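(* Let $\pi$ be an $\mathbf{mL^3}$ proof net of size $s$ and level $l$. Then, the round-by-round procedure reaches a normal form in at most $(l+1)2_{2l}^s$ steps.
   Context: Formulas of second order multiplicative exponential linear logic with paragraph ($\mathbf{meLL}$) are $A,B::=X\mid X^\perp\mid A\otimes B\mid A⅋B\mid !A\mid ?A\mid \exists X.A\mid\forall X.A\mid \S A$, where ⅋ is the multiplicative disjunction (''par''). Proofs are represented as proof nets (correct nets built from links: axiom, cut, tensor, par, for all, exists, of course, why not, flat, pax, paragraph, with exponential boxes). An indexing of a net is a function from edges to $\mathbb Z$ such that the premises and conclusions of axiom, cut, tensor, par and quantifier links have equal index, the premise of an of course, flat (dereliction) or paragraph link has index one more than its conclusion, pax links preserve the index, the conclusion of a why not link has the index of the conclusions of its premises' flat links minus one, and all conclusions of the net have the same index. $\mathbf{mL^3}$ is the system of all (untyped) $\mathbf{meLL}$ proof nets admitting an indexing. The canonical indexing is the unique indexing that is non-negative and takes value 0 somewhere in each connected component; the level of a link/box is its canonical index and the level of $\pi$ is the maximum index. The size of $\pi$ is the number of links other than auxiliary ports. The round-by-round procedure repeatedly reduces a cut of lowest level, choosing non-contractive cuts (all reducible cuts except those between an of course link and a why not link of positive arity) first, and among contractive cuts one whose box is minimal in the contractive order. Notation: $2_0^n=n$, $2_{k+1}^n=2^{2_k^n}$.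
   Formalization: Index drops once, not twice, from flat premise to why not conclusion (flat lowers by one, why not preserves), else reducts may have no indexing; canonical indexing ties the net's conclusions into one component; levels are inherited along reduction and the contractive order is made explicit. *)

(* Defs.v *)
From Stdlib Require Import Relation_Operators.
From mathcomp Require Import all_boot all_order all_algebra.

Set Implicit Arguments.
Unset Strict Implicit.
Unset Printing Implicit Defensive.

Import Order.TTheory GRing.Theory Num.Theory.

(* Untyped nets of second order multiplicative exponential linear logic with
   paragraph.

   Discharged edges and pax links. A discharged edge is the conclusion of a
   flat or pax link and the premise of a pax or why not link, so discharged
   edges form chains  flat -> pax -> ... -> pax -> why not,  with exactly one
   pax link on the border of each box which contains the flat link but not the
   why not link. A net therefore only records the why not link which ends the
   chain of each flat link f. The pax link of that chain on the border of the
   box b is the pair (f, b) (see [pax]), and the edge of that chain at a given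
   location (inside a box, or outside all boxes) is the pair of f and the
   location (see [edge]).

   Boxes. A box is named by its of course link (its principal port). *)

(* In each constructor the premises come before the conclusions. [Flat a w]
   has premise a, and its chain of discharged edges ends at the why not link
   w; the premises of a why not link are thus stored in the flat links. *)
Inductive link (W N : Type) : Type :=
| Ax of W & W
| Cut of W & W
| Tensor of W & W & W
| Par of W & W & W
| Forall of W & W
| Exists of W & W
| OfCourse of W & W
| WhyNot of W
| Flat of W & N
| Paragraph of W & W.

Arguments Ax {W N}. Arguments Cut {W N}. Arguments Tensor {W N}.
Arguments Par {W N}. Arguments Forall {W N}. Arguments Exists {W N}.
Arguments OfCourse {W N}. Arguments WhyNot {W N}. Arguments Flat {W N}.
Arguments Paragraph {W N}.

Definition map_link (W W' N N' : Type) (g : W -> W') (h : N -> N')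
    (k : link W N) : link W' N' :=
  match k with
  | Ax a b => Ax (g a) (g b)
  | Cut a b => Cut (g a) (g b)
  | Tensor a b c => Tensor (g a) (g b) (g c)
  | Par a b c => Par (g a) (g b) (g c)
  | Forall a c => Forall (g a) (g c)
  | Exists a c => Exists (g a) (g c)
  | OfCourse a c => OfCourse (g a) (g c)
  | WhyNot c => WhyNot (g c)
  | Flat a w => Flat (g a) (h w)
  | Paragraph a c => Paragraph (g a) (g c)
  end.

Definition premise_wires (W N : Type) (k : link W N) : seq W :=
  match k with
  | Ax _ _ | WhyNot _ => [::]
  | Cut a b | Tensor a b _ | Par a b _ => [:: a; b]
  | Forall a _ | Exists a _ | OfCourse a _ | Flat a _ | Paragraph a _ => [:: a]
  end.

Definition conclusion_wires (W N : Type) (k : link W N) : seq W :=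
  match k with
  | Ax a b => [:: a; b]
  | Cut _ _ | Flat _ _ => [::]
  | Tensor _ _ c | Par _ _ c | Forall _ c | Exists _ c | OfCourse _ c
  | WhyNot c | Paragraph _ c => [:: c]
  end.

Definition flat_target (W N : Type) (k : link W N) : option N :=
  if k is Flat _ w then Some w else None.

Definition is_of_course (W N : Type) (k : link W N) : bool :=
  if k is OfCourse _ _ then true else false.

Definition is_why_not (W N : Type) (k : link W N) : bool :=
  if k is WhyNot _ then true else false.

(* [wire] and [node] are finite stocks of names, for the non-discharged edges
   and for the links other than pax links. The links of the net are the nodes
   in [links]; the other nodes, and the wires which are attached to no link of
   the net, play no role. [box l] is the innermost box which contains l; the
   ports of a box are not inside it. *)
Record net := Net {
  wire : finType;
  node : finType;
  links : {set node};
  lab : node -> link wire node;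
  box : node -> option node }.

(* [inr (f, d)] is the edge at location d of the chain starting at f, where
   d = None means outside all boxes and d = Some b means immediately inside b.
   So the conclusion of f is [inr (f, box f)], and the pax link of f on the
   border of b has premise [inr (f, Some b)] and conclusion
   [inr (f, box b)]. *)
Definition edge (G : net) : finType :=
  (wire G + node G * option (node G))%type.

Section Nets.
Variable G : net.
Implicit Types (l m b c f o w : node G) (x y z : wire G).

Definition inside b l : bool :=
  [exists m, (box l == Some m)
             && connect [rel u v : node G | box u == Some v] m b].

Definition flats w : {set node G} :=
  [set f in links G | flat_target (lab f) == Some w].

(* The pax link of f on the border of b, an auxiliary port of b. *)
Definition pax f b : bool :=
  (f \in links G) &&
  if flat_target (lab f) is Some w then inside b f && ~~ inside b w else false.

Definition premises l : {set edge G} :=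
  match lab l with
  | WhyNot _ => [set inr (f, box l) | f in flats l]
  | k => [set inl x | x in premise_wires k]
  end.

Definition conclusions l : {set edge G} :=
  match lab l with
  | Flat _ _ => [set inr (l, box l)]
  | k => [set inl x | x in conclusion_wires k]
  end.

Definition edges : {set edge G} :=
  (\bigcup_(l in links G) conclusions l)
    :|: [set e | [exists f, exists b, pax f b && (e == inr (f, box b))]].

Definition all_premise_wires : seq (wire G) :=
  flatten [seq premise_wires (lab l) | l <- enum (links G)].

Definition all_conclusion_wires : seq (wire G) :=
  flatten [seq conclusion_wires (lab l) | l <- enum (links G)].

(* The conclusions of the net; none of them is discharged. *)
Definition net_conclusion (e : edge G) : bool :=
  if e is inl x then
    (x \in all_conclusion_wires) && (x \notin all_premise_wires)
  else false.

Record well_formed : Prop := WellFormed {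
  wf_conclusions : uniq all_conclusion_wires;
  wf_premises : uniq all_premise_wires;
  wf_source : {subset all_premise_wires <= all_conclusion_wires};
  wf_flat : forall f w, f \in links G -> flat_target (lab f) = Some w ->
    [/\ w \in links G, is_why_not (lab w)
      & forall b, inside b w -> inside b f];
  wf_box : forall l b, l \in links G -> box l = Some b ->
    b \in links G /\ is_of_course (lab b);
  wf_nested : forall b, b \in links G -> ~~ inside b b;
  wf_border : forall l m x, l \in links G -> m \in links G ->
    x \in conclusion_wires (lab l) -> x \in premise_wires (lab m) ->
    box l = if is_of_course (lab m) then Some m else box m;
  wf_outer : forall l x, l \in links G -> x \in conclusion_wires (lab l) ->
    x \notin all_premise_wires -> box l = None }.

(* Correctness. Since nets are untyped, for all links carry no eigenvariable
   and are not switched. *)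
Definition switching (s : node G -> edge G) : Prop :=
  forall l, l \in links G -> premises l != set0 ->
    match lab l with
    | Par _ _ _ | WhyNot _ => s l \in premises l
    | _ => True
    end.

Definition kept_edges (s : node G -> edge G) l : {set edge G} :=
  match lab l with
  | Par _ _ _ | WhyNot _ => (premises l :&: [set s l]) :|: conclusions l
  | OfCourse _ _ =>
      conclusions l :|: [set inr (f, box l) | f in [pred f | pax f l]]
  | _ => premises l :|: conclusions l
  end.

(* The incidence graph of links and edges. An of course link stands for its
   whole box: it is incident to the conclusions of the box, including those of
   the auxiliary ports, but not to its own premise. The graph is therefore the
   disjoint union of the graphs of the contents of all boxes and of the graph
   of the net outside all boxes, each with its boxes collapsed to nodes. *)
Definition switching_graph (s : node G -> edge G) : rel (node G + edge G) :=
  fun u v =>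
    match u, v with
    | inl l, inr e | inr e, inl l => (l \in links G) && (e \in kept_edges s l)
    | _, _ => false
    end.

(* A cycle of length 2 goes back and forth along one incidence. *)
Definition acyclic (T : eqType) (r : rel T) : Prop :=
  forall p : seq T, ucycle r p -> size p <= 2.

Definition correct : Prop :=
  forall s, switching s -> acyclic (switching_graph s).

Definition proof_net : Prop := well_formed /\ correct.

Definition size_net : nat := #|links G|.

Local Open Scope ring_scope.

Definition link_constraint (I : edge G -> int) l : Prop :=
  match lab l with
  | Ax a b | Cut a b => I (inl a) = I (inl b)
  | Tensor a b c | Par a b c =>
      I (inl a) = I (inl c) /\ I (inl b) = I (inl c)
  | Forall a c | Exists a c => I (inl a) = I (inl c)
  | OfCourse a c | Paragraph a c => I (inl a) = I (inl c) + 1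
  | Flat a _ => I (inl a) = I (inr (l, box l)) + 1
  | WhyNot c => forall f, f \in flats l -> I (inr (f, box l)) = I (inl c)
  end.

Record indexing (I : edge G -> int) : Prop := Indexing {
  idx_link : forall l, l \in links G -> link_constraint I l;
  idx_pax : forall f b, pax f b -> I (inr (f, Some b)) = I (inr (f, box b));
  idx_conclusions : forall e e', net_conclusion e -> net_conclusion e' ->
    I e = I e' }.

Definition mL3 : Prop := proof_net /\ exists I, indexing I.

(* Connectedness, with the conclusions of the net tied together: they have
   equal indices, so parts of the net with a conclusion cannot be shifted
   independently of each other. *)
Definition linked : rel (edge G) := fun e e' =>
  [|| [exists l in links G, (e \in premises l :|: conclusions l)
                            && (e' \in premises l :|: conclusions l)],
      [exists f, exists b, [&& pax f b,
         e \in [set inr (f, Some b); inr (f, box b)]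
         & e' \in [set inr (f, Some b); inr (f, box b)]]]
    | net_conclusion e && net_conclusion e'].

Record canonical (I : edge G -> int) : Prop := Canonical {
  can_indexing : indexing I;
  can_ge0 : forall e, e \in edges -> 0 <= I e;
  can_zero : forall e, e \in edges ->
    exists e', [/\ e' \in edges, connect linked e e' & I e' = 0] }.

(* The level of the net, for I canonical. *)
Definition level (I : edge G -> int) : nat :=
  (\max_(e in edges) `|I e|)%N.

End Nets.

(* Cut elimination. *)

Definition cut_on (G : net) (c : node G) (x y : wire G) : Prop :=
  c \in links G /\ (lab c = Cut x y \/ lab c = Cut y x).

(* The cut c on x and y, against the axiom a on y and z: the link which had
   premise z now has premise x. *)
Definition ax_reduct (G : net) (c a : node G) (x z : wire G) : net :=
  {| wire := wire G; node := node G;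
     links := links G :\: [set c; a];
     lab := fun l => map_link (fun u => if u == z then x else u) id (lab l);
     box := @box G |}.

(* The new cuts are named c and t. *)
Definition mult_reduct (G : net) (c t p : node G) (a b a' b' : wire G) : net :=
  {| wire := wire G; node := node G;
     links := links G :\ p;
     lab := fun l => if l == c then Cut a a'
                     else if l == t then Cut b b' else lab l;
     box := @box G |}.

(* Quantifier and paragraph steps. *)
Definition unary_reduct (G : net) (c m n : node G) (a b : wire G) : net :=
  {| wire := wire G; node := node G;
     links := links G :\: [set m; n];
     lab := fun l => if l == c then Cut a b else lab l;
     box := @box G |}.

(* The cut c between the of course link o, with premise a, and the why not
   link w. For each flat link f above w, a copy of the content of the box o is
   placed where f is, and f becomes a cut between the premise of f and the
   copy of a. Outside links and wires are renamed by inl; the copies made for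
   f are renamed by inr (_, f). The chains which leave the box o keep their
   final why not links, so their pax links are duplicated, extended through
   the boxes which contain f, or erased when w has arity 0. *)
Definition exp_reduct (G : net) (c o w : node G) (a : wire G) : net :=
  {| wire := (wire G + wire G * node G)%type;
     node := (node G + node G * node G)%type;
     links := [set l' : node G + node G * node G |
       match l' with
       | inl l => (l \in links G) && ~~ inside o l && (l \notin [set c; o; w])
       | inr (l, f) => [&& l \in links G, inside o l & f \in flats w]
       end];
     lab := fun l' =>
       match l' with
       | inl l =>
           match lab l with
           | Flat u v => if l \in flats w then Cut (inl u) (inr (a, l))
                         else Flat (inl u) (inl v)
           | k => map_link inl inl k
           end
       | inr (l, f) =>
           map_link (fun u => inr (u, f))
                    (fun v => if inside o v then inr (v, f) else inl v) (lab l)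
       end;
     box := fun l' =>
       match l' with
       | inl l => omap inl (box l)
       | inr (l, f) => if box l == Some o then omap inl (box f)
                       else omap (fun b => inr (b, f)) (box l)
       end |}.

Definition exp_residual (G : net) (u : wire G + wire G * node G) : wire G :=
  match u with inl x => x | inr (x, _) => x end.

(* [step c G' r]: G' is obtained by reducing the cut c, and r sends each wire
   of G' to the wire of G of which it is a residual. The remaining cuts (those
   between links which are not dual) are irreducible. *)
Inductive step (G : net) (c : node G) :
    forall G' : net, (wire G' -> wire G) -> Prop :=
| AxStep x y z a : cut_on c x y -> a \in links G ->
    lab a = Ax y z \/ lab a = Ax z y ->
    @step G c (ax_reduct c a x z) (fun u => u)
| MultStep x y t p a b a' b' : cut_on c x y ->
    t \in links G -> lab t = Tensor a b x ->
    p \in links G -> lab p = Par a' b' y ->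
    @step G c (mult_reduct c t p a b a' b') (fun u => u)
| QuantStep x y m n a b : cut_on c x y ->
    m \in links G -> lab m = Forall a x ->
    n \in links G -> lab n = Exists b y ->
    @step G c (unary_reduct c m n a b) (fun u => u)
| ParagraphStep x y m n a b : cut_on c x y ->
    m \in links G -> lab m = Paragraph a x ->
    n \in links G -> lab n = Paragraph b y ->
    @step G c (unary_reduct c m n a b) (fun u => u)
| ExpStep x y o w a : cut_on c x y ->
    o \in links G -> lab o = OfCourse a x ->
    w \in links G -> lab w = WhyNot y ->
    @step G c (exp_reduct c o w a) (@exp_residual G).

Definition reducible (G : net) (c : node G) : Prop :=
  exists G' (r : wire G' -> wire G), step c r.

Definition normal (G : net) : Prop := forall c : node G, ~ reducible c.

(* c is a contractive cut, between the box o and the why not link w. *)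
Definition contractive (G : net) (c o w : node G) : Prop :=
  exists x y a,
    [/\ cut_on c x y,
        o \in links G /\ lab o = OfCourse a x,
        w \in links G /\ lab w = WhyNot y
      & flats w != set0].

Section RoundByRound.
Variables (G : net) (lev : wire G -> int).
Implicit Types c o w : node G.

Definition cut_level c : int := if lab c is Cut x _ then lev x else 0%R.

(* The contractive order, on the boxes involved in contractive cuts of level
   i, is the reflexive transitive closure of the following relation: o comes
   before o' when an auxiliary port of o is above the why not link cut against
   o' (reducing o changes the arity of that link), or when the cut on o is
   inside o' (reducing o' duplicates that cut). *)
Definition contractive_before (i : int) o o' : Prop :=
  exists c w c' w',
    [/\ contractive c o w /\ cut_level c = i,
        contractive c' o' w' /\ cut_level c' = i
      & (exists2 f, f \in flats w' & pax f o) \/ inside o' c].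

Definition contractive_le (i : int) : node G -> node G -> Prop :=
  clos_refl_trans _ (contractive_before i).

Definition minimal_box (i : int) o : Prop :=
  forall o', contractive_le i o' o -> o' = o.

Definition chosen c : Prop :=
  [/\ reducible c,
      forall c', reducible c' -> (cut_level c <= cut_level c')%R
    & forall o w, contractive c o w ->
        minimal_box (cut_level c) o /\
        forall c', reducible c' -> cut_level c' = cut_level c ->
          exists o' w', contractive c' o' w'].

End RoundByRound.

(* The round-by-round procedure, started on G with levels lev, always reaches
   a normal form, in at most n steps. Edges of a reduct keep the level of the
   edge of which they are residuals. *)
Fixpoint normalizes_within (n : nat) (G : net) (lev : wire G -> int) : Prop :=
  normal G \/
  if n is n'.+1 then
    (exists c, chosen lev c) /\
    forall c G' (r : wire G' -> wire G), chosen lev c -> step c r ->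
      normalizes_within n' (fun u => lev (r u))
  else False.

(* 2_k^n *)
Definition tower (k n : nat) : nat := iter k (expn 2) n.

(* Main.v *)
From Stdlib Require Import Relation_Operators.
Require Import Defs.
From mathcomp Require Import all_boot all_order all_algebra.
From mathcomp Require Import zify.

Set Implicit Arguments.
Unset Strict Implicit.
Unset Printing Implicit Defensive.

Import Order.TTheory GRing.Theory Num.Theory.

(* A step on a cut of level i creates cuts of level at least i only, so the
   procedure runs through the levels 0, ..., l in order. At level i, a net of
   size s first undergoes non-contractive steps, which decrease the size. A
   contractive step creates no cut of level i, since the box it copies, being
   minimal, contains none; hence it decreases the number k of reducible cuts of
   level i, and it at most squares the size. As 2 k <= s, the round has at most
   s steps and yields a net of size at most s ^ (2 ^ k) <= 2 ^ (2 ^ s).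

   The point is that a minimal box always exists: a cycle of the contractive
   order would be a cycle of the net, so correctness must be preserved by the
   steps. A switching graph is acyclic iff it has no core, that is, no nonempty
   set of vertices each of which has two neighbours in the set; a core of the
   reduct is turned into a core of the net, with the help of walks inside the
   part which is common to both. *)

(** * Graphs of minimal degree two *)

(** The factor [l + 1] counts one round for each of the levels 0, ..., l. Round i starts from a net
    of size at most [tower (2 * i) s], takes at most as many steps as this size, and adds two
    exponentials to the bound. Correctness is the obstacle. A cycle of the reduct need not come from
    a cycle of the net: it may use both cuts left by a tensor against a par, although a switching
    keeps only one premise of the par, and it may cross several copies of one box. In both cases
    only a piece of it is lifted, a walk through the common part which stops as soon as it meets the
    redex again; the redex then closes it up. Cores replace cycles because vertices can be added to
    a set, or preimages taken, without arranging them in a simple closed sequence. A switching is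
    likewise reduced to what it says about a core: at most one premise of each par or why not link
    belongs to it. Since a box is a single node of the graph around it, each location is treated
    separately. *)

Section Degree.
Variables (T : finType) (r : rel T).
Implicit Types (S K : {set T}) (v : T).

Definition deg2 S v : Prop :=
  exists u1 u2, [/\ u1 \in S, u2 \in S, u1 != u2, r v u1 & r v u2].

Lemma deg2_sub K S v : K \subset S -> deg2 K v -> deg2 S v.
Proof.
move=> sKS [u1 [u2 [K1 K2 ne r1 r2]]].
by exists u1, u2; split; rewrite ?(subsetP sKS).
Qed.

Lemma deg2_avoid S v z : deg2 S v -> exists u, [/\ u \in S, u != z & r v u].
Proof.
case=> u1 [u2 [S1 S2 ne r1 r2]].
have [e1|n1] := eqVneq u1 z; last by exists u1.
by exists u2; split => //; rewrite -e1 eq_sym.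
Qed.

Lemma deg2_cons S v u z :
  u \in S -> r v u -> z \in S -> r v z -> u != z -> deg2 S v.
Proof. by move=> *; exists u, z. Qed.

(* Walk from [p0] without turning back: since the vertices met before [Stop]
   have another neighbour, either the walk meets itself, or it reaches
   [Stop]. *)
Lemma walk_or_cycle : symmetric r -> irreflexive r ->
  forall n S (Stop : {set T}) p0, #|S| <= n -> p0 \in S ->
  (exists2 u, u \in S & r p0 u) ->
  (forall v, v \in S -> v != p0 -> v \notin Stop -> deg2 S v) ->
  (exists p, [/\ ucycle r p, 2 < size p, {subset p <= S}
    & forall v, v \in p -> deg2 [set x in p] v]) \/
  (exists p q, [/\ path r p0 p /\ uniq (p0 :: p),
     [/\ q = last p0 p, q \in Stop & q != p0],
     (p0 \in p0 :: p) /\ {subset p0 :: p <= S},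
     (forall v, v \in p0 :: p -> v \in Stop -> v = p0 \/ v = q) /\
     (exists2 u, u \in p0 :: p & r p0 u) /\ (exists2 u, u \in p0 :: p & r q u)
    & forall v, v \in p0 :: p -> v != p0 -> v != q ->
        deg2 [set x in p0 :: p] v]).
Proof.
move=> rC rI; elim=> [|n IH] S Stop p0 leS p0S [p1 p1S r01] degS.
  by move: leS; rewrite leqn0 => /eqP/cards0_eq eS; rewrite eS inE in p0S.
have p1n0 : p1 != p0 by apply: contraTneq r01 => ->; rewrite rI.
have [p1St|p1nSt] := boolP (p1 \in Stop).
  right; exists [:: p1], p1; split => //=; first by rewrite r01 inE eq_sym p1n0.
  - by split; [rewrite inE eqxx | move=> z; rewrite !inE => /orP[]/eqP->].
  - split; first by move=> v; rewrite !inE => /orP[]/eqP->; [left | right].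
    split; first by exists p1; rewrite ?inE ?eqxx ?orbT.
    by exists p0; rewrite ?inE ?eqxx // rC.
  - by move=> v; rewrite !inE => /orP[]/eqP->; rewrite eqxx.
(* Without [p0], whose neighbours become stops, a walk from [p1] ends in [Stop] or at a neighbour of
   [p0]; in the second case [p0] closes a cycle. *)
pose S1 := S :\ p0; pose Stop1 := Stop :|: [set u | r p0 u].
have leS1 : #|S1| <= n by move: leS; rewrite (cardsD1 p0) p0S.
have p1S1 : p1 \in S1 by rewrite !inE p1n0.
have [|v|[p [cyc sz sub deg]]|[p [q [[pth unq] [eq_q qSt qn1] [_ sub] [stp [[u1
    u1p r1u1] [u2 u2p rqu2]]] deg]]]]
    := IH S1 Stop1 p1 leS1 p1S1.
- have [u [uS un0 r1u]] := deg2_avoid p0 (degS p1 p1S p1n0 p1nSt).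
  by exists u; rewrite // !inE un0.
- rewrite !inE negb_or => /andP[vn0 vS] _ /andP[vnSt nr0v].
  have [u1 [u2 [S1u S2u ne rv1 rv2]]] := degS v vS vn0 vnSt.
  exists u1, u2; split=> //; rewrite !inE ?S1u ?S2u andbT.
    by apply: contraNneq nr0v => <-; rewrite rC.
  by apply: contraNneq nr0v => <-; rewrite rC.
- by left; exists p; split=> // x /sub; rewrite !inE => /andP[].
have p0np : p0 \notin p1 :: p.
  by apply/negP => /sub; rewrite !inE eqxx.
have subS : {subset p0 :: p1 :: p <= S}.
  by move=> x; rewrite inE => /predU1P[->//|/sub]; rewrite !inE => /andP[].
have inp x : x \in p1 :: p -> x \in [set x in p0 :: p1 :: p].
  by move=> xp; rewrite inE in_cons xp orbT.
have inp0 : p0 \in [set x in p0 :: p1 :: p] by rewrite inE mem_head.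
have degp1 : deg2 [set x in p0 :: p1 :: p] p1.
  exists p0, u1; split=> //; [exact: inp | | by rewrite rC].
  by apply: contraNneq p0np => ->.
have degp v : v \in p1 :: p -> v != p1 -> v != q ->
    deg2 [set x in p0 :: p1 :: p] v.
  move=> vp n1 nq; apply: deg2_sub (deg v vp n1 nq).
  by apply/subsetP => x; rewrite !inE => ->; rewrite orbT.
have qp : q \in p1 :: p by rewrite eq_q mem_last.
have u2np0 : u2 != p0 by apply: contraNneq p0np => <-.
have [qSt1|qnSt] := boolP (q \in Stop).
  right; exists (p1 :: p), q; split=> //.
  - by rewrite /= r01 pth; split=> //; move: unq => /= ->; rewrite p0np.
  - by split=> //; apply: contraNneq p0np => <-.
  - by split=> //; rewrite inE eqxx.
  - split.
      move=> v; rewrite inE => /predU1P[->|vp vSt]; first by left.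
      have : v \in Stop1 by rewrite inE vSt.
      case/(stp v vp) => [ev|]; last by right.
      by move: vSt; rewrite ev (negbTE p1nSt).
    split; first by exists p1; rewrite ?inE ?eqxx ?orbT.
    by exists u2; rewrite // inE u2p orbT.
  - move=> v; rewrite inE => /predU1P[->|vp]; first by rewrite eqxx.
    by have [->|n1] := eqVneq v p1 => // _ nq; apply: degp.
(* Here [q] is a neighbour of [p0] other than [p1], so the cycle has more than two vertices. *)
left; exists (p0 :: p1 :: p).
have r0q : r p0 q by move: qSt; rewrite !inE (negbTE qnSt).
split=> //.
- rewrite /ucycle /= r01 rcons_path pth -eq_q rC r0q /=.
  by rewrite p0np; move: unq => /=.
- by clear - eq_q qn1; case: p eq_q qn1 => //= ->; rewrite eqxx.
move=> v; rewrite inE => /predU1P[->|vp].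
  exists p1, q; split=> //; [exact/inp/mem_head | exact: inp |].
  by rewrite eq_sym.
have [->//|n1] := eqVneq v p1.
have [->|nq] := eqVneq v q; last exact: degp.
by exists p0, u2; split=> //; [exact: inp | rewrite eq_sym | rewrite rC].
Qed.

(** The form used for the steps: in the second case only the ends [p0] and [q] may lack a second
    neighbour, and only they may lie in [Stop]. Giving each end one more neighbour outside [K]
    completes a core. *)
Lemma walk_or_core S (Stop : {set T}) p0 :
  symmetric r -> irreflexive r -> p0 \in S ->
  (exists2 u, u \in S & r p0 u) ->
  (forall v, v \in S -> v != p0 -> v \notin Stop -> deg2 S v) ->
  (exists K, [/\ K \subset S, K != set0 & forall v, v \in K -> deg2 K v]) \/
  (exists K q, [/\ K \subset S, p0 \in K,
     [/\ q \in K, q \in Stop & q != p0],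
     (forall v, v \in K -> v \in Stop -> v = p0 \/ v = q) /\
     (exists2 u, u \in K & r p0 u) /\ (exists2 u, u \in K & r q u)
    & forall v, v \in K -> v != p0 -> v != q -> deg2 K v]).
Proof.
move=> rC rI p0S n0 degS.
have [[p [cyc sz sub deg]]|] := walk_or_cycle rC rI (leqnn _) p0S n0 degS.
  left; exists [set x in p]; split.
  - by apply/subsetP => x; rewrite inE => /sub.
  - by case: p sz {cyc sub deg} => //= a p _; apply/set0Pn; exists a; rewrite !inE eqxx.
  - by move=> v; rewrite inE => /deg.
case=> p [q [_ [eq_q qSt qn] [p0p sub] [stp [[u1 u1p r1] [u2 u2p r2]]] deg]].
right; exists [set x in p0 :: p], q; split.
- by apply/subsetP => x; rewrite inE => /sub.
- by rewrite inE.
- by split=> //; rewrite inE eq_q mem_last.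
- split; first by move=> v; rewrite inE; apply: stp.
  by split; [exists u1 | exists u2]; rewrite // inE.
- by move=> v; rewrite inE; apply: deg.
Qed.

(* A finite forest with an edge has at least two leaves. *)
Lemma core_but_one S p0 : symmetric r -> irreflexive r -> S != set0 ->
  (forall v, v \in S -> v != p0 -> deg2 S v) ->
  (p0 \in S -> exists2 u, u \in S & r p0 u) ->
  exists K, [/\ K \subset S, K != set0 & forall v, v \in K -> deg2 K v].
Proof.
move=> rC rI Sn0 deg n0.
have [p0S|p0nS] := boolP (p0 \in S); last first.
  by exists S; split=> // v vS; apply: deg => //; apply: contraNneq p0nS => <-.
have := @walk_or_core S set0 p0 rC rI p0S (n0 p0S).
by case=> [v vS vn _|//|[K [q [_ _ []]]]]; [exact: deg | rewrite inE].
Qed.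

(** With nowhere to stop, the walk can only meet itself. *)
Lemma core_cycle S : symmetric r -> irreflexive r -> S != set0 ->
  (forall v, v \in S -> deg2 S v) ->
  exists p, [/\ ucycle r p, 2 < size p & {subset p <= S}].
Proof.
move=> rC rI /set0Pn[p0 p0S] deg.
have n0 : exists2 u, u \in S & r p0 u.
  by have [u [uS _ ru]] := deg2_avoid p0 (deg _ p0S); exists u.
have := @walk_or_cycle rC rI _ S set0 p0 (leqnn _) p0S n0.
case=> [v vS _ _|[p [? ? ? _]]|[p [q [_ [_]]]]]; first exact: deg.
  by exists p.
by rewrite inE.
Qed.

End Degree.

(** The map [h] may depend on [v]: it has to tell apart only the neighbours of one vertex. *)
Lemma deg2_map (T T' : finType) (r : rel T) (r' : rel T') (S : {set T})
    (S' : {set T'}) (h : T' -> T) v v' : deg2 r' S' v' ->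
  (forall u1 u2, u1 \in S' -> u2 \in S' -> r' v' u1 -> r' v' u2 ->
     h u1 = h u2 -> u1 = u2) ->
  (forall u, u \in S' -> r' v' u -> h u \in S /\ r v (h u)) ->
  deg2 r S v.
Proof.
case=> u1 [u2 [S1 S2 ne r1 r2]] inj hS.
have [hS1 hr1] := hS _ S1 r1; have [hS2 hr2] := hS _ S2 r2.
exists (h u1), (h u2); split=> //.
by apply: contraNneq ne => /inj ->.
Qed.

Lemma uniq_flatten_mem (T T' : eqType) (F : T -> seq T') s l m x :
  uniq (flatten [seq F i | i <- s]) -> l \in s -> m \in s ->
  x \in F l -> x \in F m -> l = m.
Proof.
have notin k t : x \in F k -> k \in t ->
    x \in flatten [seq F i | i <- t].
  by move=> xF kt; apply/flattenP; exists (F k) => //; apply: map_f.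
elim: s => //= k s IH; rewrite cat_uniq => /and3P[_ /hasPn dis us].
rewrite !inE => /predU1P[->|ls] /predU1P[->|ms] // xl xm.
- by have /negP[] := dis x (notin _ _ xm ms).
- by have /negP[] := dis x (notin _ _ xl ls).
- exact: IH.
Qed.

Lemma uniq_flatten_each (T T' : eqType) (F : T -> seq T') s l :
  uniq (flatten [seq F i | i <- s]) -> l \in s -> uniq (F l).
Proof.
elim: s => //= k s IH; rewrite cat_uniq => /and3P[uk _ us].
by rewrite inE => /predU1P[->|ls] //; apply: IH.
Qed.

(** * Boxes *)

Section Boxes.
Variable G : net.
Implicit Types (l m b c f o w : node G) (x y z : wire G) (d : option (node G)).

(** [inside] is defined by reachability; this form gives inductions which climb out one box at a
    time. *)
Inductive in_box b l : Prop :=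
| InBoxHere of box l = Some b
| InBoxDeeper m of box l = Some m & in_box b m.

Lemma insideP b l : reflect (in_box b l) (inside b l).
Proof.
apply: (iffP existsP) => [[m /andP[/eqP lm /connectP[p]]]|].
  elim: p m l lm => [|n p IH] m l lm /=; first by move=> _ ->; left.
  by case/andP=> /eqP mn pth eb; right with m => //; apply: IH pth eb.
elim=> {l}[l lb|l m lm _ [n /andP[/eqP mn cn]]].
  by exists b; rewrite lb eqxx connect0.
exists m; rewrite lm eqxx; apply: connect_trans cn; apply: connect1.
by rewrite /= mn.
Qed.

Lemma inside_here b l : box l = Some b -> inside b l.
Proof. by move=> lb; apply/insideP; left. Qed.

Lemma inside_step b l m : box l = Some m -> inside b l = (m == b) || inside b m.
Proof.
move=> lm; apply/insideP/orP => [[lb|n ln bn]|[/eqP<-|/insideP bm]].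
- by left; move: lb; rewrite lm => -[->].
- by right; apply/insideP; move: ln; rewrite lm => -[->].
- by left.
- by right with m.
Qed.

Lemma inside_out b l : box l = None -> inside b l = false.
Proof. by move=> l0; apply/insideP => -[|m]; rewrite l0. Qed.

Lemma inside_box b l m : box l = box m -> inside b l = inside b m.
Proof.
case E: (box m) => [n|] lm.
  by rewrite (inside_step _ lm) (inside_step _ E).
by rewrite !inside_out.
Qed.

Lemma inside_trans b m l : inside b m -> inside m l -> inside b l.
Proof.
move=> bm /insideP; elim=> {l}[l lm|l n ln _ IH].
  by rewrite (inside_step _ lm) bm orbT.
by rewrite (inside_step _ ln) IH orbT.
Qed.

(** A link has a single innermost box, so the boxes around it form a chain. *)
Lemma inside_comparable b b' l :
  inside b l -> inside b' l -> [\/ b = b', inside b b' | inside b' b].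
Proof.
move/insideP; elim=> {l}[l lb|l n ln bn IH].
  by rewrite (inside_step _ lb) => /orP[/eqP->|]; [constructor 1 | constructor 3].
rewrite (inside_step _ ln) => /orP[/eqP<-|/IH //].
by constructor 2; apply/insideP.
Qed.

(** The invariant of the steps on the shape of nets. Uniqueness is stated link by link, since the
    lists of [well_formed] depend on an enumeration of the links, which changes at each step. *)
Record tidy : Prop := Tidy {
  tidy_concl : forall l m x, l \in links G -> m \in links G ->
    x \in conclusion_wires (lab l) -> x \in conclusion_wires (lab m) -> l = m;
  tidy_uniq_concl : forall l, l \in links G -> uniq (conclusion_wires (lab l));
  tidy_prem : forall l m x, l \in links G -> m \in links G ->
    x \in premise_wires (lab l) -> x \in premise_wires (lab m) -> l = m;
  tidy_uniq_prem : forall l, l \in links G -> uniq (premise_wires (lab l));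
  tidy_flat : forall f w, f \in links G -> flat_target (lab f) = Some w ->
    [/\ w \in links G, is_why_not (lab w)
      & forall b, inside b w -> inside b f];
  tidy_box : forall l b, l \in links G -> box l = Some b ->
    b \in links G /\ is_of_course (lab b);
  tidy_nested : forall b, b \in links G -> ~~ inside b b;
  tidy_border : forall l m x, l \in links G -> m \in links G ->
    x \in conclusion_wires (lab l) -> x \in premise_wires (lab m) ->
    box l = if is_of_course (lab m) then Some m else box m }.

Lemma well_formed_tidy : well_formed G -> tidy.
Proof.
case=> uc up _ wf wb wn wbd _.
split=> //.
- by move=> l m x lG mG; apply: uniq_flatten_mem uc _ _; rewrite mem_enum.
- by move=> l lG; apply: uniq_flatten_each uc _; rewrite mem_enum.
- by move=> l m x lG mG; apply: uniq_flatten_mem up _ _; rewrite mem_enum.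
- by move=> l lG; apply: uniq_flatten_each up _; rewrite mem_enum.
Qed.

Hypothesis tG : tidy.

Lemma inside_links b l : l \in links G -> inside b l ->
  b \in links G /\ is_of_course (lab b).
Proof.
move=> lG /insideP bl; elim: bl lG => {l}[l lb|l m lm _ IH] lG.
  exact: tidy_box lb.
by apply: IH; case: (tidy_box tG lG lm).
Qed.

(** Two distinct innermost boxes would each lie inside the other, hence inside themselves. *)
Lemma box_eq_inside l m : l \in links G -> m \in links G ->
  (forall b, inside b l = inside b m) -> box l = box m.
Proof.
move=> lG mG eq.
case El: (box l) => [b|]; last first.
  case Em: (box m) => [b|//].
  by move: (eq b); rewrite (inside_here Em) (inside_out _ El).
have bl := inside_here El; have bm := bl; rewrite eq in bm.
have [bG _] := inside_links lG bl.
case Em: (box m) => [b'|]; last by rewrite (inside_out _ Em) in bm.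
move: (bm); rewrite (inside_step _ Em) => /orP[/eqP->//|bb'].
have: inside b' l by rewrite eq inside_here.
rewrite (inside_step _ El) => /orP[/eqP->//|b'b].
by have := tidy_nested tG bG; rewrite (inside_trans bb' b'b).
Qed.

(** Of two distinct boxes around [l], one is inside the other, which at equal locations puts it
    inside itself. Hence a chain leaves at most one box at each location. *)
Lemma sibling_boxes b b' l : l \in links G -> inside b l -> inside b' l ->
  box b = box b' -> b = b'.
Proof.
move=> lG bl b'l bb'.
have [bG _] := inside_links lG bl; have [b'G _] := inside_links lG b'l.
have [//|i|i] := inside_comparable bl b'l.
  by have := tidy_nested tG bG; rewrite (inside_box _ bb') i.
by have := tidy_nested tG b'G; rewrite -(inside_box _ bb') i.
Qed.

End Boxes.

(** * Correctness as the absence of cores *)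

Section Cores.
Variable G : net.

(* The vertices of the incidence graph at a fixed location: [inr (inr f)] is
   the edge of the chain of [f] at this location. *)
Definition vertex : finType := (node G + (wire G + node G))%type.

Implicit Types (l m b c f o w : node G) (x y z : wire G) (d : option (node G))
  (e : wire G + node G) (S K : {set vertex}).

(** There is one graph for each location, so that [inr f] is unambiguous. As in [switching_graph],
    an of course link stands for its box: it touches the conclusions of its auxiliary ports but not
    its own premise, which lies at the location inside. *)
Definition incident d l e : bool :=
  [&& l \in links G, box l == d &
    match e with
    | inl x => (x \in premise_wires (lab l)) && ~~ is_of_course (lab l)
               || (x \in conclusion_wires (lab l))
    | inr f =>
        match lab l with
        | Flat _ _ => f == l
        | OfCourse _ _ => pax f l
        | WhyNot _ => f \in flats l
        | _ => false
        end
    end].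

Definition adj d : rel vertex := fun u v =>
  match u, v with
  | inl l, inr e | inr e, inl l => incident d l e
  | _, _ => false
  end.

Lemma adj_sym d : symmetric (adj d). Proof. by case=> [l|e] [m|e']. Qed.
Lemma adj_irr d : irreflexive (adj d). Proof. by case. Qed.

Definition switched_premise l e : bool :=
  match lab l, e with
  | Par a b _, inl x => (x == a) || (x == b)
  | WhyNot _, inr f => f \in flats l
  | _, _ => false
  end.

(** Replaces the choice of a switching: under this condition some switching keeps every premise that
    [S] uses. *)
Definition one_premise S : Prop := forall l e e', inl l \in S ->
  inr e \in S -> inr e' \in S ->
  switched_premise l e -> switched_premise l e' -> e = e'.

Definition core d S : Prop :=
  [/\ S != set0, one_premise S & forall v, v \in S -> deg2 (adj d) S v].

Definition coreless : Prop := forall d S, ~ core d S.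

Lemma one_premise_sub K S : K \subset S -> one_premise S -> one_premise K.
Proof. by move=> /subsetP sKS oS l e e' /sKS ? /sKS ? /sKS ?; apply: oS. Qed.

(** Serves to show that a part of a core with a single exit is empty. *)
Lemma coreless_but_one d S p0 : coreless -> one_premise S ->
  (forall v, v \in S -> v != p0 -> deg2 (adj d) S v) ->
  (p0 \in S -> exists2 u, u \in S & adj d p0 u) -> S = set0.
Proof.
move=> nc oS deg n0; apply/eqP; apply/negPn/negP => Sn0.
have [K [KS Kn0 degK]] := core_but_one (@adj_sym d) (@adj_irr d) Sn0 deg n0.
by case: (nc d K); split=> //; apply: one_premise_sub oS.
Qed.

Lemma switched_premiseP l e : switched_premise l e ->
  match e with inl x => x \in premise_wires (lab l) | inr f => f \in flats l end.
Proof.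
rewrite /switched_premise; case: e => x; case: (lab l) => //= a b _.
by rewrite !inE.
Qed.

Lemma flatsP f w : reflect (f \in links G /\ flat_target (lab f) = Some w)
  (f \in flats w).
Proof. by rewrite inE; apply: (iffP andP) => -[fG /eqP]. Qed.

Lemma flat_labP l v : flat_target (lab l) = Some v -> exists u, lab l = Flat u v.
Proof. by case: (lab l) => //= u _ [->]; exists u. Qed.

Lemma paxP f b : reflect (exists w, [/\ f \in links G,
   flat_target (lab f) = Some w, inside b f & ~~ inside b w]) (pax f b).
Proof.
rewrite /pax; apply: (iffP andP) => [[fG]|[w [fG -> fb wb]]].
  by case: (flat_target (lab f)) => // w /andP[]; exists w.
by rewrite fb wb.
Qed.

Hypothesis tG : tidy G.

(** Besides its why not link, a chain edge touches its flat link or the box which it leaves. Two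
    such boxes at one location coincide by [sibling_boxes], and a box is never at the location of a
    link inside it. *)
Lemma incident_source d l m f : incident d l (inr f) -> incident d m (inr f) ->
  ~~ is_why_not (lab l) -> ~~ is_why_not (lab m) -> l = m.
Proof.
case/and3P=> lG /eqP ld lf /and3P[mG /eqP md mf].
have noself b g : pax g b -> box b = box g -> false.
  move=> /paxP[w [gG _ bg _]] bb; have [bG _] := inside_links tG gG bg.
  by have := tidy_nested tG bG; rewrite (inside_box _ bb) bg.
have eqb : box l = box m by rewrite ld md.
case El: (lab l) lf => //=; case Em: (lab m) mf => //= pm pl _ _.
- case/paxP: pm => w [fG _ fm _]; case/paxP: pl => w' [_ _ fl _].
  exact: (sibling_boxes tG fG fl fm eqb).
- by rewrite (eqP pm) in pl; have := noself _ _ pl eqb.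
- by rewrite (eqP pl) in pm; have := noself _ _ pm (esym eqb).
- by rewrite -(eqP pm) (eqP pl).
Qed.

Lemma adj_links d l e : adj d (inl l) (inr e) -> l \in links G /\ box l = d.
Proof. by case/and3P=> ? /eqP. Qed.

Lemma core_link d S l : core d S -> inl l \in S -> l \in links G /\ box l = d.
Proof.
by case=> _ _ deg lS; have [[m|e] [? [_ _ _ //]]] := deg _ lS => /adj_links.
Qed.

Lemma incident_flat d l f : incident d l (inr f) ->
  f \in links G /\ exists w, flat_target (lab f) = Some w.
Proof.
case/and3P=> lG _; case E: (lab l) => [||||||a c|c|a v|] //.
- by case/paxP=> w []; split=> //; exists w.
- by move/flatsP=> [fG fc]; split=> //; exists l.
- by move/eqP=> ->; rewrite lG E; split=> //; exists v.
Qed.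

(** A chain edge has at most two ends at a location, so a core which uses it contains both. *)
Lemma core_chain d S f : core d S -> inr (inr f) \in S ->
  f \in links G /\ exists l w, [/\ inl l \in S, incident d l (inr f),
    ~~ is_why_not (lab l), f \in flats w & inl w \in S].
Proof.
case=> _ _ deg fS; have [[l1|?] [[l2|?] [S1 S2 ne //= r1 r2]]] := deg _ fS.
have [fG [w fw]] := incident_flat r1.
have tgt l : incident d l (inr f) -> is_why_not (lab l) -> f \in flats l.
  by case/and3P=> _ _; case: (lab l).
split=> //.
have [w1|n1] := boolP (is_why_not (lab l1));
    have [w2|n2] := boolP (is_why_not (lab l2)).
- have /flatsP[_ t1] := tgt _ r1 w1; have /flatsP[_ t2] := tgt _ r2 w2.
  by move: t1 ne; rewrite t2 => -[->]; rewrite eqxx.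
- by exists l2, l1; split=> //; apply: tgt.
- by exists l1, l2; split=> //; apply: tgt.
- by move: ne; rewrite (incident_source r1 r2 n1 n2) eqxx.
Qed.

End Cores.

Section Correct.
Variables (G : net).

(** The switching keeps the premise which belongs to the core. The cycle given by [core_cycle] then
    survives in the switching graph, where the edge [inr f] becomes [inr (f, d)]. *)
Lemma correct_coreless : correct G -> coreless G.
Proof.
move=> cG d S coreS; have [Sn0 oS deg] := coreS.
pose put (e : wire G + node G) : edge G :=
  match e with inl x => inl x | inr f => inr (f, d) end.
have put_inj : injective put.
  by move=> [x|f] [y|g] //= => [[->]|[->]].
(* Outside the core any premise will do; the last default concerns links without premises, on which
   a switching is free. *)
pose s l : edge G :=
  if [pick e | [&& box l == d, inr e \in S & switched_premise l e]] is Some e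
  then put e
  else if [pick e in premises l] is Some e then e else put (inr l).
have put_prem l e : box l = d -> switched_premise l e -> put e \in premises l.
  move=> ld; rewrite /switched_premise /premises.
  case: (lab l) => //= [a b c|c]; case: e => //= z.
    by rewrite -in_set2 => zab; apply: imset_f; rewrite !inE in zab *.
  by rewrite ld => zf; apply/imsetP; exists z.
have sP : switching s.
  move=> l lG /set0Pn[e0 e0p].
  suff sl : s l \in premises l by case: (lab l).
  rewrite /s; case: pickP => [e /and3P[/eqP ld _ le]|_]; first exact: put_prem.
  by case: pickP => [//|/(_ e0)]; rewrite e0p.
have s_eq l e : inl l \in S -> box l = d -> inr e \in S ->
    switched_premise l e -> s l = put e.
  move=> lS ld eS le; rewrite /s; case: pickP => [e' /and3P[_ e'S le']|/(_ e)].
    by rewrite (oS _ _ _ lS eS e'S le le').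
  by rewrite ld eqxx eS le.
pose h (v : vertex G) : node G + edge G :=
  match v with inl l => inl l | inr e => inr (put e) end.
have h_inj : injective h.
  by move=> [l|e] [m|e'] //= => [[->]|[/put_inj->]].
have inc l e : inl l \in S -> inr e \in S -> incident d l e ->
    (l \in links G) && (put e \in kept_edges s l).
  move=> lS eS /and3P[-> /eqP ld] /=.
  have sl := s_eq l e lS ld eS.
  have pl := put_prem l e ld; move: sl pl.
  rewrite /kept_edges /switched_premise /premises /conclusions.
  have inlE (t : seq (wire G)) x :
      (inl x : edge G) \in [set inl y | y in t] = (x \in t).
    apply/imsetP/idP => [[y yt [->]]//|xt]; by exists x.
  case: (lab l) => /= [a b|a b|a b c|a b c|a c|a c|a c|c|a w|a c];
    case: e eS => [x|f] eS /=; rewrite ?inE ?inlE ?inE ?andbT ?andbF ?orbF //=.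
  - by move=> sl pl /orP[xp|->]; rewrite ?orbT // xp (sl xp) eqxx.
  - by move=> _ _ ->.
  - move=> _ _ fl; apply/orP; right; apply/imsetP; exists f; first by rewrite inE.
    by rewrite ld.
  - by move=> _ _ ->; rewrite orbT.
  - by move=> sl pl fl; rewrite (pl fl) (sl fl) eqxx.
  - by move=> _ _ /eqP->; rewrite ld eqxx orbT.
have h_adj u v : u \in S -> v \in S -> adj d u v ->
    switching_graph s (h u) (h v).
  by case: u v => [l|e] [m|e'] //= ? ?; apply: inc.
have [p [/andP[cyc unq] sz sub]] := core_cycle (@adj_sym _ d) (@adj_irr _ d) Sn0 deg.
suff /(cG s sP) : ucycle (switching_graph s) (map h p).
  by rewrite size_map leqNgt sz.
rewrite /ucycle (map_inj_uniq h_inj) unq andbT.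
case: p cyc sub {sz unq} => //= v p.
have {}sub : {subset v :: p <= S} -> {subset v :: rcons p v <= S}.
  by move=> sub x; rewrite inE mem_rcons inE => /or3P[/eqP->|/eqP->|xp];
    apply: sub; rewrite inE ?eqxx ?xp ?orbT.
rewrite -map_rcons => pth /sub {}sub.
have gen q w : path (adj d) w q -> {subset w :: q <= S} ->
    path (switching_graph s) (h w) (map h q).
  elim: q w => //= u q IH w /andP[wu uq] qS.
  have wS : w \in S by apply: qS; rewrite mem_head.
  have uS : u \in S by apply: qS; rewrite in_cons mem_head orbT.
  by rewrite h_adj //=; apply: IH uq _ => x xq; apply: qS; rewrite in_cons xq orbT.
exact: gen.
Qed.
End Correct.

Lemma map_link_premises (W W' N N' : Type) (g : W -> W') (h : N -> N')
    (k : link W N) : premise_wires (map_link g h k) = map g (premise_wires k).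
Proof. by case: k. Qed.

Lemma map_link_conclusions (W W' N N' : Type) (g : W -> W') (h : N -> N')
    (k : link W N) :
  conclusion_wires (map_link g h k) = map g (conclusion_wires k).
Proof. by case: k. Qed.

Lemma map_link_flat (W W' N N' : Type) (g : W -> W') (h : N -> N')
    (k : link W N) : flat_target (map_link g h k) = omap h (flat_target k).
Proof. by case: k. Qed.

Lemma map_link_of_course (W W' N N' : Type) (g : W -> W') (h : N -> N')
    (k : link W N) : is_of_course (map_link g h k) = is_of_course k.
Proof. by case: k. Qed.

Lemma map_link_why_not (W W' N N' : Type) (g : W -> W') (h : N -> N')
    (k : link W N) : is_why_not (map_link g h k) = is_why_not k.
Proof. by case: k. Qed.

Section Incidence.
Variable G : net.
Implicit Types (l m c : node G) (x y : wire G) (d : option (node G)).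

Lemma incident_prem d l x : l \in links G -> box l = d ->
  x \in premise_wires (lab l) -> ~~ is_of_course (lab l) ->
  incident d l (inl x).
Proof. by rewrite /incident => -> -> -> ->; rewrite eqxx. Qed.

Lemma incident_concl d l x : l \in links G -> box l = d ->
  x \in conclusion_wires (lab l) -> incident d l (inl x).
Proof. by rewrite /incident => -> -> ->; rewrite eqxx orbT. Qed.

Lemma incidentE d l x : incident d l (inl x) ->
  [/\ l \in links G, box l = d
    & (x \in premise_wires (lab l) /\ ~~ is_of_course (lab l))
      \/ x \in conclusion_wires (lab l)].
Proof. by case/and3P=> ? /eqP ? /orP[/andP|]; split=> //; [left | right]. Qed.

Lemma cut_onC c x y : cut_on c x y -> cut_on c y x.
Proof. by case=> cG [|]; split=> //; [right | left]. Qed.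

Lemma cut_on_link c x y : cut_on c x y -> [/\ c \in links G,
  premise_wires (lab c) =i [:: x; y], conclusion_wires (lab c) = [::],
  ~~ is_of_course (lab c) & flat_target (lab c) = None].
Proof.
by case=> cG [->|->]; split=> // z; rewrite !inE // orbC.
Qed.

Lemma cut_on_prem c x y : cut_on c x y ->
  x \in premise_wires (lab c) /\ y \in premise_wires (lab c).
Proof. by case/cut_on_link=> _ eqp _ _ _; rewrite !eqp !inE !eqxx orbT. Qed.

Lemma cut_on_not_switched c x y e : cut_on c x y -> switched_premise c e = false.
Proof. by rewrite /switched_premise; case=> _ [->|->]. Qed.

Hypothesis tG : tidy G.

Lemma cut_on_neq c x y : cut_on c x y -> x != y.
Proof.
by case=> cG [] lc; have := tidy_uniq_prem tG cG; rewrite lc /= inE andbT // eq_sym.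
Qed.

Lemma cut_on_box c x y l : cut_on c x y -> l \in links G ->
  x \in conclusion_wires (lab l) -> box l = box c.
Proof.
move=> cc lG xl; have [cG _ _ nc _] := cut_on_link cc.
by rewrite (tidy_border tG lG cG xl (proj1 (cut_on_prem cc))) (negbTE nc).
Qed.

End Incidence.

(** * Steps which do not duplicate boxes *)

Section Relabel.
Variables (G : net) (L : {set node G}) (lab' : node G -> link (wire G) (node G)).

Let G' : net := Net L lab' (@box G).

(** No flat link appears, disappears or changes its target, so the chains and the auxiliary ports
    are the same in both nets. *)
Hypothesis same_flats : forall f w,
  (f \in L) && (flat_target (lab' f) == Some w)
  = (f \in links G) && (flat_target (lab f) == Some w).

Lemma relabel_flats (w : node G) : @flats G' w = @flats G w.
Proof. by apply/setP => f; rewrite !inE same_flats. Qed.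

Lemma relabel_pax (f b : node G) : @pax G' f b = @pax G f b.
Proof.
apply/paxP/paxP => -[w [/= fL fw fb wb]]; exists w.
  have : (f \in links G) && (flat_target (@lab G f) == Some w).
    by rewrite -same_flats; apply/andP; split; [exact: fL | exact/eqP].
  by case/andP=> fG /eqP fw'; split.
have : (f \in L) && (flat_target (lab' f) == Some w).
  by rewrite same_flats; apply/andP; split; [exact: fL | exact/eqP].
by case/andP=> fG /eqP fw'; split.
Qed.

(** Incidence with chain edges depends on a link only through what is left once its wires are
    forgotten. *)
Definition skeleton (W N : Type) (k : link W N) : link unit N :=
  map_link (fun _ => tt) id k.

Lemma relabel_incident_chain d (l f : node G) : l \in L -> l \in links G ->
  skeleton (lab' l) = skeleton (lab l) ->
  @incident G' d l (inr f) = @incident G d l (inr f).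
Proof.
rewrite /incident /= => -> ->.
case: (lab' l); case: (lab l) => //= *; congr (_ && _).
  exact: relabel_pax.
by rewrite relabel_flats.
Qed.

Lemma relabel_incident d (l : node G) e : l \in L -> l \in links G ->
  lab' l = lab l -> @incident G' d l e = @incident G d l e.
Proof.
case: e => [x|f] lL lG ll; last by rewrite relabel_incident_chain ?ll.
by rewrite /incident /= lL lG ll.
Qed.

Lemma relabel_switched (l : node G) e : lab' l = lab l ->
  @switched_premise G' l e = @switched_premise G l e.
Proof.
rewrite /switched_premise /= => ->; case: (lab l) => //= w.
by case: e => // f; rewrite relabel_flats.
Qed.

Lemma relabel_tidy : tidy G ->
  (forall l m x, l \in L -> m \in L -> x \in conclusion_wires (lab' l) ->
     x \in conclusion_wires (lab' m) -> l = m) ->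
  (forall l, l \in L -> uniq (conclusion_wires (lab' l))) ->
  (forall l m x, l \in L -> m \in L -> x \in premise_wires (lab' l) ->
     x \in premise_wires (lab' m) -> l = m) ->
  (forall l, l \in L -> uniq (premise_wires (lab' l))) ->
  L \subset links G ->
  (forall l, l \in links G -> is_why_not (lab l) || is_of_course (lab l) ->
     l \in L /\ skeleton (lab' l) = skeleton (lab l)) ->
  (forall l m x, l \in L -> m \in L ->
    x \in conclusion_wires (lab' l) -> x \in premise_wires (lab' m) ->
    box l = if is_of_course (lab' m) then Some m else box m) ->
  tidy G'.
Proof.
move=> tG h1 h2 h3 h4 /subsetP sub keep h5; split=> //=.
- move=> f w fL fw; have := same_flats f w; rewrite fL fw eqxx /=.
  move/esym/andP => [fG /eqP fw']; have [wG ww win] := tidy_flat tG fG fw'.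
  have [] := keep w wG; first by rewrite ww.
  by move: ww; case: (lab w) => //= c _; case: (lab' w).
- move=> l b /sub lG lb; have [bG bo] := tidy_box tG lG lb.
  have [] := keep b bG; first by rewrite bo orbT.
  by move: bo; case: (lab b) => //= c e _; case: (lab' b).
- by move=> b /sub; apply: tidy_nested tG _.
Qed.

End Relabel.

(** * The axiom step *)

Section AxiomStep.
Variables (G : net) (tG : tidy G).
Variables (c a : node G) (x y z : wire G).
Hypotheses (cc : cut_on c x y) (aG : a \in links G).
Hypothesis la : lab a = Ax y z \/ lab a = Ax z y.

Local Notation G' := (ax_reduct c a x z).
Local Notation sg := (fun u => if u == z then x else u).

Implicit Types (l m f w b : node G) (u : wire G) (d : option (node G))
  (v : vertex G).

Let cG : c \in links G. Proof. by case: cc. Qed.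
Let aconcl : conclusion_wires (lab a) =i [:: y; z].
Proof. by case: la => -> u; rewrite !inE // orbC. Qed.
Let yz : y != z.
Proof. by have := tidy_uniq_concl tG aG; case: la => -> /=;
    rewrite inE andbT // eq_sym. Qed.
Let aflat : flat_target (lab a) = None. Proof. by case: la => ->. Qed.
Let ca : c != a.
Proof. by apply/eqP=> e; case: cc => _; rewrite e; case: la => -> []. Qed.

Let linksE l : (l \in links G') = [&& l != c, l != a & l \in links G].
Proof. by rewrite !inE negb_or -andbA. Qed.

Let same_flats f w :
  (f \in links G') && (flat_target (@lab G' f) == Some w)
  = (f \in links G) && (flat_target (lab f) == Some w).
Proof.
have [_ _ _ _ cfl] := cut_on_link cc.
rewrite linksE /= map_link_flat; case E: (f \in links G); rewrite ?andbF // andbT.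
have [->|nc] := eqVneq f c; first by rewrite cfl.
have [->|na] := eqVneq f a; first by rewrite aflat.
by case: (flat_target (lab f)).
Qed.

Let znconcl l : l \in links G' -> z \notin conclusion_wires (lab l).
Proof.
rewrite linksE => /and3P[_ na lG]; apply/negP => zl.
have := tidy_concl tG lG aG zl; rewrite aconcl !inE eqxx orbT => /(_ isT) e.
by rewrite e eqxx in na.
Qed.

Let xnprem l : l \in links G' -> x \notin premise_wires (lab l).
Proof.
rewrite linksE => /and3P[nc _ lG]; apply/negP => xl.
by rewrite (tidy_prem tG lG cG xl (proj1 (cut_on_prem cc))) eqxx in nc.
Qed.

Let concl' l : l \in links G' ->
  conclusion_wires (@lab G' l) = conclusion_wires (lab l).
Proof.
move=> lG'; rewrite map_link_conclusions -[RHS]map_id; apply/eq_in_map => u ul /=.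
by case: eqP => // eu; move: (znconcl lG'); rewrite -eu ul.
Qed.

Let prem' l : premise_wires (@lab G' l) = map sg (premise_wires (lab l)).
Proof. by rewrite map_link_premises. Qed.

(** Only the removed cut had the premise [x], so renaming [z] to [x] identifies no two premises. *)
Let sg_inj l : l \in links G' -> {in premise_wires (lab l) &, injective sg}.
Proof.
move=> lG' u v ul vl /=.
have ux : u != x by apply: contraNneq (xnprem lG') => <-.
have vx : v != x by apply: contraNneq (xnprem lG') => <-.
case: eqP => [->|_]; case: eqP => [->//|_] // e.
  by rewrite e eqxx in vx.
by rewrite e eqxx in ux.
Qed.

Let premP l u : l \in links G' -> u \in premise_wires (@lab G' l) ->
  (u = x /\ z \in premise_wires (lab l)) \/
  [/\ u != z, u != x & u \in premise_wires (lab l)].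
Proof.
move=> lG'; rewrite prem' => /mapP[v vl ->] /=; case: eqP => [<-|/eqP nz];
    first by left.
by right; split=> //; apply: contraNneq (xnprem lG') => <-.
Qed.

Lemma ax_reduct_tidy : tidy G'.
Proof.
apply: relabel_tidy => //.
- move=> l m u lL mL; rewrite (concl' lL) (concl' mL).
  by apply: (tidy_concl tG); move: lL mL; rewrite !linksE => /and3P[_ _ ?] /and3P[].
- move=> l lL; rewrite (concl' lL); apply: (tidy_uniq_concl tG).
  by move: lL; rewrite linksE => /and3P[].
- move=> l m u lL mL ul um.
  have lG : l \in links G by move: lL; rewrite linksE => /and3P[].
  have mG : m \in links G by move: mL; rewrite linksE => /and3P[].
  case: (premP lL ul) (premP mL um) => [[-> zl]|[nz nx ul']] [[e zm]|[nz' nx' um']].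
  + exact: (tidy_prem tG lG mG zl zm).
  + by rewrite eqxx in nx'.
  + by rewrite e eqxx in nx.
  + exact: (tidy_prem tG lG mG ul' um').
- move=> l lL; rewrite prem' map_inj_in_uniq; last exact: sg_inj.
  by apply: (tidy_uniq_prem tG); move: lL; rewrite linksE => /and3P[].
- by apply/subsetP => l; rewrite linksE => /and3P[].
- move=> l lG lw; split; last by case: (lab l).
  rewrite linksE lG andbT; apply/andP; split; apply: contraTneq lw => ->.
    by case: cc => _ [->|->].
  by case: la => ->.
- move=> l m u lL mL; rewrite (concl' lL) map_link_of_course => ul um.
  have lG : l \in links G by move: lL; rewrite linksE => /and3P[].
  have mG : m \in links G by move: mL; rewrite linksE => /and3P[].
  case: (premP mL um) => [[eu zm]|[_ _ um']]; last exact: (tidy_border tG lG mG ul um').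
  rewrite eu in ul; rewrite (cut_on_box tG cc lG ul).
  rewrite -(cut_on_box tG (cut_onC cc) aG); last by rewrite aconcl !inE eqxx.
  by apply: (tidy_border tG aG mG _ zm); rewrite aconcl !inE eqxx orbT.
Qed.

(** In the reduct [x] goes straight from its source to the link which had premise [z]. A core
    through [x] is lifted by the detour [x], cut, [y], axiom, [z]; any other core is kept. *)
Lemma ax_reduct_coreless : coreless G -> coreless G'.
Proof.
move=> nc d S' coreS'; have [Sn0 oS' deg] := coreS'.
have linkS l : inl l \in S' -> [/\ l \in links G', l \in links G & box l = d].
  move=> /(core_link coreS')[lL lb]; split=> //.
  by move: lL; rewrite linksE => /and3P[].
pose S : {set vertex G} := if inr (inl x) \in S' then
  S' :|: [set inl c; inl a; inr (inl y); inr (inl z)] else S'.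
have S'S v : v \in S' -> v \in S by rewrite /S; case: ifP => // _ vS; rewrite inE vS.
have S_link l : inl l \in S -> [\/ inl l \in S', l = c | l = a].
  rewrite /S; case: ifP => _ lS; last by constructor 1.
  move: lS; rewrite 4!in_setU 4!in_set1 => /orP[|/orP[/orP[/orP[]|]|]];
      first by constructor 1.
  - by move/eqP=> -[->]; constructor 2.
  - by move/eqP=> -[->]; constructor 3.
  - by move/eqP.
  - by move/eqP.
have S_wire u : inr (inl u) \in S ->
    inr (inl u) \in S' \/ inr (inl x) \in S' /\ (u = y \/ u = z).
  rewrite /S; case: ifP => xS uS; last by left.
  move: uS; rewrite 4!in_setU 4!in_set1 => /orP[|/orP[/orP[/orP[]|]|]]; first by left.
  - by move/eqP.
  - by move/eqP.
  - by move/eqP=> -[->]; right; split; rewrite ?xS; [|left].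
  - by move/eqP=> -[->]; right; split; rewrite ?xS; [|right].
have S_chain f : inr (inr f) \in S -> inr (inr f) \in S'.
  rewrite /S; case: ifP => // _.
  by rewrite 4!in_setU 4!in_set1 => /orP[//|/orP[/orP[/orP[]|]|]] /eqP.
have inc_inl l u : inl l \in S' -> @incident G' d l (inl u) ->
    u \in conclusion_wires (lab l) \/
    ~~ is_of_course (lab l) /\
    (u = x /\ z \in premise_wires (lab l) \/
     [/\ u != z, u != x & u \in premise_wires (lab l)]).
  move=> lS; have [lL lG lb] := linkS l lS.
  case/incidentE=> _ _ [[ul no]|]; last by rewrite (concl' lL); left.
  by right; split; [move: no; rewrite map_link_of_course | exact: premP].
have inc_wire l u : u != x -> inl l \in S' -> @incident G' d l (inl u) ->
    @incident G d l (inl u).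
  move=> ux lS /(inc_inl l u lS); have [lL lG lb] := linkS l lS.
  case=> [ul|[no [[eu]|[_ _ ul]]]]; first exact: incident_concl.
    by rewrite eu eqxx in ux.
  exact: incident_prem.
have inc_chain l f : inl l \in S' -> @incident G' d l (inr f) ->
    @incident G d l (inr f).
  move=> lS; have [lL lG lb] := linkS l lS.
  by rewrite (relabel_incident_chain same_flats) //=; case: (lab l).
have znS : inr (inl z) \notin S'.
  apply/negP=> /[dup] zS /deg[[l|?] [? [lS _ _ // adjl _]]].
  have [lL lG lb] := linkS l lS.
  case/(inc_inl l z lS): adjl => [zl|[_ [[ex zl]|[/eqP]//]]].
    by move: (znconcl lL); rewrite zl.
  by move: (xnprem lL); rewrite -ex zl.
have nbrx : inr (inl x) \in S' -> exists l m, [/\ inl l \in S', inl m \in S',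
    x \in conclusion_wires (lab l), z \in premise_wires (lab m)
    & ~~ is_of_course (lab m)].
  move=> /deg[[l|?] [[m|?] [lS mS lm // al am]]].
  have [lL lG _] := linkS l lS; have [mL mG _] := linkS m mS.
  have lm' : l <> m by move=> e; rewrite e eqxx in lm.
  case: (inc_inl l x lS al) (inc_inl m x mS am) =>
      [xl|[nl [[_ zl]|[_ /eqP//]]]] [xm|[nm [[_ zm]|[_ /eqP//]]]].
  - by case: lm'; apply: (tidy_concl tG lG mG xl xm).
  - by exists l, m.
  - by exists m, l.
  - by case: lm'; apply: (tidy_prem tG lG mG zl zm).
have abox : box a = box c.
  by apply: (cut_on_box tG (cut_onC cc) aG); rewrite aconcl !inE eqxx.
have [px py] := cut_on_prem cc.
have [_ _ _ cno _] := cut_on_link cc.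
apply: (nc d S); split.
- by have [v vS] := set0Pn _ Sn0; apply/set0Pn; exists v; apply: S'S.
- move=> l e e' lS eS e'S le le'.
  have lS' : inl l \in S'.
    case: (S_link l lS) => // el; first by rewrite el (cut_on_not_switched _ cc) in le.
    by move: le; rewrite el /switched_premise; case: la => ->.
  have [lL lG lb] := linkS l lS'.
  pose k (e : wire G + node G) : wire G + node G :=
    if e is inl u then inl (sg u) else e.
  have kP e0 : inr e0 \in S -> switched_premise l e0 ->
      inr (k e0) \in S' /\ @switched_premise G' l (k e0).
    move=> e0S le0; split; last first.
      move: le0; rewrite /switched_premise /=; case: e0 {e0S} => [u|f] /=.
        by case: (lab l) => //= a0 b0 _ /orP[]/eqP->; rewrite eqxx ?orbT.
      by case: (lab l) => //= w; rewrite (relabel_flats same_flats).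
    case: e0 e0S le0 => [u|f] /=; last by move/S_chain.
    case/S_wire=> [uS _|[xS [->|->]]].
    + by case: eqP uS => // ->; rewrite (negbTE znS).
    + move=> /switched_premiseP yl;
        have lc := tidy_prem tG lG cG yl (proj2 (cut_on_prem cc)).
      by move: lL; rewrite linksE lc eqxx.
    + by rewrite eqxx.
  have [kS kl] := kP e eS le; have [kS' kl'] := kP e' e'S le'.
  have := oS' l _ _ lS' kS kS' kl kl'.
  move: (switched_premiseP le) (switched_premiseP le').
  case: e e' {eS e'S le le' kS kl kS' kl'} => [u|f] [u'|f'] //= ul u'l [e].
  by congr inl; apply: (sg_inj lL ul u'l e).
move=> v vS.
have [vS'|vnS'] := boolP (v \in S'); last first.
  have xS : inr (inl x) \in S'.
    by apply: contraNT vnS' => xnS; move: vS; rewrite /S (negbTE xnS).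
  have [l [m [lS mS xl zm no]]] := nbrx xS.
  have [lL lG lb] := linkS l lS; have [mL mG mb] := linkS m mS.
  have cb : box c = d by rewrite -lb -(cut_on_box tG cc lG xl).
  have inS (v0 : vertex G) : v0 \in [set inl c; inl a; inr (inl y);
      inr (inl z)] -> v0 \in S.
    by rewrite /S xS => uT; rewrite inE uT orbT.
  have mSS := S'S _ mS; have xSS := S'S _ xS.
  have cS : inl c \in S by apply: inS; rewrite 3!in_setU 4!in_set1 eqxx.
  have aS : inl a \in S by apply: inS; rewrite 3!in_setU 4!in_set1 eqxx orbT.
  have yS : inr (inl y) \in S by apply: inS; rewrite 3!in_setU 4!in_set1 eqxx !orbT.
  have zS : inr (inl z) \in S by apply: inS; rewrite 3!in_setU 4!in_set1 eqxx !orbT.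
  have := vS; rewrite {1}/S xS 4!in_setU 4!in_set1 (negbTE vnS') /= =>
      /orP[/orP[/orP[]|]|] /eqP->.
  + apply: (deg2_cons xSS _ yS); [exact: incident_prem | exact: incident_prem |].
    by apply: contra_neq (cut_on_neq tG cc) => -[].
  + apply: (deg2_cons yS _ zS); rewrite /= ?incident_concl ?aconcl ?inE ?eqxx
      ?orbT ?abox //.
  + apply: (deg2_cons cS _ aS) => //; first exact: incident_prem.
    by rewrite /= incident_concl ?abox ?aconcl ?inE ?eqxx.
  + apply: (deg2_cons aS _ mSS); [|exact: incident_prem|].
      by rewrite /= incident_concl ?abox ?aconcl ?inE ?eqxx ?orbT.
    by move: mL; rewrite linksE => /and3P[_ na _]; rewrite eq_sym;
        apply: contra_neq na => -[].
case: v vS vS' => [l|[u|f]] vS vS'.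
- have [lL lG lb] := linkS l vS'.
  (* Seen from the link below, the edge [x] of the reduct is [z]; seen from its source it is [x]
     itself. *)
  pose k (v : vertex G) : vertex G := match v with
    | inr (inl u) => if (u == x) && (x \notin conclusion_wires (lab l))
                     then inr (inl z) else v
    | _ => v end.
  apply: (deg2_map (h := k) (deg _ vS')).
  + move=> [?|[u1|f1]] [?|[u2|f2]] // S1 S2 _ _ /=; try by case: ifP.
    case: (boolP (_ && _)) => [/andP[/eqP-> _]|_];
        case: (boolP (_ && _)) => [/andP[/eqP-> _]|_] //.
      by case=> e; move: S2; rewrite -e (negbTE znS).
    by case=> e; move: S1; rewrite e (negbTE znS).
  + move=> [?|[u|f]] // uS au; last by split; [exact: S'S | exact: inc_chain].
    have [ex|nx] := eqVneq u x; last first.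
      by rewrite /= (negbTE nx); split; [exact: S'S | exact: inc_wire].
    rewrite /= ex eqxx /= in uS au *; case: (boolP (x \in _)) => [xl|xl] /=.
      by split; [exact: S'S | exact: incident_concl].
    split; first by rewrite /S uS 4!in_setU 4!in_set1 eqxx !orbT.
    case: (inc_inl l x vS' au) => [xl'|[no [[_ zl]|[_ /eqP//]]]].
      by rewrite xl' in xl.
    exact: incident_prem.
- have [ex|nx] := eqVneq u x; last first.
    by apply: (deg2_map (h := id) (deg _ vS')) => // -[l|//] lS /= al;
      split; [exact: S'S | exact: inc_wire].
  rewrite ex in vS vS' *.
  have [l [m [lS mS xl zm no]]] := nbrx vS'.
  have [lL lG lb] := linkS l lS.
  have cb : box c = d by rewrite -lb -(cut_on_box tG cc lG xl).
  have cS : inl c \in S by rewrite /S vS' 4!in_setU 4!in_set1 eqxx !orbT.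
  apply: (deg2_cons (S'S _ lS) _ cS); [exact: incident_concl | exact: incident_prem |].
  by move: lL; rewrite linksE => /and3P[nc' _ _]; apply: contra_neq nc' => -[].
- by apply: (deg2_map (h := id) (deg _ vS')) => // -[l|//] lS /= al;
    split; [exact: S'S | exact: inc_chain].
Qed.

End AxiomStep.

(** * Quantifier and paragraph steps: cuts between links with one premise *)

Definition unary_link (G : net) (m : node G) (a x : wire G) : Prop :=
  [/\ m \in links G, premise_wires (lab m) = [:: a],
      conclusion_wires (lab m) = [:: x] & ~~ is_of_course (lab m)].

Lemma unary_linkP (G : net) (m : node G) (a x : wire G) : unary_link m a x ->
  [/\ flat_target (lab m) = None, ~~ is_why_not (lab m)
    & forall e, switched_premise m e = false].
Proof. by rewrite /switched_premise; case=> _; case: (lab m). Qed.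

Section UnaryStep.
Variables (G : net) (tG : tidy G).
Variables (c m n : node G) (a b x y : wire G).
Hypotheses (cc : cut_on c x y) (um : unary_link m a x) (un : unary_link n b y).

Local Notation G' := (unary_reduct c m n a b).
Implicit Types (l k f w : node G) (u : wire G) (d : option (node G))
  (v : vertex G).

Let cG : c \in links G. Proof. by case: cc. Qed.
Let mG : m \in links G. Proof. by case: um. Qed.
Let nG : n \in links G. Proof. by case: un. Qed.
Let xm : x \in conclusion_wires (lab m). Proof. by case: um => _ _ ->; rewrite inE. Qed.
Let yn : y \in conclusion_wires (lab n). Proof. by case: un => _ _ ->; rewrite inE. Qed.
Let am : a \in premise_wires (lab m). Proof. by case: um => _ ->; rewrite inE. Qed.
Let bn : b \in premise_wires (lab n). Proof. by case: un => _ ->; rewrite inE. Qed.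
Let mno : ~~ is_of_course (lab m). Proof. by case: um. Qed.
Let nno : ~~ is_of_course (lab n). Proof. by case: un. Qed.
Let cx : x \in premise_wires (lab c). Proof. by case: (cut_on_prem cc). Qed.
Let cy : y \in premise_wires (lab c). Proof. by case: (cut_on_prem cc). Qed.
Let xy : x != y. Proof. exact: (cut_on_neq tG cc). Qed.
Let ccl : conclusion_wires (lab c) = [::]. Proof. by case/cut_on_link: cc. Qed.
Let cno : ~~ is_of_course (lab c). Proof. by case/cut_on_link: cc. Qed.
Let cm : c != m. Proof. by apply/eqP=> e; move: xm; rewrite -e ccl. Qed.
Let cn : c != n. Proof. by apply/eqP=> e; move: yn; rewrite -e ccl. Qed.
Let mn : m != n.
Proof.
apply/eqP=> e; move: yn xy; rewrite -e; case: um => _ _ -> _.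
by rewrite inE => /eqP->; rewrite eqxx.
Qed.
Let ab : a != b.
Proof. by apply: contraNneq mn => e; apply/eqP/(tidy_prem tG mG nG am); rewrite e. Qed.
Let mbox : box m = box c. Proof. exact: (cut_on_box tG cc mG xm). Qed.
Let nbox : box n = box c. Proof. exact: (cut_on_box tG (cut_onC cc) nG yn). Qed.

Let linksE l : (l \in links G') = [&& l != m, l != n & l \in links G].
Proof. by rewrite !inE negb_or -andbA. Qed.

Let linksP l : l \in links G' -> [/\ l != m, l != n & l \in links G].
Proof. by rewrite linksE => /and3P. Qed.

Let labE l : l != c -> @lab G' l = @lab G l.
Proof. by rewrite /= => /negbTE->. Qed.

Let labc : @lab G' c = Cut a b. Proof. by rewrite /= eqxx. Qed.

Let same_flats f w :
  (f \in links G') && (flat_target (@lab G' f) == Some w)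
  = (f \in links G) && (flat_target (lab f) == Some w).
Proof.
have [_ _ _ _ cfl] := cut_on_link cc.
have [mfl _ _] := unary_linkP um; have [nfl _ _] := unary_linkP un.
rewrite linksE; have [->|nc] := eqVneq f c; first by rewrite labc cfl !andbF.
rewrite (labE nc).
have [->|_] := eqVneq f m; first by rewrite mfl !andbF.
have [->|_] := eqVneq f n; first by rewrite nfl !andbF.
by [].
Qed.

Let conclE l : conclusion_wires (@lab G' l) = conclusion_wires (@lab G l).
Proof. by have [->|/labE->//] := eqVneq l c; rewrite labc ccl. Qed.

Let premP l u : l \in links G' -> u \in premise_wires (@lab G' l) ->
  [\/ l = c /\ u = a, l = c /\ u = b
    | [/\ l != c, u != a, u != b & u \in premise_wires (@lab G l)]].
Proof.
case/linksP=> lm ln lG; have [->|nc] := eqVneq l c.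
  by rewrite labc !inE => /orP[]/eqP->; [constructor 1 | constructor 2].
rewrite (labE nc) => ul; constructor 3; split=> //.
  by apply: contraNneq lm => e; apply/eqP/(tidy_prem tG lG mG ul); rewrite e.
by apply: contraNneq ln => e; apply/eqP/(tidy_prem tG lG nG ul); rewrite e.
Qed.

Lemma unary_reduct_tidy : tidy G'.
Proof.
apply: relabel_tidy => //.
- move=> l k u lL kL; rewrite (conclE l) (conclE k).
  by apply: (tidy_concl tG); [case: (linksP lL) | case: (linksP kL)].
- by move=> l lL; rewrite (conclE l); apply: (tidy_uniq_concl tG); case: (linksP lL).
- move=> l k u lL kL ul uk.
  have [_ _ lG] := linksP lL; have [_ _ kG] := linksP kL.
  case: (premP lL ul) => [[-> eu]|[-> eu]|[nc na nb ul']];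
    case: (premP kL uk) => [[-> eu']|[-> eu']|[nc' na' nb' uk']] //.
  + by rewrite eu eqxx in na'.
  + by rewrite eu eqxx in nb'.
  + by rewrite eu' eqxx in na.
  + by rewrite eu' eqxx in nb.
  + exact: (tidy_prem tG lG kG ul' uk').
- move=> l lL; have [_|nc] := eqVneq l c; first by rewrite /= inE ab.
  by apply: (tidy_uniq_prem tG); case: (linksP lL).
- by apply/subsetP => l /linksP[].
- move=> l lG lw.
  have [mfl mw _] := unary_linkP um; have [nfl nw _] := unary_linkP un.
  have cw : is_why_not (lab c) = false by case: cc => _ [->|->].
  have nc : l != c by apply/eqP=> e; rewrite e cw (negbTE cno) in lw.
  rewrite (negbTE nc); split=> //; rewrite linksE lG andbT.
  apply/andP; split; apply/eqP=> e; move: lw; rewrite e.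
    by rewrite (negbTE mw) (negbTE mno).
  by rewrite (negbTE nw) (negbTE nno).
- move=> l k u lL kL; rewrite (conclE l) => ul uk.
  have [_ _ lG] := linksP lL; have [_ _ kG] := linksP kL.
  case: (premP kL uk) => [[-> eu]|[-> eu]|[nc _ _ uk']].
  + rewrite eqxx /= -mbox; rewrite eu in ul.
    by rewrite (tidy_border tG lG mG ul am) (negbTE mno).
  + rewrite eqxx /= -nbox; rewrite eu in ul.
    by rewrite (tidy_border tG lG nG ul bn) (negbTE nno).
  + by rewrite (negbTE nc); apply: (tidy_border tG lG kG ul uk').
Qed.

(** A core through the new cut on [a] and [b] is lifted by the longer path [a], [m], [x], [c], [y],
    [n], [b]. *)
Lemma unary_reduct_coreless : coreless G -> coreless G'.
Proof.
move=> nc d S' coreS'; have [Sn0 oS' deg] := coreS'.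
have linkS l : inl l \in S' -> [/\ l \in links G', l \in links G & box l = d].
  by move=> /(core_link coreS')[lL lb]; split=> //; case: (linksP lL).
pose T : {set vertex G} := [set inl m; inl n; inr (inl x); inr (inl y)].
pose S : {set vertex G} := if inl c \in S' then S' :|: T else S'.
have S'S v : v \in S' -> v \in S by rewrite /S; case: ifP => // _ vS; rewrite inE vS.
have S_T v : v \in S -> v \in S' \/ inl c \in S' /\ v \in T.
  rewrite /S; case: ifP => [cS|]; last by left.
  by rewrite in_setU => /orP[|vT]; [left | right].
have T_S v : inl c \in S' -> v \in T -> v \in S.
  by move=> cS vT; rewrite /S cS in_setU vT orbT.
have inc l e : l != c -> inl l \in S' ->
    @incident G' d l e -> @incident G d l e.
  by move=> lc lS; have [lL lG _] := linkS l lS;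
    rewrite (relabel_incident same_flats) // (labE lc).
have incc e : @incident G' d c e -> e = inl a \/ e = inl b.
  case/and3P=> _ _; case: e => [u|f]; last by rewrite labc.
  by rewrite labc andbT orbF !inE => /orP[]/eqP->; [left | right].
have abS : inl c \in S' -> inr (inl a) \in S' /\ inr (inl b) \in S'.
  move=> /deg[[?|e1] [[?|e2] [S1 S2 ne //]]] /incc[] e1E /incc[] e2E;
    by rewrite e1E e2E ?eqxx in S1 S2 ne.
have mT : inl m \in T by rewrite 3!in_setU 4!in_set1 eqxx.
have nT : inl n \in T by rewrite 3!in_setU 4!in_set1 eqxx !orbT.
have xT : inr (inl x) \in T by rewrite 3!in_setU 4!in_set1 eqxx !orbT.
have yT : inr (inl y) \in T by rewrite 3!in_setU 4!in_set1 eqxx !orbT.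
apply: (nc d S); split.
- by have [v vS] := set0Pn _ Sn0; apply/set0Pn; exists v; apply: S'S.
- have [_ _ msw] := unary_linkP um; have [_ _ nsw] := unary_linkP un.
  move=> l e e' lS eS e'S le le'.
  have lc : l != c by apply: contraTneq le => ->; rewrite (cut_on_not_switched _ cc).
  have lS' : inl l \in S'.
    case: (S_T _ lS) => // -[_]; rewrite 3!in_setU 4!in_set1.
    case/orP=> [/orP[/orP[]|]|] /eqP[el] //.
      by rewrite el msw in le.
    by rewrite el nsw in le.
  have [lL lG lb] := linkS l lS'.
  have eS' e0 : inr e0 \in S -> switched_premise l e0 -> inr e0 \in S'.
    case/S_T=> // -[_]; rewrite 3!in_setU 4!in_set1.
    case/orP=> [/orP[/orP[]|]|] /eqP[->] // /switched_premiseP ul.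
      by rewrite (tidy_prem tG lG cG ul cx) eqxx in lc.
    by rewrite (tidy_prem tG lG cG ul cy) eqxx in lc.
  by apply: (oS' l e e' lS' (eS' e eS le) (eS' e' e'S le'));
    rewrite (relabel_switched same_flats) // (labE lc).
move=> v /[dup] vS /S_T[vS'|[cS vT]]; last first.
  have [_ _ cb] := linkS c cS; have [aS bS] := abS cS.
  have := vT; rewrite 3!in_setU 4!in_set1 => /orP[/orP[/orP[]|]|] /eqP->.
  + apply: (deg2_cons (S'S _ aS) _ (T_S _ cS xT)).
    * by rewrite /= incident_prem // mbox.
    * by rewrite /= incident_concl // mbox.
    * apply: contra_neq cm => -[e]; apply: (tidy_prem tG cG mG cx); by rewrite -e.
  + apply: (deg2_cons (S'S _ bS) _ (T_S _ cS yT)).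
    * by rewrite /= incident_prem // nbox.
    * by rewrite /= incident_concl // nbox.
    * apply: contra_neq cn => -[e]; apply: (tidy_prem tG cG nG cy); by rewrite -e.
  + apply: (deg2_cons (S'S _ cS) _ (T_S _ cS mT)).
    * by rewrite /= incident_prem.
    * by rewrite /= incident_concl // mbox.
    * by apply: contra_neq cm => -[].
  + apply: (deg2_cons (S'S _ cS) _ (T_S _ cS nT)).
    * by rewrite /= incident_prem.
    * by rewrite /= incident_concl // nbox.
    * by apply: contra_neq cn => -[].
case: v vS vS' => [l|e] vS vS'.
  have [lL lG lb] := linkS l vS'.
  have [lc|lc] := eqVneq l c.
    rewrite lc in lb vS' *.
    apply: (deg2_cons (T_S _ vS' xT) _ (T_S _ vS' yT));
        [exact: incident_prem | exact: incident_prem |].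
    by apply: contra_neq xy => -[].
  by apply: (deg2_map (h := id) (deg _ vS')) => // -[//|e] eS /= al;
    split; [exact: S'S | exact: inc].
(* At [a] and [b] the neighbour [c] is replaced by the link which has this wire as premise in the
   net. *)
pose h (v : vertex G) : vertex G :=
  if v == inl c then if e == inl a then inl m else inl n else v.
have hn l : inl l \in S' -> inl l != (if e == inl a then inl m else inl n : vertex G).
  move=> lS; have [/linksP[lm ln _] _ _] := linkS l lS.
  by case: ifP => _; [apply: contra_neq lm | apply: contra_neq ln] => -[].
apply: (deg2_map (h := h) (deg _ vS')).
- move=> [l1|?] [l2|?] // S1 S2 _ _; rewrite /h.
  case: (eqVneq (inl l1) (inl c : vertex G)) => [->|_];
    case: (eqVneq (inl l2) (inl c : vertex G)) => [->|_] // /eqP.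
    by rewrite eq_sym (negbTE (hn _ S2)).
  by rewrite (negbTE (hn _ S1)).
- move=> [l|//] lS al; rewrite /h;
    case: (eqVneq (inl l) (inl c : vertex G)) => [[lc]|lc]; last first.
    by split; [exact: S'S | apply: inc => //; apply: contra_neq lc => ->].
  rewrite lc in lS al; have [_ _ cb] := linkS c lS.
  case/incc: al => [->|->].
    by rewrite eqxx; split; [exact: T_S | rewrite /= incident_prem // mbox].
  case: eqP => [[e0]|_]; first by move: ab; rewrite e0 eqxx.
  by split; [exact: T_S | rewrite /= incident_prem // nbox].
Qed.

End UnaryStep.

(** * The step of a tensor against a par *)

Section MultiplicativeStep.
Variables (G : net) (tG : tidy G).
Variables (c t p : node G) (a b a' b' x y : wire G).
Hypotheses (cc : cut_on c x y) (tGl : t \in links G) (lt : lab t = Tensor a b x).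
Hypotheses (pG : p \in links G) (lp : lab p = Par a' b' y).

Local Notation G' := (mult_reduct c t p a b a' b').
Implicit Types (l f w : node G) (u : wire G) (d : option (node G))
  (v k : vertex G).

Let cG : c \in links G. Proof. by case: cc. Qed.
Let cx : x \in premise_wires (lab c). Proof. by case: (cut_on_prem cc). Qed.
Let cy : y \in premise_wires (lab c). Proof. by case: (cut_on_prem cc). Qed.
Let xy : x != y. Proof. exact: (cut_on_neq tG cc). Qed.
Let ccl : conclusion_wires (lab c) = [::]. Proof. by case/cut_on_link: cc. Qed.
Let cno : ~~ is_of_course (lab c). Proof. by case/cut_on_link: cc. Qed.
Let ct : c != t. Proof. by apply/eqP=> e; move: ccl; rewrite e lt. Qed.
Let cp : c != p. Proof. by apply/eqP=> e; move: ccl; rewrite e lp. Qed.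
Let tp : t != p. Proof. by apply/eqP=> e; move: lp; rewrite -e lt. Qed.
Let ta : a \in premise_wires (lab t). Proof. by rewrite lt inE eqxx. Qed.
Let tb : b \in premise_wires (lab t). Proof. by rewrite lt !inE eqxx orbT. Qed.
Let pa : a' \in premise_wires (lab p). Proof. by rewrite lp inE eqxx. Qed.
Let pb : b' \in premise_wires (lab p). Proof. by rewrite lp !inE eqxx orbT. Qed.
Let tx : x \in conclusion_wires (lab t). Proof. by rewrite lt inE. Qed.
Let py : y \in conclusion_wires (lab p). Proof. by rewrite lp inE. Qed.
Let tno : ~~ is_of_course (lab t). Proof. by rewrite lt. Qed.
Let pno : ~~ is_of_course (lab p). Proof. by rewrite lp. Qed.
Let tbox : box t = box c. Proof. exact: (cut_on_box tG cc tGl tx). Qed.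
Let pbox : box p = box c. Proof. exact: (cut_on_box tG (cut_onC cc) pG py). Qed.
Let nprem u : u \in premise_wires (lab t) -> u \notin premise_wires (lab p).
Proof.
by move=> ut; apply: contraNN tp => up; apply/eqP/(tidy_prem tG tGl pG ut up).
Qed.
Let ncut u : u \in premise_wires (lab t) -> u \notin premise_wires (lab c).
Proof.
by move=> ut; apply: contraNN ct => uc; apply/eqP/(tidy_prem tG cG tGl uc ut).
Qed.
Let ncut' u : u \in premise_wires (lab p) -> u \notin premise_wires (lab c).
Proof.
by move=> up; apply: contraNN cp => uc; apply/eqP/(tidy_prem tG cG pG uc up).
Qed.

Let linksP l : l \in links G' -> l != p /\ l \in links G.
Proof. by rewrite !inE => /andP. Qed.

Let labE l : l != c -> l != t -> @lab G' l = @lab G l.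
Proof. by rewrite /= => /negbTE-> /negbTE->. Qed.

Let labc : @lab G' c = Cut a a'. Proof. by rewrite /= eqxx. Qed.
Let labt : @lab G' t = Cut b b'.
Proof. by rewrite /= eqxx eq_sym (negbTE ct). Qed.

Let same_flats f w :
  (f \in links G') && (flat_target (@lab G' f) == Some w)
  = (f \in links G) && (flat_target (@lab G f) == Some w).
Proof.
have [_ _ _ _ cfl] := cut_on_link cc.
have [->|nc] := eqVneq f c; first by rewrite labc cfl !andbF.
have [->|nt] := eqVneq f t; first by rewrite labt lt !andbF.
rewrite (labE nc nt) !inE; have [->|_] := eqVneq f p; first by rewrite lp !andbF.
by [].
Qed.

Let conclP l u : u \in conclusion_wires (@lab G' l) ->
  [/\ l != c, l != t & u \in conclusion_wires (@lab G l)].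
Proof.
have [->|nc] := eqVneq l c; first by rewrite labc.
have [->|nt] := eqVneq l t; first by rewrite labt.
by rewrite (labE nc nt).
Qed.

Let premP l u : l \in links G' -> u \in premise_wires (@lab G' l) ->
  [\/ l = c /\ (u = a \/ u = a'), l = t /\ (u = b \/ u = b')
    | [/\ l != c, l != t, u \notin [:: a; b; a'; b']
        & u \in premise_wires (@lab G l)]].
Proof.
case/linksP=> np lG.
have [->|nc] := eqVneq l c.
  by rewrite labc !inE => /orP[]/eqP->; constructor 1; split; [|left| |right].
have [->|nt] := eqVneq l t.
  by rewrite labt !inE => /orP[]/eqP->; constructor 2; split; [|left| |right].
rewrite (labE nc nt) => ul; constructor 3; split=> //; rewrite !inE.
apply/negP=> /or4P[] /eqP eu; rewrite eu in ul.
- by rewrite (tidy_prem tG lG tGl ul ta) eqxx in nt.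
- by rewrite (tidy_prem tG lG tGl ul tb) eqxx in nt.
- by rewrite (tidy_prem tG lG pG ul pa) eqxx in np.
- by rewrite (tidy_prem tG lG pG ul pb) eqxx in np.
Qed.

Let neq_tens_par u u' : u \in [:: a; b] -> u' \in [:: a'; b'] -> u != u'.
Proof.
move=> ut up; apply/eqP=> e; have := @nprem u; rewrite lt lp => /(_ _)/negP; apply.
  by move: ut; rewrite !inE.
by move: up; rewrite e !inE.
Qed.

Let ab : a != b. Proof. by have := tidy_uniq_prem tG tGl; rewrite lt /= inE andbT. Qed.
Let ab' : a' != b'. Proof. by have := tidy_uniq_prem tG pG;
    rewrite lp /= inE andbT. Qed.

Lemma mult_reduct_tidy : tidy G'.
Proof.
apply: relabel_tidy => //.
- move=> l k u /linksP[_ lG] /linksP[_ kG] /conclP[_ _ ul] /conclP[_ _ uk].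
  exact: (tidy_concl tG lG kG ul uk).
- move=> l /linksP[_ lG]; have := tidy_uniq_concl tG lG.
  by do 2![case: eqP => // _].
- move=> l k u lL kL ul uk.
  have [_ lG] := linksP lL; have [_ kG] := linksP kL.
  have aa' : a != a' by apply: neq_tens_par; rewrite !inE eqxx.
  have bb' : b != b' by apply: neq_tens_par; rewrite !inE eqxx ?orbT.
  have a_b' : a != b' by apply: neq_tens_par; rewrite !inE eqxx ?orbT.
  have b_a' : b != a' by apply: neq_tens_par; rewrite !inE eqxx ?orbT.
  case: (premP lL ul) => [[-> eu]|[-> eu]|[nc nt nu ul']];
    case: (premP kL uk) => [[-> eu']|[-> eu']|[nc' nt' nu' uk']] //.
  + by case: eu eu' => -> [] e; move: ab ab' a_b' b_a'; rewrite e eqxx // eq_sym ?eqxx.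
  + by case: eu nu' => ->; rewrite !inE eqxx ?orbT.
  + by case: eu eu' => -> [] e; move: ab ab' a_b' b_a'; rewrite e eqxx // eq_sym ?eqxx.
  + by case: eu nu' => ->; rewrite !inE eqxx ?orbT.
  + by case: eu' nu => ->; rewrite !inE eqxx ?orbT.
  + by case: eu' nu => ->; rewrite !inE eqxx ?orbT.
  + exact: (tidy_prem tG lG kG ul' uk').
- move=> l /linksP[_ lG]; have := tidy_uniq_prem tG lG.
  case: eqP => _; last case: eqP => _ //.
    by move=> _; rewrite /= inE andbT; apply: neq_tens_par; rewrite !inE eqxx.
  by move=> _; rewrite /= inE andbT; apply: neq_tens_par; rewrite !inE eqxx orbT.
- by apply/subsetP => l /linksP[].
- move=> l lG lw.
  have cw : is_why_not (lab c) = false by case: cc => _ [->|->].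
  have nc : l != c by apply/eqP=> e; rewrite e cw (negbTE cno) in lw.
  have nt : l != t by apply/eqP=> e; rewrite e lt in lw.
  have np : l != p by apply/eqP=> e; rewrite e lp in lw.
  by rewrite (negbTE nc) (negbTE nt) !inE np lG.
- move=> l k u lL kL /conclP[_ _ ul] uk.
  have [_ lG] := linksP lL; have [_ kG] := linksP kL.
  case: (premP kL uk) => [[-> eu]|[-> eu]|[nc nt _ uk']].
  + rewrite eqxx /=; case: eu ul => -> ul.
      by rewrite (tidy_border tG lG tGl ul ta) (negbTE tno).
    by rewrite (tidy_border tG lG pG ul pa) (negbTE pno).
  + rewrite [t == c]eq_sym (negbTE ct) eqxx /= tbox; case: eu ul => -> ul.
      by rewrite (tidy_border tG lG tGl ul tb) (negbTE tno).
    by rewrite (tidy_border tG lG pG ul pb) (negbTE pno).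
  + by rewrite (negbTE nc) (negbTE nt); apply: (tidy_border tG lG kG ul uk').
Qed.

(** A core of the reduct may use both new cuts, on [a], [a'] and on [b], [b'], and its lift would
    then need both premises of the par. So both cuts are removed, and a walk from a premise of the
    tensor goes on until it meets one of the four wires again. If this is the other premise of the
    tensor, [t] closes a core; if it is a premise of the par, the path [t], [x], [c], [y], [p] does,
    with a single premise of [p]. *)
Lemma mult_reduct_coreless : coreless G -> coreless G'.
Proof.
move=> nc d S' coreS'; have [Sn0 oS' deg] := coreS'.
have linkS l : inl l \in S' -> [/\ l != p, l \in links G', l \in links G & box l = d].
  by move=> /(core_link coreS')[lL lb]; case: (linksP lL).
have inc l e : l != c -> l != t -> inl l \in S' ->
    @incident G' d l e -> @incident G d l e.
  by move=> lc lt' lS; have [_ lL lG _] := linkS l lS;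
    rewrite (relabel_incident same_flats) // (labE lc lt').
have incc e : @incident G' d c e -> e = inl a \/ e = inl a'.
  case/and3P=> _ _; case: e => [u|f]; last by rewrite labc.
  by rewrite labc andbT orbF !inE => /orP[]/eqP->; [left | right].
have inct e : @incident G' d t e -> e = inl b \/ e = inl b'.
  case/and3P=> _ _; case: e => [u|f]; last by rewrite labt.
  by rewrite labt andbT orbF !inE => /orP[]/eqP->; [left | right].
pose S0 : {set vertex G} := S' :\: [set inl c; inl t].
have S0E v : (v \in S0) = [&& v != inl c, v != inl t & v \in S'].
  by rewrite in_setD in_set2 negb_or -andbA.
have S0S' : {subset S0 <= S'} by move=> v; rewrite S0E => /and3P[].
have linkS0 l : inl l \in S0 -> [/\ l != c, l != t & inl l \in S'].
  by rewrite S0E => /and3P[].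
have edgeS0 e : inr e \in S' -> inr e \in S0 by rewrite S0E => ->.
have one0 : @one_premise G S0.
  move=> l e e' /linkS0[lc lt' lS] /S0S' eS /S0S' e'S le le'.
  by apply: (oS' l e e' lS eS e'S);
    rewrite (relabel_switched same_flats) // (labE lc lt').
pose Q : {set vertex G} :=
  [set inr (inl a); inr (inl b); inr (inl a'); inr (inl b')].
have QE u : (inr (inl u) \in Q) = [|| u == a, u == b, u == a' | u == b'].
  by rewrite 3!in_setU 4!in_set1 -!orbA.
have adj0 v k : v \in S0 -> @adj G' d v k -> k \in S0 -> @adj G d v k.
  move=> vS al kS; case: v k vS kS al => [l|e] [l'|e'] //.
    by case/linkS0=> ? ? ? _; apply: inc.
  by move=> _ /linkS0[? ? ?]; apply: inc.
have deg0 v : v \in S0 -> v \notin Q -> deg2 (@adj G d) S0 v.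
  move=> vS vQ; have [k1 [k2 [S1 S2 ne a1 a2]]] := deg v (S0S' v vS).
  have kS0 k : k \in S' -> @adj G' d v k -> k \in S0.
    move=> kS ak; rewrite S0E kS andbT.
    case: k v vS vQ ak {kS a1 a2} => [l|e] [l'|e'] // vS vQ ak.
    apply/andP; split; apply: contraNneq vQ => -[el]; rewrite el in ak.
      by case: (incc e' ak) => ->; rewrite QE eqxx ?orbT.
    by case: (inct e' ak) => ->; rewrite QE eqxx ?orbT.
  have K1 := kS0 k1 S1 a1; have K2 := kS0 k2 S2 a2.
  by exists k1, k2; split=> //; apply: adj0.
have mem2 l u u' : l \in links G' -> @lab G' l = Cut u u' -> inl l \in S' ->
    inr (inl u) \in S' /\ inr (inl u') \in S'.
  move=> lL ll lS; have [[?|e1] [[?|e2] [S1 S2 ne //]]] := deg _ lS.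
  have eP e : @incident G' d l e -> e = inl u \/ e = inl u'.
    case/and3P=> _ _; rewrite ll; case: e => //= z.
    by rewrite andbT orbF !inE => /orP[]/eqP->; [left | right].
  by move=> /eP[] e1E /eP[] e2E; rewrite e1E e2E ?eqxx in S1 S2 ne.
have start u0 l : inl l \in S' -> (l = c /\ u0 = a \/ l = t /\ u0 = b) ->
    [/\ u0 \in [:: a; b], inr (inl u0) \in S0, box c = d
      & exists2 k, k \in S0 & @adj G d (inr (inl u0)) k].
  move=> lS lu; have [_ lL lG lb] := linkS l lS.
  have u0S : inr (inl u0) \in S'.
    case: lu lS lL => -[-> ->] lS lL; first by case: (mem2 _ _ _ lL labc lS).
    by case: (mem2 _ _ _ lL labt lS).
  have u0l : u0 \in premise_wires (@lab G' l).
    by case: lu => -[-> ->]; rewrite ?labc ?labt inE eqxx.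
  split; [|exact: edgeS0| |].
  - by case: lu => -[_ ->]; rewrite !inE eqxx ?orbT.
  - by case: lu lb => -[-> _] lb //; rewrite -tbox.
  (* The neighbour of [u0] other than its cut is its source, hence not one of the new cuts. *)
  have [[l'|?] [lS' nl // al]] := deg2_avoid (inl l) (deg _ u0S).
  have [_ lL' lG' lb'] := linkS l' lS'.
  have l'S0 : inl l' \in S0.
    have l'n l0 : conclusion_wires (@lab G' l0) = [::] -> l' != l0.
      move=> l0c; apply: contraNneq nl => e; rewrite e in al lL' *.
      case/incidentE: al => _ _ [[ul _]|]; last by rewrite l0c.
      by apply/eqP; congr inl; apply: (tidy_prem mult_reduct_tidy lL' lL ul u0l).
    rewrite S0E lS' andbT; apply/andP; split.
      by apply: contra_neq (l'n c _) => [[]|] //; rewrite labc.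
    by apply: contra_neq (l'n t _) => [[]|] //; rewrite labt.
  exists (inl l') => //.
  by apply: (@adj0 (inr (inl u0)) (inl l')) => //; apply: edgeS0.
have S00 : inl c \notin S' -> inl t \notin S' -> S0 = S'.
  move=> cS tS; apply/setP => v; rewrite S0E.
  have [vc|_] := eqVneq v (inl c); first by rewrite vc (negbTE cS).
  by have [vt|_] := eqVneq v (inl t); first by rewrite vt (negbTE tS).
have nSxy u : u \in [:: x; y] -> inr (inl u) \notin S'.
  move=> uxy; apply/negP=> /deg[[l|?] [? [lS _ _ // al _]]].
  have [np lL lG lb] := linkS l lS.
  case/incidentE: al => _ _ [[ul _]|/conclP[_ nt ul]].
  - have uc : u \in premise_wires (lab c) by case/cut_on_link: cc => _ ->.
    case: (premP lL ul) => [[_ eu]|[_ eu]|[ncl _ _ ul']].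
    + by case: eu uc => -> uc; [have := ncut ta | have := ncut' pa]; rewrite uc.
    + by case: eu uc => -> uc; [have := ncut tb | have := ncut' pb]; rewrite uc.
    + by rewrite (tidy_prem tG lG cG ul' uc) eqxx in ncl.
  - move: uxy ul; rewrite !inE => /orP[] /eqP-> ul.
      by rewrite (tidy_concl tG lG tGl ul tx) eqxx in nt.
    by rewrite (tidy_concl tG lG pG ul py) eqxx in np.
(* Without the new cuts, the core lies already in the net. *)
have [|noct] := boolP ((inl c \in S') || (inl t \in S')); last first.
  have [cS tS] : inl c \notin S' /\ inl t \notin S' by apply/andP; rewrite -negb_or.
  have eS := S00 cS tS.
  case: (nc d S0); split=> //; first by rewrite eS.
  move=> v vS; have [vQ|] := boolP (v \in Q); last exact: deg0.
  have vS' := S0S' v vS.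
  have [k1 [k2 [S1 S2 ne a1 a2]]] := deg v vS'.
  have K1 : k1 \in S0 by rewrite eS.
  have K2 : k2 \in S0 by rewrite eS.
  by exists k1, k2; split=> //; apply: adj0.
move=> ctS; have {ctS} [u0 [u0t u0S cb [k0 k0S ak0]]] : exists u0,
    [/\ u0 \in [:: a; b], inr (inl u0) \in S0, box c = d
      & exists2 k, k \in S0 & @adj G d (inr (inl u0)) k].
  by case/orP: ctS => lS; [exists a; apply: (start a c lS); left
                          | exists b; apply: (start b t lS); right].
have := @walk_or_core _ (@adj G d) S0 Q (inr (inl u0)) (@adj_sym G d)
  (@adj_irr G d) u0S (ex_intro2 _ _ k0 k0S ak0).
case=> [v vS _ vQ|[K [KS Kn0 degK]]|]; first exact: deg0.
  by case: (nc d K); split=> //; apply: one_premise_sub one0.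
case=> K [q [KS u0K [qK qQ nq] [stp [[k1 k1K ak1] [k2 k2K ak2]]] degK]].
have KS0 := subsetP KS; have oneK := one_premise_sub KS one0.
have [e] : exists e, q = inr (inl e).
  by move: qQ; rewrite 3!in_setU 4!in_set1 -!orbA => /or4P[] /eqP->; eexists.
move=> eq; rewrite {q}eq in qK qQ nq stp ak2 degK.
have ne : e != u0 by apply: contra_neq nq => ->.
have nK l : inl l \in K -> [/\ l != c, l != t, l != p & l \in links G'].
  move=> lK; have [lc lt' lS] := linkS0 l (KS0 _ lK).
  by have [] := linkS l lS.
have tK k : k \in K -> k != inl t.
  by case: k => // l /nK[_ nt _ _]; apply: contra_neq nt => -[].
have pK k : k \in K -> k != inl p.
  by case: k => // l /nK[_ _ np _]; apply: contra_neq np => -[].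
have in_tens u : u \in [:: a; b] -> u \in premise_wires (lab t) by rewrite lt !inE.
have in_par u : u \in [:: a'; b'] -> u \in premise_wires (lab p) by rewrite lp !inE.
have t_adj u : u \in [:: a; b] -> @adj G d (inl t) (inr (inl u)).
  by move=> ut; rewrite /= incident_prem ?tbox ?in_tens.
have p_adj u : u \in [:: a'; b'] -> @adj G d (inl p) (inr (inl u)).
  by move=> up; rewrite /= incident_prem ?pbox ?in_par.
have degF (F : {set vertex G}) v : K \subset F -> v \in K ->
    (v = inr (inl u0) -> deg2 (@adj G d) F v) ->
    (v = inr (inl e) -> deg2 (@adj G d) F v) -> deg2 (@adj G d) F v.
  move=> KF vK d0 d1; have [/d0//|n0] := eqVneq v (inr (inl u0)).
  have [/d1//|n1] := eqVneq v (inr (inl e)).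
  exact: deg2_sub KF (degK v vK n0 n1).
move: qQ; rewrite QE => eQ.
have [et|ent] := boolP (e \in [:: a; b]).
  pose F := inl t |: K.
  have KF : K \subset F by apply: subsetUr.
  have tF : inl t \in F by rewrite in_setU in_set1 eqxx.
  have KF' := subsetP KF.
  apply: (nc d F); split; first by apply/set0Pn; exists (inl t).
  - move=> l f f' lF fF f'F lf lf'.
    have lK : inl l \in K.
      move: lF; rewrite in_setU in_set1 => /orP[/eqP[el]|//].
      by move: lf; rewrite el /switched_premise lt.
    have eK g : inr g \in F -> inr g \in K by rewrite in_setU in_set1.
    exact: oneK lK (eK _ fF) (eK _ f'F) lf lf'.
  - move=> v; rewrite in_setU in_set1 => /orP[/eqP->|vK].
      apply: (deg2_cons (KF' _ u0K) (t_adj _ u0t) (KF' _ qK) (t_adj _ et)).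
      by apply: contra_neq ne => -[].
    apply: degF => // ->.
      apply: (deg2_cons (KF' _ k1K) ak1 tF); [rewrite adj_sym;
          exact: t_adj | exact: tK].
    apply: (deg2_cons (KF' _ k2K) ak2 tF); [rewrite adj_sym; exact: t_adj | exact: tK].
have ep : e \in [:: a'; b'] by move: eQ ent; rewrite !inE orbA => /orP[->|].
pose T : {set vertex G} := [set inl t; inr (inl x); inl c; inr (inl y); inl p].
have TE v : (v \in T) = [|| v == inl t, v == inr (inl x), v == inl c,
    v == inr (inl y) | v == inl p].
  by rewrite 4!in_setU 5!in_set1 -!orbA.
pose F := T :|: K.
have KF : K \subset F by apply: subsetUr.
have KF' := subsetP KF.
have TF v : v \in T -> v \in F by move=> vT; rewrite in_setU vT.
have tF : inl t \in F by apply: TF; rewrite TE eqxx ?orbT.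
have xF : inr (inl x) \in F by apply: TF; rewrite TE eqxx ?orbT.
have cF : inl c \in F by apply: TF; rewrite TE eqxx ?orbT.
have yF : inr (inl y) \in F by apply: TF; rewrite TE eqxx ?orbT.
have pF : inl p \in F by apply: TF; rewrite TE eqxx ?orbT.
apply: (nc d F); split; first by apply/set0Pn; exists (inl t).
- move=> l f f' lF fF f'F lf lf'.
  have fK g : inr g \in F -> inr g \in K \/ (g = inl x \/ g = inl y).
    rewrite in_setU TE => /orP[|]; last by left.
    by case/or4P=> [/eqP//|/eqP[->]|/eqP//|/orP[/eqP[->]|/eqP//]]; right; [left|right].
  have xyl g : g = inl x \/ g = inl y -> switched_premise l g -> l = c.
    move=> gxy /switched_premiseP gl.
    have lG : l \in links G.
      move: lF; rewrite in_setU TE => /orP[|/nK[_ _ _ /linksP[]]//].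
      by case/or4P=> [/eqP[->]|/eqP//|/eqP[->]|/orP[/eqP//|/eqP[->]]].
    by case: gxy gl => -> gl; [apply: (tidy_prem tG lG cG gl cx) | apply:
        (tidy_prem tG lG cG gl cy)].
  have lc : l != c by apply: contraTneq lf => ->; rewrite (cut_on_not_switched _ cc).
  have fK' g : inr g \in F -> switched_premise l g -> inr g \in K.
    by case/fK=> // gxy /(xyl g gxy) elc; rewrite elc eqxx in lc.
  move: lF; rewrite in_setU TE => /orP[|lK]; last first.
    exact: oneK lK (fK' _ fF lf) (fK' _ f'F lf') lf lf'.
  case/or4P=> [/eqP[el]|/eqP//|/eqP[el]|/orP[/eqP//|/eqP[el]]].
  + by move: lf; rewrite el /switched_premise lt.
  + by rewrite el eqxx in lc.
  (* The walk meets the four wires only at its ends, and it starts at a premise of the tensor: [e]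
     is the only premise of the par in [F]. *)
  have fe g : inr g \in F -> switched_premise l g -> g = inl e.
    move=> gF lg; have gK := fK' g gF lg.
    move: lg; rewrite el /switched_premise lp; case: g {gF} gK => // u uK uab.
    have /stp : inr (inl u) \in Q by rewrite QE; case/orP: uab => ->; rewrite ?orbT.
    case=> // [[eu]|[->//]]; move: (neq_tens_par u0t (u' := u)).
    by rewrite !inE => /(_ uab); rewrite eu eqxx.
  by rewrite (fe f fF lf) (fe f' f'F lf').
move=> v; rewrite in_setU TE => /orP[|vK]; last first.
  apply: degF => // ->.
    apply: (deg2_cons (KF' _ k1K) ak1 tF); [rewrite adj_sym; exact: t_adj | exact: tK].
  apply: (deg2_cons (KF' _ k2K) ak2 pF); [rewrite adj_sym; exact: p_adj | exact: pK].
case/or4P=> [/eqP->|/eqP->|/eqP->|/orP[]/eqP->].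
- apply: (deg2_cons (KF' _ u0K) (t_adj _ u0t) xF).
    by rewrite /= incident_concl ?tbox.
  apply: contraNneq (ncut (in_tens _ u0t)) => -[->]; exact: cx.
- apply: (deg2_cons tF _ cF); [by rewrite /= incident_concl ?tbox | by rewrite /=
    incident_prem |].
  by apply: contra_neq ct => -[].
- apply: (deg2_cons xF _ yF); [by rewrite /= incident_prem | by rewrite /=
    incident_prem |].
  by apply: contra_neq xy => -[].
- apply: (deg2_cons cF _ pF); [by rewrite /= incident_prem | by rewrite /=
    incident_concl ?pbox |].
  by apply: contra_neq cp => -[].
- apply: (deg2_cons (KF' _ qK) (p_adj _ ep) yF).
    by rewrite /= incident_concl ?pbox.
  apply: contraNneq (ncut' (in_par _ ep)) => -[->]; exact: cy.
Qed.

End MultiplicativeStep.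

(** * The exponential step *)

Section ExponentialStep.
Variables (G : net) (tG : tidy G).
Variables (c o w : node G) (a x y : wire G).
Hypotheses (cc : cut_on c x y) (oG : o \in links G) (lo : lab o = OfCourse a x).
Hypotheses (wG : w \in links G) (lw : lab w = WhyNot y).

Local Notation G' := (exp_reduct c o w a).
Implicit Types (l m b f g v : node G) (u z : wire G) (d : option (node G)).

Let cG : c \in links G. Proof. by case: cc. Qed.
Let xo : x \in conclusion_wires (lab o). Proof. by rewrite lo inE. Qed.
Let yw : y \in conclusion_wires (lab w). Proof. by rewrite lw inE. Qed.
Let ao : a \in premise_wires (lab o). Proof. by rewrite lo inE. Qed.
Let cx : x \in premise_wires (lab c). Proof. by case: (cut_on_prem cc). Qed.
Let cy : y \in premise_wires (lab c). Proof. by case: (cut_on_prem cc). Qed.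
Let xy : x != y. Proof. exact: (cut_on_neq tG cc). Qed.
Let ccl : conclusion_wires (lab c) = [::]. Proof. by case/cut_on_link: cc. Qed.
Let cno : ~~ is_of_course (lab c). Proof. by case/cut_on_link: cc. Qed.
Let co : c != o. Proof. by apply/eqP=> e; move: ccl; rewrite e lo. Qed.
Let cw : c != w. Proof. by apply/eqP=> e; move: ccl; rewrite e lw. Qed.
Let ow : o != w. Proof. by apply/eqP=> e; move: lw; rewrite -e lo. Qed.

Lemma cut_box_of_course : box o = box c.
Proof. exact: (cut_on_box tG cc oG xo). Qed.

Lemma cut_box_why_not : box w = box c.
Proof. exact: (cut_on_box tG (cut_onC cc) wG yw). Qed.

Lemma cut_box_eq : box o = box w.
Proof. by rewrite cut_box_of_course cut_box_why_not. Qed.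

Lemma inside_cut_eq b : inside b w = inside b o.
Proof. exact/inside_box/esym/cut_box_eq. Qed.

Let noo : ~~ inside o o. Proof. exact: (tidy_nested tG oG). Qed.
Let now : ~~ inside o w. Proof. by rewrite inside_cut_eq. Qed.

Lemma why_not_above f : f \in flats w ->
  [/\ f \in links G, exists u, lab f = Flat u w
    & forall b, inside b w -> inside b f].
Proof.
case/flatsP=> fG fw; have [_ _ win] := tidy_flat tG fG fw.
by split=> //; apply: flat_labP fw.
Qed.

(* Otherwise the box, the cut and the why not link would form a cycle. *)
Lemma flats_outside f : coreless G -> f \in flats w -> ~~ inside o f.
Proof.
move=> nc fw; apply/negP=> fo; have [fG [u lf] _] := why_not_above fw.
pose S : {set vertex G} :=
  [set inl c; inl o; inl w; inr (inl x); inr (inl y); inr (inr f)].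
have SE (v : vertex G) : (v \in S) = [|| v == inl c, v == inl o, v == inl w,
    v == inr (inl x), v == inr (inl y) | v == inr (inr f)].
  by rewrite 5!in_setU 6!in_set1 -!orbA.
have cS : inl c \in S by rewrite SE eqxx ?orbT.
have oS : inl o \in S by rewrite SE eqxx ?orbT.
have wS : inl w \in S by rewrite SE eqxx ?orbT.
have xS : inr (inl x) \in S by rewrite SE eqxx ?orbT.
have yS : inr (inl y) \in S by rewrite SE eqxx ?orbT.
have fS : inr (inr f) \in S by rewrite SE eqxx ?orbT.
have io : incident (box c) o (inr f).
  rewrite /incident oG lo cut_box_of_course eqxx /=.
  by apply/paxP; exists w; split=> //; rewrite lf.
have iw : incident (box c) w (inr f).
  by rewrite /incident wG lw cut_box_why_not eqxx.
have iox : incident (box c) o (inl x).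
  by apply: incident_concl => //; exact: cut_box_of_course.
have iwy : incident (box c) w (inl y).
  by apply: incident_concl => //; exact: cut_box_why_not.
have icx : incident (box c) c (inl x) by apply: incident_prem.
have icy : incident (box c) c (inl y) by apply: incident_prem.
apply: (nc (box c) S); split; first by apply/set0Pn; exists (inl c).
  move=> l e e' lS eS e'S.
  have eE e0 : inr e0 \in S -> [\/ e0 = inl x, e0 = inl y | e0 = inr f].
    rewrite SE => /or4P[/eqP//|/eqP//|/eqP//|/or3P[]/eqP[->]].
    - by constructor 1.
    - by constructor 2.
    - by constructor 3.
  move: lS; rewrite SE => /or4P[/eqP[->]|/eqP[->]|/eqP[->]|/or3P[]/eqP//].
  - by rewrite (cut_on_not_switched _ cc).
  - by rewrite /switched_premise lo.
  - by rewrite /switched_premise lw; case: (eE e eS) => -> //; case: (eE e' e'S) => ->.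
move=> v; rewrite SE => /or4P[/eqP->|/eqP->|/eqP->|/or3P[]/eqP->].
- by apply: (deg2_cons xS _ yS) => //; apply: contra_neq xy => -[].
- by apply: (deg2_cons xS _ fS).
- by apply: (deg2_cons yS _ fS).
- by apply: (deg2_cons cS _ oS).
- by apply: (deg2_cons cS _ wS).
- by apply: (deg2_cons oS _ wS).
Qed.

(** Granted by [flats_outside] in a coreless net; it keeps copies of the box from being placed
    inside the box. *)
Hypothesis fo : forall f, f \in flats w -> ~~ inside o f.

Lemma exp_inside_outer (B : node G') l : reflect
  (exists2 b, B = inl b & inside b l) (@inside G' B (inl l)).
Proof.
apply: (iffP idP) => [/insideP|[b ->{B} /insideP]].
  move e: (inl l : node G') => L bl.
  elim: bl l e => {L}[L lb|L M lm _ IH] l e; move: lb || move: lm; rewrite -e /=.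
    by case E: (box l) => [b0|] //= [<-]; exists b0 => //; apply: inside_here.
  case E: (box l) => [m|] //= [/IH[b -> bm]]; exists b => //.
  by rewrite (inside_step _ E) bm orbT.
elim=> {l}[l lb|l m lm _ IH]; first by apply: inside_here; rewrite /= lb.
have lm' : @box G' (inl l) = Some (inl m) by rewrite /= lm.
by rewrite (inside_step _ lm') IH orbT.
Qed.

(** The box is opened at the place of [f]: around the copy of [l] come the copies of the boxes
    strictly inside [o], then the boxes around [f]. *)
Lemma exp_inside_copy (B : node G') l f : inside o l -> reflect
  ((exists b, [/\ B = inr (b, f), inside b l & inside o b])
   \/ (exists2 b, B = inl b & inside b f))
  (@inside G' B (inr (l, f))).
Proof.
move=> ol; apply: (iffP idP) => [/insideP|].
  move e: (inr (l, f) : node G') => L bl.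
  elim: bl l e ol => {L}[L lb|L M lm bM IH] l e ol; move: lb || move: lm;
    rewrite -e /=; case: eqP => [lo'|lo'].
  - by case E: (box f) => [b|] //= [<-]; right; exists b => //; apply: inside_here.
  - case E: (box l) => [b|] //= [<-]; left; exists b; split=> //.
      exact: inside_here.
    move: ol; rewrite (inside_step _ E) => /orP[/eqP eb|//].
    by rewrite E eb in lo'.
  - case E: (box f) => [m|] //= [em]; right.
    have /exp_inside_outer[b eB bm] : @inside G' B (inl m).
      by rewrite em; apply/insideP; exact: bM.
    by exists b => //; rewrite (inside_step _ E) bm orbT.
  - case E: (box l) => [m|] //= [em].
    have om : inside o m.
      move: ol; rewrite (inside_step _ E) => /orP[/eqP eb|//].
      by rewrite E eb in lo'.
    have [[b [eB bm ob]]|[b eB bf]] := IH m em om.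
      by left; exists b; split=> //; rewrite (inside_step _ E) bm orbT.
    by right; exists b.
case=> [[b [->{B} bl ob]]|[b ->{B} bf]].
  elim: (insideP _ _ bl) ol => {bl l}[l lb|l m lm /insideP bm IH] ol.
    apply: inside_here => /=; rewrite lb; case: eqP => [[eb]|//].
    by move: ob; rewrite eb (negbTE noo).
  have mo : m != o.
    apply: contraNneq noo => em; apply: (inside_trans ob); rewrite -em.
    exact: bm.
  have lm' : @box G' (inr (l, f)) = Some (inr (m, f)).
    by rewrite /= lm ifN.
  rewrite (inside_step _ lm') IH ?orbT //.
  move: ol; rewrite (inside_step _ lm) => /orP[/eqP em|//].
  by rewrite em eqxx in mo.
have top l0 : box l0 = Some o -> @inside G' (inl b) (inr (l0, f)).
  case E: (box f) => [m|] lo'; last by rewrite (inside_out _ E) in bf.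
  have lm' : @box G' (inr (l0, f)) = Some (inl m) by rewrite /= lo' eqxx E.
  move: bf; rewrite (inside_step _ E) (inside_step _ lm') => /orP[/eqP->|bm].
    by rewrite eqxx.
  by apply/orP; right; apply/exp_inside_outer; exists b.
elim: (insideP _ _ ol) => {ol l}[l /top //|l m lm _ IH].
have [em|nm] := eqVneq m o; first by apply: top; rewrite lm em.
have lm' : @box G' (inr (l, f)) = Some (inr (m, f)) by rewrite /= lm ifN.
by rewrite (inside_step _ lm') IH orbT.
Qed.

Lemma exp_links_outer l : (inl l \in links G') =
  [&& l \in links G, ~~ inside o l, l != c, l != o & l != w].
Proof.
by rewrite inE !inE !negb_or -!andbA.
Qed.

Lemma exp_links_copy l f : (inr (l, f) \in links G') =
  [&& l \in links G, inside o l & f \in flats w].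
Proof. by rewrite inE. Qed.

Lemma exp_lab_above f : f \in flats w -> exists2 u, lab f = Flat u w &
  @lab G' (inl f) = Cut (inl u) (inr (a, f)).
Proof.
by move=> /[dup] fw /why_not_above[_ [u lf] _]; exists u; rewrite //= lf fw.
Qed.

Lemma exp_lab_outer l : l \notin flats w ->
  @lab G' (inl l) = map_link inl inl (lab l).
Proof. by move=> lf /=; rewrite (negbTE lf); case: (lab l). Qed.

Lemma exp_lab_copy l f : @lab G' (inr (l, f)) =
  map_link (fun u => inr (u, f))
    (fun v => if inside o v then inr (v, f) else inl v) (lab l).
Proof. by []. Qed.

Lemma exp_concl_outer (X : wire G') l :
  X \in conclusion_wires (@lab G' (inl l)) ->
  exists2 u, X = inl u & u \in conclusion_wires (lab l).
Proof.
have [/exp_lab_above[u _ ->//]|/exp_lab_outer->] := boolP (l \in flats w).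
by rewrite map_link_conclusions => /mapP[u ul ->]; exists u.
Qed.

Lemma exp_concl_copy (X : wire G') l f :
  X \in conclusion_wires (@lab G' (inr (l, f))) ->
  exists2 u, X = inr (u, f) & u \in conclusion_wires (lab l).
Proof.
by rewrite exp_lab_copy map_link_conclusions => /mapP[u ul ->]; exists u.
Qed.

Lemma exp_prem_outer (X : wire G') l :
  X \in premise_wires (@lab G' (inl l)) ->
  (exists2 u, X = inl u & u \in premise_wires (lab l)) \/
  l \in flats w /\ X = inr (a, l).
Proof.
have [/[dup] lw' /exp_lab_above[u lf ->]|/exp_lab_outer->] := boolP (l \in flats w).
  rewrite !inE => /orP[]/eqP->; last by right.
  by left; exists u; rewrite // lf inE.
by rewrite map_link_premises => /mapP[u ul ->]; left; exists u.
Qed.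

Lemma exp_prem_copy (X : wire G') l f :
  X \in premise_wires (@lab G' (inr (l, f))) ->
  exists2 u, X = inr (u, f) & u \in premise_wires (lab l).
Proof.
by rewrite exp_lab_copy map_link_premises => /mapP[u ul ->]; exists u.
Qed.

Lemma exp_of_course_outer l : is_of_course (@lab G' (inl l)) = is_of_course (lab l).
Proof. by rewrite /=; case: (lab l) => //= u v; case: ifP. Qed.

Lemma exp_of_course_copy l f :
  is_of_course (@lab G' (inr (l, f))) = is_of_course (lab l).
Proof. by rewrite exp_lab_copy map_link_of_course. Qed.

Lemma exp_why_not_outer l : is_why_not (@lab G' (inl l)) = is_why_not (lab l).
Proof. by rewrite /=; case: (lab l) => //= u v; case: ifP. Qed.

Lemma exp_why_not_copy l f :
  is_why_not (@lab G' (inr (l, f))) = is_why_not (lab l).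
Proof. by rewrite exp_lab_copy map_link_why_not. Qed.

Lemma exp_flat_outer (B : node G') l :
  flat_target (@lab G' (inl l)) = Some B ->
  exists v, [/\ l \notin flats w, flat_target (lab l) = Some v & B = inl v].
Proof.
have [/exp_lab_above[u _ ->//]|lnw] := boolP (l \in flats w).
rewrite exp_lab_outer // map_link_flat.
by case: (flat_target (lab l)) => //= v [<-]; exists v.
Qed.

Lemma exp_flat_copy (B : node G') l f :
  flat_target (@lab G' (inr (l, f))) = Some B ->
  exists2 v, flat_target (lab l) = Some v &
    B = if inside o v then inr (v, f) else inl v.
Proof.
rewrite exp_lab_copy map_link_flat.
by case: (flat_target (lab l)) => //= v [<-]; exists v.
Qed.

(** The box [b] also contains [g], hence is comparable with [o]; it is neither [o] nor inside [o],
    since [v] is outside [o]. *)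
Lemma leaving_chain g v b : g \in links G -> flat_target (lab g) = Some v ->
  inside o g -> ~~ inside o v -> inside b v -> inside b o.
Proof.
move=> gG gv og nov bv; have [_ _ win] := tidy_flat tG gG gv.
have [e|//|ob] := inside_comparable (win b bv) og.
  by rewrite -e bv in nov.
by rewrite (inside_trans ob bv) in nov.
Qed.

Lemma exp_box_copy l f : inside o l ->
  (box l = Some o /\ @box G' (inr (l, f)) = omap inl (box f)) \/
  (exists b, [/\ box l = Some b, inside o b & @box G' (inr (l, f)) = Some (inr
      (b, f))]).
Proof.
move=> ol; rewrite /=; case: eqP => [->|nlo]; first by left.
right; case E: (box l) nlo => [b|] nlo; last by rewrite (inside_out _ E) in ol.
exists b; split=> //; move: ol; rewrite (inside_step _ E) => /orP[/eqP e|//].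
by rewrite e in nlo.
Qed.

Lemma exp_reduct_tidy : tidy G'.
Proof.
have outG l : inl l \in links G' -> l \in links G by rewrite exp_links_outer => /andP[].
have cpG l f : inr (l, f) \in links G' ->
    l \in links G by rewrite exp_links_copy => /andP[].
have no_oprem l f u : inr (l, f) \in links G' -> u \in premise_wires (lab l) -> u != a.
  rewrite exp_links_copy => /and3P[lG ol _] ul; apply: contraNneq noo => e.
  by rewrite -{2}(tidy_prem tG lG oG _ ao) // -e.
have out_oprem l u : inl l \in links G' -> u \in premise_wires (lab l) -> u != a.
  rewrite exp_links_outer => /and5P[lG _ _ lo' _] ul; apply: contraNneq lo' => e.
  by apply/eqP; apply: (tidy_prem tG lG oG _ ao); rewrite -e.
split.
- move=> [l|[l f]] [m|[m f']] X lG mG.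
  + move=> /exp_concl_outer[u -> ul] /exp_concl_outer[_ [<-] um].
    by rewrite (tidy_concl tG (outG _ lG) (outG _ mG) ul um).
  + by move=> /exp_concl_outer[u -> ul] /exp_concl_copy[].
  + by move=> /exp_concl_copy[u -> ul] /exp_concl_outer[].
  + move=> /exp_concl_copy[u -> ul] /exp_concl_copy[_ [<- <-] um].
    by rewrite (tidy_concl tG (cpG _ _ lG) (cpG _ _ mG) ul um).
- move=> [l|[l f]] lG.
    have [/exp_lab_above[u _ ->//]|lnw] := boolP (l \in flats w).
    rewrite exp_lab_outer // map_link_conclusions map_inj_uniq; last by move=> u z [].
    exact: (tidy_uniq_concl tG (outG _ lG)).
  rewrite exp_lab_copy map_link_conclusions map_inj_uniq; last by move=> u z [].
  exact: (tidy_uniq_concl tG (cpG _ _ lG)).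
- move=> [l|[l f]] [m|[m f']] X lG mG.
  + move=> /exp_prem_outer[[u -> ul]|[lw' ->]] /exp_prem_outer[[z e um]|[mw e]] //.
      by case: e um => <- um; rewrite (tidy_prem tG (outG _ lG) (outG _ mG) ul um).
    by case: e => ->.
  + move=> /exp_prem_outer[[u -> ul]|[lw' ->]] /exp_prem_copy[z e um] //.
    by case: e um => <- _ um; have := no_oprem _ _ _ mG um; rewrite eqxx.
  + move=> /exp_prem_copy[z -> um] /exp_prem_outer[[u // ul]|[lw' [e _]]].
    by have := no_oprem _ _ _ lG um; rewrite e eqxx.
  + move=> /exp_prem_copy[u -> ul] /exp_prem_copy[_ [<- <-] um].
    by rewrite (tidy_prem tG (cpG _ _ lG) (cpG _ _ mG) ul um).
- move=> [l|[l f]] lG.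
    have [/exp_lab_above[u _ ->//]|lnw] := boolP (l \in flats w).
    rewrite exp_lab_outer // map_link_premises map_inj_uniq; last by move=> u z [].
    exact: (tidy_uniq_prem tG (outG _ lG)).
  rewrite exp_lab_copy map_link_premises map_inj_uniq; last by move=> u z [].
  exact: (tidy_uniq_prem tG (cpG _ _ lG)).
- move=> [g|[g f]] V gL.
    move=> /exp_flat_outer[v [gnw gv ->]].
    have gG := outG _ gL; have [vG vw win] := tidy_flat tG gG gv.
    rewrite exp_why_not_outer; split=> //.
      move: gL; rewrite !exp_links_outer vG => /and5P[_ og _ _ _].
      rewrite (contraNN (win o) og) /=; apply/and3P; split; apply/eqP=> e.
      - by move: vw; rewrite e; case: cc => _ [->|->].
      - by move: vw; rewrite e lo.
      - by case/flatsP: gnw; split=> //; rewrite gv e.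
    move=> B /exp_inside_outer[b -> bv]; apply/exp_inside_outer.
    by exists b => //; apply: win.
  move=> /exp_flat_copy[v gv ->].
  have gG := cpG _ _ gL; have [vG vw win] := tidy_flat tG gG gv.
  move: gL; rewrite exp_links_copy => /and3P[_ og fw].
  have [ov|nov] := boolP (inside o v).
    rewrite exp_links_copy vG ov fw exp_why_not_copy; split=> // B.
    case/(exp_inside_copy _ _ ov) => [[b [-> bv ob]]|[b -> bf]].
      by apply/(exp_inside_copy _ _ og); left; exists b; split=> //; apply: win.
    by apply/(exp_inside_copy _ _ og); right; exists b.
  rewrite exp_links_outer vG nov exp_why_not_outer; split=> //=.
    apply/and3P; split; apply/eqP=> e.
    - by move: vw; rewrite e; case: cc => _ [->|->].
    - by move: vw; rewrite e lo.
    - have gw : g \in flats w by apply/flatsP; rewrite gv e.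
      by have := fo gw; rewrite og.
  (* A box around [v] is around [o] by [leaving_chain], hence around [w], which has the same
     location, and so around [f]. *)
  move=> B /exp_inside_outer[b -> bv]; apply/(exp_inside_copy _ _ og).
  right; exists b => //; have [_ _ fwin] := why_not_above fw; apply: fwin.
  by rewrite inside_cut_eq; apply: leaving_chain gv og nov bv.
- have outb l b : box l = Some b -> l \in links G -> ~~ inside o l ->
      inl b \in links G' /\ is_of_course (@lab G' (inl b)).
    move=> lb lG ol; have [bG bo] := tidy_box tG lG lb.
    rewrite exp_links_outer exp_of_course_outer bG; split=> //=.
    apply/and4P; split.
    + by apply: contraNN ol => ob; apply: inside_trans ob (inside_here lb).
    + by apply: contraTneq bo => ->.
    + by apply: contraNneq ol => <-; apply: inside_here.
    + by apply: contraTneq bo => ->; rewrite lw.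
  move=> [l|[l f]] B lL.
    move: lL; rewrite exp_links_outer => /and5P[lG ol _ _ _] /=.
    by case E: (box l) => [b|] //= [<-]; apply: outb E _ _.
  have lG := cpG _ _ lL; move: lL; rewrite exp_links_copy => /and3P[_ ol fw].
  have [[_ ->]|[b [lb ob ->]]] := exp_box_copy f ol.
    have [fG _ _] := why_not_above fw.
    by case E: (box f) => [b|] //= [<-]; apply: outb E _ _ => //; apply: fo.
  case=> <-; have [bG bo] := tidy_box tG lG lb.
  by rewrite exp_links_copy bG ob fw exp_of_course_copy.
- move=> [b|[b f]] bL; apply/negP.
    case/exp_inside_outer=> _ [<-] bb.
    by have := tidy_nested tG (outG _ bL); rewrite bb.
  have bG := cpG _ _ bL; move: bL; rewrite exp_links_copy => /and3P[_ ob fw].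
  case/(exp_inside_copy _ _ ob)=> [[_ [[<-] bb _]]|[]//].
  by have := tidy_nested tG bG; rewrite bb.
- move=> [l|[l f]] [m|[m f']] X lL mL.
  + move=> /exp_concl_outer[u -> ul] /exp_prem_outer[[_ [<-] um]|[]//].
    rewrite exp_of_course_outer /= (tidy_border tG (outG _ lL) (outG _ mL) ul um).
    by case: ifP.
  + by move=> /exp_concl_outer[u -> ul] /exp_prem_copy[].
  + move=> /exp_concl_copy[u -> ul] /exp_prem_outer[[]//|[mw [eu ef]]].
    have [_ [z lm] _] := why_not_above mw; rewrite exp_of_course_outer lm;
        rewrite {f}ef eu in lL ul *.
    have := tidy_border tG (cpG _ _ lL) oG ul ao; rewrite lo /= => lbo.
    by rewrite lbo eqxx.
  + move=> /exp_concl_copy[u -> ul] /exp_prem_copy[_ [<- <-] um].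
    have := tidy_border tG (cpG _ _ lL) (cpG _ _ mL) ul um.
    rewrite exp_of_course_copy /=; case: ifP => mo -> //=.
    rewrite ifN //; apply: contraNneq noo => -[e].
    by move: mL; rewrite exp_links_copy e => /and3P[].
Qed.

End ExponentialStep.

Lemma deg2_preim (T T' : finType) (r : rel T) (r' : rel T') (S' : {set T'})
    (h : T -> T') (S : {set T}) v :
  (forall u, h u \in S' -> u \in S) -> deg2 r' S' (h v) ->
  (forall u', u' \in S' -> r' (h v) u' -> exists2 u, u' = h u & r v u) ->
  deg2 r S v.
Proof.
move=> hS [u1' [u2' [S1 S2 ne r1 r2]]] pre.
have [u1 e1 ru1] := pre _ S1 r1; have [u2 e2 ru2] := pre _ S2 r2.
exists u1, u2; split=> //; try by apply: hS; rewrite -?e1 -?e2.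
by apply: contraNneq ne => e; rewrite e1 e2 e.
Qed.

(** * No core appears in the exponential step *)

Section ExponentialCore.
Variables (G : net) (tG : tidy G) (nc : coreless G).
Variables (c o w : node G) (a x y : wire G).
Hypotheses (cc : cut_on c x y) (oG : o \in links G) (lo : lab o = OfCourse a x).
Hypotheses (wG : w \in links G) (lw : lab w = WhyNot y).

Local Notation G' := (exp_reduct c o w a).
Implicit Types (l m b f g v : node G) (u z : wire G) (d : option (node G))
  (e : wire G + node G) (p q : vertex G).

Let fo f (fw : f \in flats w) : ~~ inside o f :=
  flats_outside tG cc oG lo wG lw nc fw.
Let tG' : tidy G' := exp_reduct_tidy tG cc oG lo wG lw fo.
Let insideW b : inside b w = inside b o.
Proof. exact: (inside_cut_eq tG cc oG lo wG lw). Qed.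
Let above f (fw : f \in flats w) := why_not_above tG fw.

Definition outer_edge e : wire G' + node G' :=
  match e with inl u => inl (inl u) | inr g => inr (inl g) end.
Definition copy_edge f e : wire G' + node G' :=
  match e with inl u => inl (inr (u, f)) | inr g => inr (inr (g, f)) end.
Definition outer_vertex p : vertex G' :=
  match p with inl l => inl (inl l) | inr e => inr (outer_edge e) end.
Definition copy_vertex f p : vertex G' :=
  match p with inl l => inl (inr (l, f)) | inr e => inr (copy_edge f e) end.
Definition residual_vertex (P : vertex G') : vertex G :=
  match P with
  | inl (inl l) | inl (inr (l, _)) => inl l
  | inr (inl (inl u)) | inr (inl (inr (u, _))) => inr (inl u)
  | inr (inr (inl g)) | inr (inr (inr (g, _))) => inr (inr g)
  end.

(** With [pax g o], the chain from the copy of [g] for [f] leaves the copy; apart from the root [a],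
    such edges are the only exits of a copy. *)
Definition leaf_edge g f : wire G' + node G' := inr (inr (g, f)).

(** [OuterRoot] is the cut which replaces the flat link [l]. [OuterBox] covers the auxiliary ports
    which the chain of a copy may gain: a box around [f] which does not contain the end [v] of the
    chain has to be crossed. *)
Inductive outer_incidence l : wire G' + node G' -> Prop :=
| OuterOld e of incident (box l) l e
    & (if e is inr g then g \notin flats w else true) :
    outer_incidence l (outer_edge e)
| OuterRoot of l \in flats w : outer_incidence l (copy_edge l (inl a))
| OuterWhyNot g f of pax g o & g \in flats l & is_why_not (lab l) & f \in flats w :
    outer_incidence l (leaf_edge g f)
| OuterBox g f v of pax g o & g \in flats v & is_of_course (lab l) & f \in flats w
    & inside l f & ~~ inside l v : outer_incidence l (leaf_edge g f).

Lemma exp_flats_outer l (B : node G') :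
  B \in @flats G' (inl l) ->
  (exists g, [/\ B = inl g, g \in flats l, g \notin flats w & ~~ inside o g]) \/
  (exists g f, [/\ B = inr (g, f), pax g o, g \in flats l & f \in flats w]).
Proof.
case/flatsP; case: B => [g|[g f]] gL.
  case/exp_flat_outer=> // v [gnw gv [ev]]; left; exists g; split=> //.
    by apply/flatsP; rewrite gv ev; move: gL; rewrite exp_links_outer => /andP[].
  by move: gL; rewrite exp_links_outer => /and5P[].
move: gL; rewrite exp_links_copy => /and3P[gG og fw].
case/exp_flat_copy=> // v gv; case: ifP => // nov [ev]; right; exists g, f; split=> //.
  by apply/paxP; exists v; rewrite nov.
by apply/flatsP; rewrite gv ev.
Qed.

Lemma exp_flats_copy l f (B : node G') : B \in @flats G' (inr (l, f)) ->
  exists2 g, B = inr (g, f) & g \in flats l.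
Proof.
case/flatsP; case: B => [g|[g f']] gL.
  by case/exp_flat_outer=> // v [].
move: gL; rewrite exp_links_copy => /and3P[gG og fw].
case/exp_flat_copy=> // v gv; case: ifP => // ov [ev <-]; exists g => //.
by apply/flatsP; rewrite gv ev.
Qed.

Lemma exp_pax_outer b (B : node G') : @pax G' B (inl b) ->
  (exists g, [/\ B = inl g, pax g b & g \notin flats w]) \/
  (exists g f v, [/\ B = inr (g, f), pax g o, g \in flats v & f \in flats w]
     /\ inside b f /\ ~~ inside b v).
Proof.
case/paxP=> V [BL BV bB bV]; case: B BL BV bB => [g|[g f]] gL.
  case/exp_flat_outer=> // v [gnw gv ev] /exp_inside_outer[_ [<-] bg].
  left; exists g; split=> //; apply/paxP; exists v; split=> //.
    by move: gL; rewrite exp_links_outer => /andP[].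
  by apply: contraNN bV => bv; rewrite ev; apply/exp_inside_outer; exists b.
move: gL; rewrite exp_links_copy => /and3P[gG og fw].
case/exp_flat_copy=> // v gv ev.
case/(exp_inside_copy tG oG _ _ og)=> [[? []//]|[_ [<-] bf]].
move: bV; rewrite ev; case: ifP => [ov|nov] bV.
  case/negP: bV; apply/(exp_inside_copy tG oG _ _ ov).
  by right; exists b.
right; exists g, f, v; do ![split] => //.
- by apply/paxP; exists v; rewrite nov.
- exact/flatsP.
- by apply: contraNN bV => bv; apply/exp_inside_outer; exists b.
Qed.

Lemma exp_pax_copy b f (B : node G') : inside o b -> @pax G' B (inr (b, f)) ->
  exists2 g, B = inr (g, f) & pax g b.
Proof.
move=> ob /paxP[V [BL BV bB bV]]; case: B BL BV bB => [g|[g f']] gL.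
  by move=> _ /exp_inside_outer[].
move: gL; rewrite exp_links_copy => /and3P[gG og fw].
case/exp_flat_copy=> // v gv ev.
case/(exp_inside_copy tG oG _ _ og)=> [[_ [[<- ef] bg _]]|[]//].
rewrite -ef in ev *; exists g => //; apply/paxP; exists v; split=> //.
apply: contraNN bV => bv; have ov := inside_trans ob bv.
by rewrite ev ov; apply/(exp_inside_copy tG oG _ _ ov); left; exists b.
Qed.

Lemma incident_outer D l E : @incident G' D (inl l) E -> outer_incidence l E.
Proof.
case/and3P=> lL _ inc.
have lG : l \in links G by move: lL; rewrite exp_links_outer => /andP[].
case: E inc => [X|B].
  case/orP=> [/andP[]|].
    case/exp_prem_outer=> // [[u -> ul]|[lnw ->]]; last by move=> _; apply: OuterRoot.
    by rewrite exp_of_course_outer => no; apply: (@OuterOld l (inl u)) => //;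
        apply: incident_prem.
  case/exp_concl_outer=> // u -> ul.
  by apply: (@OuterOld l (inl u)) => //; apply: incident_concl.
have [/(exp_lab_above tG c o a)[u lf ->]//|lnw] := boolP (l \in flats w).
rewrite exp_lab_outer //.
case E: (lab l) => [||||||u v|u|u v|] //=.
- case/exp_pax_outer=> [[g [-> gl gnw]]|[g [f [v' [[-> go gv' fw] [lf nlv]]]]]].
    by apply: (@OuterOld l (inr g)) => //; rewrite /incident lG eqxx E.
  by apply: OuterBox gv' _ _ _ _ => //; rewrite E.
- case/exp_flats_outer=> [[g [-> gl gnw nog]]|[g [f [-> go gl fw]]]].
    by apply: (@OuterOld l (inr g)) => //; rewrite /incident lG eqxx E.
  by apply: OuterWhyNot => //; rewrite E.
- move/eqP=> ->; apply: (@OuterOld l (inr l)) => //.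
  by rewrite /incident lG eqxx E /=.
Qed.

Lemma incident_copy D l f E : @incident G' D (inr (l, f)) E ->
  exists2 e, E = copy_edge f e & incident (box l) l e.
Proof.
case/and3P=> lL _ inc.
move: lL; rewrite exp_links_copy => /and3P[lG ol fw].
case: E inc => [X|B].
  case/orP=> [/andP[]|].
    case/exp_prem_copy=> u -> ul; rewrite exp_of_course_copy => no.
    by exists (inl u) => //; apply: incident_prem.
  by case/exp_concl_copy=> u -> ul; exists (inl u) => //; apply: incident_concl.
rewrite exp_lab_copy; case E: (lab l) => [||||||u v|u|u v|] //=.
- case/(exp_pax_copy ol)=> g -> gl; exists (inr g) => //.
  by rewrite /incident lG eqxx E.
- case/exp_flats_copy=> g -> gl; exists (inr g) => //.
  by rewrite /incident lG eqxx E.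
- move/eqP=> ->; exists (inr l) => //.
  by rewrite /incident lG eqxx E /=.
Qed.

Lemma switched_copy l f e : inside o l -> f \in flats w ->
  switched_premise l e -> @switched_premise G' (inr (l, f)) (copy_edge f e).
Proof.
move=> ol fw; rewrite /switched_premise exp_lab_copy.
case E: (lab l) => [| | |u v z| | | |u| |] //=; case: e => //= g.
  by case/orP=> /eqP->; rewrite eqxx ?orbT.
case/flatsP=> gG gl; have [_ _ win] := tidy_flat tG gG gl.
apply/(@flatsP G'); split; first by rewrite exp_links_copy gG fw (win _ ol).
by rewrite exp_lab_copy map_link_flat gl /= ol.
Qed.

Lemma switched_outer l e : inl l \in links G' ->
  (if e is inr g then inl g \in links G' else true) ->
  switched_premise l e -> @switched_premise G' (inl l) (outer_edge e).
Proof.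
move=> lL eL; rewrite /switched_premise => le.
have lnw : l \notin flats w.
  by apply/negP=> /above[_ [u lf] _]; rewrite lf in le.
rewrite exp_lab_outer //; move: le;
    case E: (lab l) => [| | |u v z| | | |u| |] //=; case: e eL => //= g gL.
case/flatsP=> gG gl; apply/(@flatsP G'); split=> //;
    rewrite exp_lab_outer ?map_link_flat ?gl //.
apply/flatsP=> -[_]; rewrite gl => -[elw].
by move: lL; rewrite exp_links_outer elw eqxx !andbF.
Qed.

Lemma switched_leaf l g f : pax g o -> g \in flats l -> is_why_not (lab l) ->
  f \in flats w -> @switched_premise G' (inl l) (leaf_edge g f).
Proof.
case/paxP=> v [gG gv og nov] /flatsP[_ gl] lwn fw.
move: gl; rewrite gv => -[evl]; rewrite {v}evl in gv nov.
rewrite /switched_premise exp_lab_outer; last first.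
  by apply/negP=> /above[_ [u lf] _]; rewrite lf in lwn.
case E: (lab l) lwn => //= _; apply/(@flatsP G'); split.
  by rewrite exp_links_copy gG og fw.
by rewrite exp_lab_copy map_link_flat gv /= (negbTE nov).
Qed.

Lemma copy_edge_inj f : injective (copy_edge f).
Proof. by move=> [u|g] [z|g'] //= [->]. Qed.

Lemma outer_edge_inj : injective outer_edge.
Proof. by move=> [u|g] [z|g'] //= [->]. Qed.

Section Core.
Variables (D : option (node G')) (S' : {set vertex G'}).
Hypothesis coreS' : core D S'.

Let oS' : one_premise S'. Proof. by case: coreS'. Qed.
Let deg' P : P \in S' -> deg2 (adj D) S' P. Proof. by case: coreS' => _ _; apply. Qed.

(** Inside a box of the copy for [f] the reduct merely repeats the net inside [b]: every vertex of
    the core carries the same [f], and forgetting it gives a core of the net. *)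
Lemma no_core_inner_location b f : D = Some (inr (b, f)) -> False.
Proof.
move=> eD.
have link L : inl L \in S' -> exists l,
    [/\ L = inr (l, f), box l = Some b, inside o l & f \in flats w].
  move=> /(core_link coreS')[LL]; rewrite eD; case: L LL => [l|[l f']] LL.
    by rewrite /=; case: (box l).
  move: LL; rewrite exp_links_copy => /and3P[lG ol fw].
  case: (exp_box_copy c w a f' ol) => [[_ ->]|[b' [lb _ ->]]].
    by case: (box f').
  by case=> eb ef; rewrite -ef; exists l; split; rewrite // lb eb.
have edge E : inr E \in S' -> exists e, E = copy_edge f e.
  move=> /deg'[[L|?] [_ [LS _ _ // /= inc _]]].
  have [l [eL _ _ _]] := link _ LS; rewrite eL in inc.
  by have [e -> _] := incident_copy inc; exists e.
pose S := [set v | copy_vertex f v \in S'].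
have SE p0 : (p0 \in S) = (copy_vertex f p0 \in S') by rewrite inE.
apply: (@nc (Some b) S); split.
- have [Sn0 _ _] := coreS'; have [[L|E] PS] := set0Pn _ Sn0; apply/set0Pn.
    by have [l [eL _ _ _]] := link _ PS; exists (inl l); rewrite SE /= -eL.
  by have [e eE] := edge _ PS; exists (inr e); rewrite SE /= -eE.
- move=> l e e'; rewrite !SE => lS eS e'S le le'.
  have [_ [[<-] _ ol fw]] := link _ lS.
  apply: (@copy_edge_inj f).
  exact: oS' lS eS e'S (switched_copy ol fw le) (switched_copy ol fw le').
move=> v; rewrite SE => vS; apply: deg2_preim (deg' vS) _ => [u|P PS aP];
    first by rewrite SE.
case: P v PS vS aP => [L|E] [l|e] //= PS vS aP.
  have [l [eL lb _ _]] := link _ PS; exists (inl l); first by rewrite eL.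
  rewrite eL in aP; have [e' ee'] := incident_copy aP; rewrite lb.
  by rewrite (copy_edge_inj ee').
have [_ [[<-] lb _ _]] := link _ vS.
by have [e -> inc] := incident_copy aP; exists (inr e) => //=; rewrite -lb.
Qed.

Section OuterLocation.
Variable d : option (node G).
Hypothesis eD : D = omap inl d.

Lemma core_outer_link l : inl (inl l) \in S' ->
  [/\ inl l \in links G', l \in links G & box l = d].
Proof.
move=> /(core_link coreS')[lL]; rewrite eD /= => lb; split=> //.
  by move: lL; rewrite exp_links_outer => /andP[].
by move: lb; case: (box l) => [b|]; case: d => [b'|] //= [->].
Qed.

Lemma core_copy_link l f : inl (inr (l, f)) \in S' ->
  [/\ l \in links G, inside o l, f \in flats w, box l = Some o & box f = d].
Proof.
move=> /(core_link coreS')[]; rewrite exp_links_copy => /and3P[lG ol fw].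
case: (exp_box_copy c w a f ol) => [[lb ->]|[b [_ _ ->]]]; rewrite eD; last by case: d.
by case: (box f) => [b|]; case: d => [b'|] //= -[->].
Qed.

(** With no leaf available, the root [a] is the only exit of the copy. Every other vertex of the
    core in the copy has two neighbours there, and [coreless_but_one] applies to the content of the
    box [o]. *)
Lemma copy_absent f : f \in flats w -> box f = d ->
  (forall g, pax g o -> inr (leaf_edge g f) \notin S') ->
  forall p, copy_vertex f p \notin S'.
Proof.
move=> fw fd noleaf p; pose S := [set v | copy_vertex f v \in S'].
have SE p0 : (p0 \in S) = (copy_vertex f p0 \in S') by rewrite inE.
suff S0 : S = set0 by rewrite -SE S0 inE.
have link l : inl l \in S -> inside o l /\ box l = Some o.
  by rewrite SE => /core_copy_link[].
have nbr e L : inl L \in S' -> inr e \in S -> @incident G' D L (copy_edge f e) ->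
    e = inl a /\ L = inl f \/
    exists2 l, L = inr (l, f) & incident (Some o) l e.
  move=> LS eS; case: L LS => [l|[l f']] LS inc.
    left; have := incident_outer inc; rewrite SE in eS.
    move Eq : (copy_edge f e) => E oE; rewrite /= Eq in eS.
    case: {E}oE Eq eS => [e' _ _|lw'|g f' go _ _ _|g f' v go _ _ _ _ _] Eq eS.
    - by case: e e' Eq {inc eS} => [u|g] [u'|g'].
    - by case: e Eq {inc eS} => //= u [-> ->].
    - case: e Eq {inc} => //= g' [eg ef]; rewrite -ef in eS.
      by have := noleaf g go; rewrite eS.
    - case: e Eq {inc} => //= g' [eg ef]; rewrite -ef in eS.
      by have := noleaf g go; rewrite eS.
  right; have [_ _ _ lb _] := core_copy_link LS.
  have [e' ee' inc'] := incident_copy inc; rewrite lb in inc'; exists l.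
    by case: e e' ee' {eS inc inc'} => [u|g] [u'|g'] //= [_ ->].
  suff -> : e = e' by [].
  by case: e e' ee' {eS inc inc'} => [u|g] [u'|g'] //= [->].
have degS p0 : p0 \in S -> p0 != inr (inl a) -> deg2 (adj (Some o)) S p0.
  move: p0 => v vS va; have vS' := vS; rewrite SE in vS'.
  apply: deg2_preim (deg' vS') _ => [u|P PS aP]; first by rewrite SE.
  case: v P PS vS vS' va aP => [l|e] [L|E] //= PS vS vS' va aP.
    have [ol lb] := link _ vS.
    by have [e -> inc] := incident_copy aP; exists (inr e) => //=; rewrite -lb.
  case: (nbr e L PS vS aP) => [[ea _]|[l -> inc]]; first by rewrite ea eqxx in va.
  by exists (inl l).
apply: (coreless_but_one (d := Some o) (p0 := inr (inl a)) nc _ degS).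
- move=> l e e' lS eS e'S le le'; have [ol _] := link _ lS.
  rewrite !SE in lS eS e'S.
  apply: (@copy_edge_inj f).
  exact: oS' lS eS e'S (switched_copy ol fw le) (switched_copy ol fw le').
- move=> aS; have aS' := aS; rewrite SE in aS'.
  have [[L|?] [LS nL // aL]] := deg2_avoid (inl (inl f)) (deg' aS').
  case: (nbr (inl a) L LS aS aL) => [[_ eL]|[l eL inc]].
    by rewrite eL eqxx in nL.
  by exists (inl l) => //; rewrite SE /= -eL.
Qed.

Lemma leaf_chain g f : pax g o -> inr (leaf_edge g f) \in S' ->
  exists v L, [/\ [/\ inl (inl v) \in S', box v = d & is_why_not (lab v)],
    [/\ g \in flats v, f \in flats w & ~~ inside o v]
    & [/\ inl L \in S', @incident G' D L (leaf_edge g f)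
        & ~~ is_why_not (@lab G' L)]].
Proof.
move=> go /(core_chain tG' coreS')[gL [L [V [LS inc nL gV VS]]]].
move: (gL); rewrite exp_links_copy => /and3P[gG og fw].
case/paxP: go => v [_ gv _ nov].
case/flatsP: gV => _ /(exp_flat_copy) [v']; rewrite gv => -[<-].
rewrite (negbTE nov) => eV; rewrite eV in VS.
have [_ _ vb] := core_outer_link VS.
exists v, L; split=> //; split=> //; first by case: (tidy_flat tG gG gv).
by apply/flatsP.
Qed.

(** The end [v] of the chain is at [d], so by [leaving_chain] every box around [d] is around [o].
    Conversely a box around [o] is around [w], hence around [f], which is at [d]. *)
Lemma leaf_location g f : pax g o -> f \in flats w -> box f = d ->
  inr (leaf_edge g f) \in S' -> d = box o.
Proof.
move=> go fw fd gS; have [v [L [[vS vb _] [gv _ nov] _]]] := leaf_chain go gS.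
case/paxP: go => v' [gG _ og _]; case/flatsP: gv => _ gv.
have [fG _ fin] := above fw; rewrite -fd.
apply: (box_eq_inside tG fG oG) => b; apply/idP/idP => [bf|bo].
  apply: (leaving_chain tG gG gv og nov).
  by rewrite (inside_box _ (m := f)) // vb.
by apply: fin; rewrite insideW.
Qed.

(** The core avoids the copies placed at [d], by [copy_absent] and [leaf_location]. Leaves may
    remain, on their way to their why not link, but never two for the same [g], so taking residuals
    embeds the core in the net. *)
Lemma no_core_without_leaf :
  (d <> box o \/ forall g f, pax g o -> inr (leaf_edge g f) \notin S') -> False.
Proof.
move=> noleaf.
have leaf_d g f : pax g o -> inr (leaf_edge g f) \in S' -> d <> box o.
  by case: noleaf => // nl go; rewrite (negbTE (nl g f go)).
have absent f p : f \in flats w -> box f = d -> copy_vertex f p \notin S'.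
  move=> fw fd; apply: copy_absent => // g go; apply/negP=> gS.
  exact: (leaf_d g f go gS (leaf_location go fw fd gS)).
have outer_link L : inl L \in S' -> exists l, L = inl l.
  case: L => [l|[l f]] LS; first by exists l.
  have [lG ol fw lb fd] := core_copy_link LS.
  by have := absent f (inl l) fw fd; rewrite /= LS.
have edge E : inr E \in S' -> (exists e, E = outer_edge e) \/
    (exists g f, E = leaf_edge g f /\ pax g o).
  move=> ES; have [[L|?] [_ [LS _ _ // /= inc _]]] := deg' ES.
  have [l eL] := outer_link _ LS; rewrite eL in LS inc.
  have [_ _ lb] := core_outer_link LS.
  have oE := incident_outer inc.
  case: {E inc} oE ES => [e _ _|lw'|g f go _ _ _|g f v go _ _ _ _ _] ES.
  - by left; exists e.
  - by have := absent l (inr (inl a)) lw' lb; rewrite /= ES.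
  - by right; exists g, f.
  - by right; exists g, f.
have old_links g : inr (outer_edge (inr g)) \in S' -> inl g \in links G'.
  by case/(core_chain tG' coreS').
have old_out g : inr (outer_edge (inr g)) \in S' -> ~~ pax g o.
  move/old_links; rewrite exp_links_outer => /and5P[_ og _ _ _].
  by apply: contraNN og => /paxP[v []].
(* Both leaves are premises of the why not link which ends the chain of [g]. *)
have leaf_inj g f f' : pax g o -> inr (leaf_edge g f) \in S' ->
    inr (leaf_edge g f') \in S' -> f = f'.
  move=> go fS fS'; have [v [L [[vS vb vw] [gv fw nov] _]]] := leaf_chain go fS.
  have [_ [_ [_ [_ fw' _] _]]] := leaf_chain go fS'.
  by have [] := oS' vS fS fS' (switched_leaf go gv vw fw) (switched_leaf go gv vw fw').
have res_inj : {in S' &, injective residual_vertex}.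
  move=> [L|E] [M|E'] PS QS.
  - by have [l ->] := outer_link _ PS; have [m ->] := outer_link _ QS; case=> ->.
  - by have [l ->] := outer_link _ PS; case: E' {QS} => [[?|[? ?]]|[?|[? ?]]].
  - by have [l ->] := outer_link _ QS; case: E {PS} => [[?|[? ?]]|[?|[? ?]]].
  - have [[e eE]|[g [f [eE go]]]] := edge _ PS;
      have [[e' eE']|[g' [f' [eE' go']]]] := edge _ QS;
      rewrite eE eE' in PS QS *.
    + by case: e e' {eE eE' PS QS} => [u|g] [u'|g'] //= [->].
    + case: e {eE} PS => //= g PS [eg]; have := old_out g PS.
      by rewrite eg go'.
    + case: e' {eE'} QS => //= g' QS [eg]; have := old_out g' QS.
      by rewrite -eg go.
    + by case=> eg; rewrite -eg in QS *; rewrite (leaf_inj g f f').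
have res_inc l E : inl (inl l) \in S' -> inr E \in S' ->
    @incident G' D (inl l) E -> adj d (inl l) (residual_vertex (inr E)).
  move=> lS ES inc; have [lL lG lb] := core_outer_link lS.
  have oE := incident_outer inc.
  case: {E inc} oE ES => [e inc _|lw'|g f go gl lwn fw|g f v go gv lo' fw lf nlv] ES.
  - by rewrite lb in inc; case: e inc {ES} => [u|g].
  - by have := absent l (inr (inl a)) lw' lb; rewrite /= ES.
  - by rewrite /= /incident lG lb eqxx; case: (lab l) lwn.
  (* The chain of [g] crosses the border of [l] already in the net: otherwise [l], which is around
     [f], would be at the location of [o], where by assumption the core has no leaf. *)
  - have lbo : inside l o.
      apply: contraT => nlo; case: (leaf_d g f go ES).
      have [v' [L [[vS vb vw] [gv' _ nov] _]]] := leaf_chain go ES.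
      have [fG _ fin] := above fw; case/paxP: go => v0 [gG gv0 og _].
      have {}gv' : flat_target (lab g) = Some v' by case/flatsP: gv'.
      rewrite -lb; apply: (box_eq_inside tG lG oG) => b; apply/idP/idP => [bl|bo].
        apply: (leaving_chain tG gG gv' og nov).
        by rewrite (inside_box _ (m := l)) // vb lb.
      have bf : inside b f by apply: fin; rewrite insideW.
      have [eb|//|lb'] := inside_comparable bf lf.
        by rewrite eb in bo; rewrite bo in nlo.
      by rewrite (inside_trans lb' bo) in nlo.
    rewrite /= /incident lG lb eqxx; case: (lab l) lo' => //= _ _ _.
    case/paxP: go => v0 [gG gv0 og _]; case/flatsP: gv => _ gv.
    by apply/paxP; exists v; split=> //; apply: inside_trans lbo og.
have res_adj P Q : P \in S' -> Q \in S' -> adj D P Q ->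
    adj d (residual_vertex P) (residual_vertex Q).
  case: P Q => [L|E] [M|E'] //= PS QS inc.
    by have [l eL] := outer_link _ PS; rewrite eL in PS inc *; apply: res_inc.
  have [l eL] := outer_link _ QS; rewrite eL in QS inc *.
  by rewrite adj_sym; apply: res_inc.
apply: (@nc d (residual_vertex @: S')); split.
- have [Sn0 _ _] := coreS'; have [P PS] := set0Pn _ Sn0.
  by apply/set0Pn; exists (residual_vertex P); apply: imset_f.
- have lift l e : inl (inl l) \in S' -> inr e \in residual_vertex @: S' ->
      switched_premise l e -> exists E, [/\ inr E \in S',
        @switched_premise G' (inl l) E & residual_vertex (inr E) = inr e].
    move=> lS /imsetP[[L|E] ES eE] le.
      by have [m em] := outer_link _ ES; rewrite em in eE.
    have [lL lG lb] := core_outer_link lS.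
    exists E; split=> //.
    have [[e' ee]|[g [f [ee go]]]] := edge _ ES; rewrite ee in ES eE *.
      have -> : e' = e by case: e' eE {ee ES} => [u|g] /= [->].
      apply: switched_outer => //; case: e' eE {ee} ES => [u|g] /= [->] //.
      exact: old_links.
    move: le; have [v [L [_ [gv fw _] _]]] := leaf_chain go ES.
    case: eE => ->; rewrite /switched_premise; case El: (lab l) => // gl.
    by apply: switched_leaf; rewrite // El.
  move=> l e e' /imsetP[[L|E] LS eL]; last by case: E eL {LS} => [[?|[? ?]]|[?|[? ?]]].
  have [m em] := outer_link _ LS; rewrite em in eL LS; case: eL => elm.
  rewrite -elm in LS => eS e'S le le'.
  have [E [ES lE eE]] := lift l e LS eS le.
  have [E' [E'S lE' eE']] := lift l e' LS e'S le'.
  by move: eE'; rewrite -(oS' LS ES E'S lE lE') eE => -[].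
move=> p /imsetP[P PS ->]; apply: deg2_map (deg' PS) _ _.
  by move=> Q1 Q2 Q1S Q2S _ _; apply: res_inj.
by move=> Q QS aQ; split; [apply: imset_f | apply: res_adj].
Qed.

(** At the location of the redex a core may run through several copies, which share their residuals,
    so it cannot be projected. Only its vertices outside the copies are kept, and a walk goes from
    the why not link [v1], which ends the chain of [g1], to a link [l] next to a discarded vertex.
    If [l] ends another chain leaving [o], the two chains meet in the box and the core is closed by
    [g1], [o], [g]. Otherwise the chain of a flat link [f] above [w] passes at [l], and the core is
    closed by [g1], [o], [x], [c], [y], [w], [f]. *)
Lemma no_core_with_leaf g1 f1 : d = box o -> pax g1 o ->
  inr (leaf_edge g1 f1) \in S' -> False.
Proof.
move=> ed go1 S1.
have [v1 [L1 [[v1S v1b v1w] [gv1 fw1 nov1] _]]] := leaf_chain go1 S1.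
have cb : box c = d by rewrite ed (cut_box_of_course tG cc oG lo).
have wb : box w = d by rewrite ed (cut_box_eq tG cc oG lo wG lw).
have ob : box o = d by [].
have out_links g : inr (inr (inl g)) \in S' -> inl g \in links G'.
  by case/(core_chain tG' coreS').
pose S := [set p | outer_vertex p \in S'].
have SE p : (p \in S) = (outer_vertex p \in S') by rewrite inE.
pose is_outer (P : vertex G') : bool := match P with
  | inl (inl _) | inr (inl (inl _)) | inr (inr (inl _)) => true | _ => false end.
pose Stop : {set vertex G} := [set p | [exists P : vertex G',
  [&& P \in S', adj D (outer_vertex p) P & ~~ is_outer P]]].
have adj_out p q : adj D (outer_vertex p) (outer_vertex q) ->
    outer_vertex p \in S' -> outer_vertex q \in S' -> adj d p q.
  have inc l e : @incident G' D (inl l) (outer_edge e) -> inl (inl l) \in S' ->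
      incident d l e.
    move=> inc lS; have [_ _ <-] := core_outer_link lS.
    have oE := incident_outer inc; move Eq: (outer_edge e) oE => E oE.
    case: {E} oE Eq => [e' i' _|_|g f _ _ _ _|g f v _ _ _ _ _ _] Eq.
    - by rewrite (outer_edge_inj Eq).
    - by case: e Eq {inc}.
    - by case: e Eq {inc}.
    - by case: e Eq {inc}.
  by case: p q => [l|e] [l'|e'] //=; [move=> /inc i lS _;
      exact: i | move=> /inc i _ lS; exact: i].
have one_S : one_premise S.
  move=> l e e'; rewrite !SE => lS eS e'S le le'; apply: outer_edge_inj.
  have [lL _ _] := core_outer_link lS.
  apply: (oS' lS eS e'S); apply: switched_outer => //.
    by case: e eS {le} => // g; apply: out_links.
  by case: e' e'S {le'} => // g; apply: out_links.
have v1Sin : inl v1 \in S by rewrite SE.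
have lk1 : switched_premise (G :=
    G') (inl v1) (leaf_edge g1 f1) by apply: switched_leaf.
(* Since the leaf of [g1] is the only premise of [v1] in the core, the other neighbour of [v1] is
   outside the copies. *)
have nbr1 : exists2 q, q \in S & adj d (inl v1) q.
  have [[?|E] [ES nE // aE]] := deg2_avoid (inr (leaf_edge g1 f1)) (deg' v1S).
  have oE := incident_outer aE.
  case: {E} oE ES nE aE => [e i _|v1w'|g f go gv lwn fw|g f v go gv lo' _ _ _] ES nE aE.
  - by exists (inr e); [rewrite SE | rewrite /= -v1b].
  - by have [_ [u lv] _] := above v1w'; rewrite lv in v1w.
  - have := oS' v1S S1 ES lk1 (switched_leaf go gv lwn fw).
    by move=> e1; rewrite e1 eqxx in nE.
  - by case: (lab v1) v1w lo'.
have degS p : p \in S -> p != inl v1 -> p \notin Stop -> deg2 (adj d) S p.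
  move=> pS _ pSt; have pS' := pS; rewrite SE in pS'.
  apply: (deg2_preim (h := outer_vertex) _ (deg' pS')) => [u|P PS aP];
      first by rewrite SE.
  have oP : is_outer P.
    apply: contraNT pSt => nP; rewrite inE; apply/existsP; exists P.
    by rewrite PS aP nP.
  have [q eP] : exists q, P = outer_vertex q.
    case: P oP {PS aP} => [[l|//]|[[u|//]|[g|//]]] _.
    - by exists (inl l).
    - by exists (inr (inl u)).
    - by exists (inr (inr g)).
  by exists q => //; rewrite eP in aP PS; apply: adj_out.
have := walk_or_core (@adj_sym G d) (@adj_irr G d) v1Sin nbr1 degS.
case=> [[K [KS Kn0 degK]]|[K [q [KS v1K [qK qSt nq] [_ [[k1 k1K ak1] [k2 k2K
    ak2]]] degK]]]].
  by apply: (@nc d K); split=> //; apply: one_premise_sub one_S.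
have KS' p : p \in K -> outer_vertex p \in S' by move=> /(subsetP KS); rewrite SE.
(* Copied links touch only copied edges, so an old edge has no discarded neighbour and the walk
   stops at a link. *)
have [l eq] : exists l, q = inl l.
  case: q qSt {qK nq ak2 degK} => [l|e]; first by exists l.
  rewrite inE => /existsP[P /and3P[_ aP nP]].
  case: P aP nP => [[m|[m f]]|?] //= aP _.
  by have [e' ] := incident_copy aP; case: e {aP} => ?; case: e'.
rewrite {q}eq in qK qSt nq ak2 degK.
have lv1 : l != v1 by apply: contra_neq nq => ->.
have lS' := KS' _ qK; have [lL lG lb] := core_outer_link lS'.
have K_links m : inl m \in K -> [/\ m != c, m != o & m != w].
  by move/KS'/core_outer_link=> [mL _ _]; move: mL; rewrite exp_links_outer => /and5P[].
have K_outside g : inr (inr g) \in K -> ~~ inside o g /\ g \notin flats w.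
  move/KS' => /= gS; have := out_links g gS.
  rewrite exp_links_outer => /and5P[_ og _ _ _]; split=> //.
  have [[L|?] [_ [LS _ _ // /= inc _]]] := deg' gS.
  case: L LS inc => [m|[m f]] LS inc; last by have [[]] := incident_copy inc.
  have oE := incident_outer inc; move Eq: (inr (inl g)) oE => E oE.
  case: {E} oE Eq => [[u|g'] _ gw|_|g' f _ _ _ _|g' f v _ _ _ _ _ _] //= [->] //.
have notK g : pax g o -> inr (inr g) \notin K.
  by case/paxP=> v [_ _ og _]; apply/negP=> /K_outside[]; rewrite og.
have notw g : pax g o -> g \notin flats w.
  by case/paxP=> v [_ _ og _]; apply/negP=> /fo; rewrite og.
have inc_leaf v g : g \in flats v -> is_why_not (lab v) -> v \in links G ->
    box v = d -> incident d v (inr g).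
  by move=> gv vw vG vb; rewrite /incident vG vb eqxx; case: (lab v) vw.
have [_ v1G _] := core_outer_link v1S.
have inc1 : incident d v1 (inr g1) by apply: inc_leaf.
have inco g : pax g o -> incident d o (inr g).
  by move=> go; rewrite /incident oG ob eqxx lo.
(* The premises added to [K] are residuals of leaves in [S'], so the condition on premises in the
   reduct covers them. *)
have lift m e : inl m \in K -> (inr e \in K \/
    (exists g f, [/\ e = inr g, pax g o, f \in flats w & inr (leaf_edge g f) \in
        S'])) ->
    switched_premise m e -> exists E, [/\ inr E \in S',
      @switched_premise G' (inl m) E & residual_vertex (inr E) = inr e].
  move=> mK [eK|[g [f [eg go fw gS]]]] me.
    exists (outer_edge e); have [mL _ _] := core_outer_link (KS' _ mK).
    split; [exact: (KS' _ eK) | apply: switched_outer => // | by case: (e)].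
    by case: e eK {me} => // g /KS'; apply: out_links.
  exists (leaf_edge g f); split; rewrite ?eg //; move: me; rewrite eg => me.
  have gm : g \in flats m by have := switched_premiseP me.
  by apply: switched_leaf => //; move: me; rewrite /switched_premise; case: (lab m).
have one_K (F : {set vertex G}) m e e' : inl m \in K -> 
    (forall e0, inr e0 \in F -> switched_premise m e0 -> inr e0 \in K \/
      (exists g f, [/\ e0 = inr g, pax g o, f \in flats w & inr (leaf_edge g f)
          \in S'])) ->
    inr e \in F -> inr e' \in F ->
    switched_premise m e -> switched_premise m e' -> e = e'.
  move=> mK FE eF e'F me me'.
  have [E [ES mE eE]] := lift m e mK (FE e eF me) me.
  have [E' [E'S mE' eE']] := lift m e' mK (FE e' e'F me') me'.
  by move: eE'; rewrite -(oS' (KS' _ mK) ES E'S mE mE') eE => -[].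
have degF (F : {set vertex G}) p : K \subset F -> p \in K ->
    (p = inl v1 -> deg2 (adj d) F p) ->
    (p = inl l -> deg2 (adj d) F p) -> deg2 (adj d) F p.
  move=> KF pK d0 d1; have [/d0//|n0] := eqVneq p (inl v1).
  have [/d1//|n1] := eqVneq p (inl l).
  exact: deg2_sub KF (degK p pK n0 n1).
have not_prem z e : z \in premise_wires (lab c) -> forall m, inl m \in K ->
    e = inl z -> switched_premise m e = false.
  move=> zc m mK ->; apply/negP=> /switched_premiseP zm.
  have [_ mG _] := core_outer_link (KS' _ mK); have [mc _ _] := K_links m mK.
  by rewrite (tidy_prem tG mG (proj1 cc) zm zc) eqxx in mc.
have root_or_leaf : (exists2 f, f \in flats w & incident d l (inr f)) \/
    (exists g f, [/\ pax g o, g \in flats l, is_why_not (lab l), f \in flats w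
       & inr (leaf_edge g f) \in S']).
  move: qSt; rewrite inE => /existsP[[?|E] /and3P[ES // inc nE]].
  have oE := incident_outer inc.
  case: {E} oE ES nE inc => [e i gw|lw'|g f go gl lwn fw|g f v go gv lo' fw lf
      nlv] ES nE inc.
  - by case: e nE {i gw ES inc}.
  - left; exists l => //; have [_ [u ll] _] := above lw'.
    by rewrite /incident lG lb eqxx ll /=.
  - by right; exists g, f.
  (* The box [l] is at the location of [w], hence not around it: the chain of [f] crosses the border
     of [l] in the net. *)
  - left; exists f => //; rewrite /incident lG lb eqxx; case: (lab l) lo' => //= _ _ _.
    have [fG [u lf'] _] := above fw; apply/paxP; exists w; split=> //.
      by rewrite lf'.
    rewrite (inside_box _ (m := l)) ?wb ?lb //; exact: (tidy_nested tG lG).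
case: root_or_leaf => [[f fw inclf]|[g [f [go gl lwn fw gS]]]]; last first.
  (* A single chain has a single why not link, whereas the walk ends away from its start. *)
  have gg1 : g != g1.
    apply: contraNneq lv1 => e; case/flatsP: gl => _; case/flatsP: gv1 => _.
    by rewrite e => -> [->].
  have incl : incident d l (inr g) by apply: inc_leaf.
  pose F : {set vertex G} := [set inl o; inr (inr g1); inr (inr g)] :|: K.
  have FE p : (p \in F) = [|| p == inl o, p == inr (inr g1), p == inr (inr g) | p
      \in K].
    by rewrite 3!in_setU 3!in_set1 -!orbA.
  have oF : inl o \in F by rewrite FE eqxx ?orbT.
  have g1F : inr (inr g1) \in F by rewrite FE eqxx ?orbT.
  have gF : inr (inr g) \in F by rewrite FE eqxx ?orbT.
  have KF : K \subset F by apply: subsetUr.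
  have KF' := subsetP KF.
  apply: (@nc d F); split; first by apply/set0Pn; exists (inl o).
    move=> m e e' mF eF e'F me me'.
    have mK : inl m \in K.
      move: mF; rewrite FE => /or4P[/eqP[em]|/eqP//|/eqP//|//].
      by move: me; rewrite em /switched_premise lo.
    apply: (one_K F m e e' mK _ eF e'F me me') => e0.
    rewrite FE => /or4P[/eqP//|/eqP[->] _|/eqP[->] _|]; last by left.
      by right; exists g1, f1.
    by right; exists g, f.
  move=> p; rewrite FE => /or4P[/eqP->|/eqP->|/eqP->|pK].
  - apply: (deg2_cons g1F (inco _ go1) gF (inco _ go)).
    by apply: contra_neq gg1 => -[].
  - apply: (deg2_cons oF (inco _ go1) (KF' _ v1K) inc1).
    by have [_ no _] := K_links _ v1K; rewrite eq_sym; apply: contra_neq no => -[].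
  - apply: (deg2_cons oF (inco _ go) (KF' _ qK) incl).
    by have [_ no _] := K_links _ qK; rewrite eq_sym; apply: contra_neq no => -[].
  - apply: degF => // ->.
      by apply: (deg2_cons (KF' _ k1K) ak1 g1F inc1);
          apply: contraNneq (notK _ go1) => <-.
    by apply: (deg2_cons (KF' _ k2K) ak2 gF incl); apply: contraNneq (notK _ go) => <-.
pose F : {set vertex G} :=
  [set inl o; inl w; inl c; inr (inl x); inr (inl y); inr (inr f); inr (inr g1)] :|: K.
have FE p : (p \in F) = [|| p == inl o, p == inl w, p == inl c, p == inr (inl x),
    p == inr (inl y), p == inr (inr f), p == inr (inr g1) | p \in K].
  by rewrite 7!in_setU 7!in_set1 -!orbA.
have oF : inl o \in F by rewrite FE eqxx ?orbT.
have wF : inl w \in F by rewrite FE eqxx ?orbT.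
have cF : inl c \in F by rewrite FE eqxx ?orbT.
have xF : inr (inl x) \in F by rewrite FE eqxx ?orbT.
have yF : inr (inl y) \in F by rewrite FE eqxx ?orbT.
have fF : inr (inr f) \in F by rewrite FE eqxx ?orbT.
have g1F : inr (inr g1) \in F by rewrite FE eqxx ?orbT.
have KF : K \subset F by apply: subsetUr.
have KF' := subsetP KF.
have [cx cy] := cut_on_prem cc; have [cG _ _ cno _] := cut_on_link cc.
have fwi : incident d w (inr f) by rewrite /incident wG wb eqxx lw.
have icx : incident d c (inl x) by apply: incident_prem.
have icy : incident d c (inl y) by apply: incident_prem.
have iox : incident d o (inl x) by apply: incident_concl => //; rewrite lo inE.
have iwy : incident d w (inl y) by apply: incident_concl => //; rewrite lw inE.
have edgeF e : inr e \in F ->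
    [\/ e = inl x \/ e = inl y, e = inr f, e = inr g1 | inr e \in K].
  rewrite FE => /or4P[/eqP//|/eqP//|/eqP//|/or4P[/eqP[->]|/eqP[->]|/eqP[->]|
      /orP[/eqP[->]|eK]]].
  - by constructor 1; left.
  - by constructor 1; right.
  - by constructor 2.
  - by constructor 3.
  - by constructor 4.
apply: (@nc d F); split; first by apply/set0Pn; exists (inl o).
- move=> m e e' mF eF e'F me me'.
  move: mF; rewrite FE => /or4P[/eqP[em]|/eqP[em]|/eqP[em]|
      /or4P[/eqP//|/eqP//|/eqP//|/orP[/eqP//|mK]]].
  + by move: me; rewrite em /switched_premise lo.
  (* The flat links above [w] have become cuts, so their chains are not in [K], and [f] is the only
     premise of [w] in [F]. *)
  + have ef e0 : inr e0 \in F -> switched_premise m e0 -> e0 = inr f.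
      move=> /edgeF e0F; rewrite em /switched_premise lw.
      case: e0F => [[->|->]|->|->|] //.
        by move=> gw; have := notw _ go1; rewrite gw.
      by case: e0 => // g0 /K_outside[_ /negP].
    by rewrite (ef e eF me) (ef e' e'F me').
  + by move: me; rewrite em (cut_on_not_switched _ cc).
  + apply: (one_K F m e e' mK _ eF e'F me me') => e0 /edgeF[[] e0x|e0f|->|];
      last by left.
    * by rewrite (not_prem x e0 cx m mK e0x).
    * by rewrite (not_prem y e0 cy m mK e0x).
    * rewrite e0f => /switched_premiseP /flatsP[_ fm]; have [_ [u lf] _] := above fw.
      by move: fm (K_links m mK); rewrite lf => -[->] [_ _]; rewrite eqxx.
    * by right; exists g1, f1.
have fg1 : f != g1 by apply: contraNneq (notw _ go1) => <-.
have [lnc lno lnw] := K_links _ qK; have [_ v1no _] := K_links _ v1K.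
have co : c != o by apply: contraTneq cno => ->; rewrite lo.
have cw : c != w by apply/eqP=> e; case: cc => _; rewrite e lw => -[].
move=> p; rewrite FE => /or4P[/eqP->|/eqP->|/eqP->|/or4P[/eqP->|/eqP->|/eqP->|/orP[/eqP->|pK]]].
- by apply: (deg2_cons xF iox g1F (inco _ go1)).
- by apply: (deg2_cons yF iwy fF fwi).
- apply: (deg2_cons xF icx yF icy); apply: contra_neq (cut_on_neq tG cc) => -[].
  by [].
- by apply: (deg2_cons cF icx oF iox); apply: contra_neq co => -[].
- by apply: (deg2_cons cF icy wF iwy); apply: contra_neq cw => -[].
- by apply: (deg2_cons (KF' _ qK) inclf wF fwi); apply: contra_neq lnw => -[].
- by apply: (deg2_cons (KF' _ v1K) inc1 oF (inco _ go1)); apply: contra_neq v1no => -[].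
- apply: degF => // ->.
    by apply: (deg2_cons (KF' _ k1K) ak1 g1F inc1);
        apply: contraNneq (notK _ go1) => <-.
  apply: (deg2_cons (KF' _ k2K) ak2 fF inclf).
  by apply: contraTneq k2K => ->; apply/negP=> /K_outside[_ /negP].
Qed.

End OuterLocation.

Lemma no_core_after_step : False.
Proof.
have outer d : D = omap inl d -> False.
  move=> eD; have [ed|nd] := eqVneq d (box o); last first.
    by apply: (no_core_without_leaf eD); left; apply/eqP.
  case: (boolP [exists g, exists f, pax g o && (inr (leaf_edge g f) \in S')]).
    by case/existsP=> g /existsP[f /andP[go gS]];
        exact: no_core_with_leaf eD g f ed go gS.
  move=> nl; apply: (no_core_without_leaf eD); right => g f go.
  by apply: contra nl => gS; apply/existsP; exists g; apply/existsP; exists f;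
      rewrite go.
case ED : D => [[b|[b f]]|].
- by apply: (outer (Some b)).
- exact: no_core_inner_location ED.
- exact: (outer None).
Qed.

End Core.

Lemma exp_reduct_coreless : coreless G'.
Proof. by move=> D S'; exact: no_core_after_step. Qed.

End ExponentialCore.

(** * Levels *)

Section Levels.
Variables (G : net) (lev : wire G -> int).
Implicit Types (l m c o w : node G) (x y u : wire G).

(* The indices of discharged edges, which are all equal along a chain, are
   eliminated from the constraints. *)
Definition level_constraint l : Prop :=
  match lab l with
  | Ax a b | Cut a b => lev a = lev b
  | Tensor a b c | Par a b c => lev a = lev c /\ lev b = lev c
  | Forall a c | Exists a c => lev a = lev c
  | OfCourse a c | Paragraph a c => lev a = (lev c + 1)%R
  | Flat a w => forall z, lab w = WhyNot z -> lev a = (lev z + 1)%R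
  | WhyNot _ => True
  end.

Record leveled (n : nat) : Prop := Leveled {
  lev_constraint : forall l, l \in links G -> level_constraint l;
  lev_bound : forall l u, l \in links G ->
    u \in premise_wires (lab l) ++ conclusion_wires (lab l) ->
    (0 <= lev u <= n%:Z)%R }.

(** The invariant of the procedure. The number [n] will be the level of the initial net; it remains
    a bound because residuals keep their levels. *)
Record valid (n : nat) : Prop := Valid {
  valid_tidy : tidy G;
  valid_coreless : coreless G;
  valid_leveled : leveled n }.

Lemma leveled_cut n c x y : leveled n -> cut_on c x y -> lev x = lev y.
Proof.
by case=> lc _ [cG ll]; have := lc c cG; rewrite /level_constraint; case: ll => ->.
Qed.

Lemma cut_level_on n c x y : leveled n -> cut_on c x y -> cut_level lev c = lev x.
Proof.
by move=> lG cc; rewrite /cut_level; case: (cc) => _ [->|->] //;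
  rewrite (leveled_cut lG cc).
Qed.

End Levels.

Lemma level_constraint_map (G G' : net) (lev : wire G -> int)
    (lev' : wire G' -> int) (h : wire G -> wire G') (t : node G -> node G')
    (l : node G) (l' : node G') :
  lab l' = map_link h t (lab l) -> (forall u, lev' (h u) = lev u) ->
  (forall v, flat_target (lab l) = Some v -> forall c', lab (t v) = WhyNot c' ->
     exists2 c, lab v = WhyNot c & lev' c' = lev c) ->
  level_constraint lev l -> level_constraint lev' l'.
Proof.
rewrite /level_constraint => -> lh.
case: (lab l) => [a b|a b|a b c|a b c|a c|a c|a c|c|u v|a c] /= tgt; rewrite ?lh //.
by move=> lu c' /(tgt v erefl)[c0 lc ->]; apply: lu.
Qed.

Section LevelStep.
Variables (G : net) (lev : wire G -> int) (n : nat).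
Hypothesis vG : valid lev n.

Let tG := valid_tidy vG.
Let nc := valid_coreless vG.
Let lG := valid_leveled vG.

Lemma bound_prem l u : l \in links G -> u \in premise_wires (lab l) ->
  (0 <= lev u <= n%:Z)%R.
Proof. by move=> lL ul; apply: (lev_bound lG lL); rewrite mem_cat ul. Qed.

Lemma bound_concl l u : l \in links G -> u \in conclusion_wires (lab l) ->
  (0 <= lev u <= n%:Z)%R.
Proof. by move=> lL ul; apply: (lev_bound lG lL); rewrite mem_cat ul orbT. Qed.

Lemma ax_valid c a x y z : cut_on c x y -> a \in links G ->
  lab a = Ax y z \/ lab a = Ax z y ->
  @valid (ax_reduct c a x z) lev n.
Proof.
move=> cc aG la; split.
- exact: (ax_reduct_tidy tG cc aG la).
- exact: (ax_reduct_coreless tG cc aG la nc).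
have exz : lev x = lev z.
  rewrite (leveled_cut lG cc); have := lev_constraint lG aG.
  by rewrite /level_constraint; case: la => ->.
have sgE u : lev (if u == z then x else u) = lev u by case: eqP => [->|].
split=> [l|l u]; rewrite !inE negb_or => /andP[_ lL].
  apply: (@level_constraint_map G (ax_reduct c a x z) lev lev _ id l l) => //;
      last exact: (lev_constraint lG lL).
  by move=> v _ c' /=; case: (lab v) => // c0 [<-]; exists c0; rewrite // sgE.
rewrite map_link_premises map_link_conclusions -map_cat => /mapP[u0 u0l ->].
by rewrite sgE; apply: (lev_bound lG lL).
Qed.

Lemma mult_valid c t p a b a' b' x y : cut_on c x y ->
  t \in links G -> lab t = Tensor a b x -> p \in links G -> lab p = Par a' b' y ->
  @valid (mult_reduct c t p a b a' b') lev n.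
Proof.
move=> cc tL lt pL lp; split.
- exact: (mult_reduct_tidy tG cc tL lt pL lp).
- exact: (mult_reduct_coreless tG cc tL lt pL lp nc).
have exy := leveled_cut lG cc.
have := lev_constraint lG tL; rewrite /level_constraint lt => -[eax ebx].
have := lev_constraint lG pL; rewrite /level_constraint lp => -[eay eby].
set G' := mult_reduct c t p a b a' b'.
have labE (m : node G) : @lab G' m =
  if m == c then Cut a a' else if m == t then Cut b b' else lab m by [].
split=> [l|l u]; rewrite !inE => /andP[_ lL].
  rewrite /level_constraint labE; case: eqP => _; first by rewrite eax eay.
  case: eqP => _; first by rewrite ebx eby.
  have := lev_constraint lG lL; rewrite /level_constraint.
  case: (@lab G l) => // u w lu z; rewrite labE.
  by case: eqP => // _; case: eqP => // _; apply: lu.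
rewrite labE; case: eqP => _.
  rewrite !inE => /orP[]/eqP->; first by apply: (bound_prem tL); rewrite lt inE eqxx.
  by apply: (bound_prem pL); rewrite lp inE eqxx.
case: eqP => _; last exact: (lev_bound lG lL).
rewrite !inE => /orP[]/eqP->; first by apply: (bound_prem tL);
    rewrite lt !inE eqxx orbT.
by apply: (bound_prem pL); rewrite lp !inE eqxx orbT.
Qed.

Lemma unary_valid c m k a b x y : cut_on c x y ->
  unary_link m a x -> unary_link k b y -> lev a = lev b ->
  @valid (unary_reduct c m k a b) lev n.
Proof.
move=> cc um uk eab; split.
- exact: (unary_reduct_tidy tG cc um uk).
- exact: (unary_reduct_coreless tG cc um uk nc).
case: um uk => [mL mp mc _] [kL kp kc _].
set G' := unary_reduct c m k a b.
have labE (l : node G) : @lab G' l = if l == c then Cut a b else lab l by [].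
split=> [l|l u]; rewrite !inE => /andP[_ lL].
  rewrite /level_constraint labE; case: eqP => _ //.
  have := lev_constraint lG lL; rewrite /level_constraint.
  case: (@lab G l) => // u w lu z; rewrite labE.
  by case: eqP => // _; apply: lu.
rewrite labE; case: eqP => _; last exact: (lev_bound lG lL).
rewrite !inE => /orP[]/eqP->; first by apply: (bound_prem mL); rewrite mp inE.
by apply: (bound_prem kL); rewrite kp inE.
Qed.

Lemma exp_valid c o w a x y : cut_on c x y ->
  o \in links G -> lab o = OfCourse a x -> w \in links G -> lab w = WhyNot y ->
  @valid (exp_reduct c o w a) (fun u => lev (exp_residual u)) n.
Proof.
move=> cc oL lo wL lw.
have fo f : f \in flats w -> ~~ inside o f.
  exact: (flats_outside tG cc oL lo wL lw nc).
split.
- exact: (exp_reduct_tidy tG cc oL lo wL lw fo).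
- exact: (exp_reduct_coreless tG nc cc oL lo wL lw).
set G' := exp_reduct c o w a.
have exy := leveled_cut lG cc.
have := lev_constraint lG oL; rewrite /level_constraint lo => eax.
have why_outer (v : node G) c' : @lab G' (inl v) = WhyNot c' ->
    exists2 c0, lab v = WhyNot c0 & lev (exp_residual c') = lev c0.
  by rewrite /=; case: (lab v) => //= [z [<-]|u z]; [exists z | case: ifP].
have why_copy (v f : node G) c' : @lab G' (inr (v, f)) = WhyNot c' ->
    exists2 c0, lab v = WhyNot c0 & lev (exp_residual c') = lev c0.
  by rewrite /=; case: (lab v) => //= z [<-]; exists z.
split=> [[l|[l f]]|[l|[l f]] u].
- rewrite exp_links_outer => /andP[lL _].
  have [lfw|lnw] := boolP (l \in flats w).
    have [u lf lc] := exp_lab_above tG c o a lfw.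
    rewrite /level_constraint lc /=.
    have := lev_constraint lG lL; rewrite /level_constraint lf => /(_ _ lw) ->.
    by rewrite eax exy.
  apply: (level_constraint_map (exp_lab_outer c o a lnw)) (lev_constraint lG lL) => //.
  by move=> v _ c'; apply: why_outer.
- rewrite exp_links_copy => /and3P[lL _ _].
  apply: (level_constraint_map (exp_lab_copy c o w a l f)) (lev_constraint lG lL) => //.
  by move=> v _ c'; case: ifP => _; [apply: why_copy | apply: why_outer].
- rewrite exp_links_outer mem_cat => /andP[lL _] /orP[].
    case/(exp_prem_outer tG)=> [[z -> zl]|[_ ->]]; first exact: (bound_prem lL zl).
    by apply: (bound_prem oL); rewrite lo inE.
  by case/(exp_concl_outer tG)=> z -> zl; apply: (bound_concl lL zl).
- rewrite exp_links_copy mem_cat => /and3P[lL _ _] /orP[].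
    by case/exp_prem_copy=> z -> zl; apply: (bound_prem lL zl).
  by case/exp_concl_copy=> z -> zl; apply: (bound_concl lL zl).
Qed.

Lemma step_valid c (G' : net) (r : wire G' -> wire G) : step c r ->
  valid (fun u => lev (r u)) n.
Proof.
case=> [x y z a cc aG la|x y t p a b a' b' cc tL lt pL lp|x y m k a b cc mL lm kL lk
  |x y m k a b cc mL lm kL lk|x y o w a cc oL lo wL lw].
- exact: (ax_valid cc aG la).
- exact: (mult_valid cc tL lt pL lp).
- apply: (unary_valid cc (x := x) (y := y)); rewrite /unary_link ?lm ?lk //.
  have := lev_constraint lG mL; have := lev_constraint lG kL.
  by rewrite /level_constraint lm lk => -> ->; apply: (leveled_cut lG cc).
- apply: (unary_valid cc (x := x) (y := y)); rewrite /unary_link ?lm ?lk //.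
  have := lev_constraint lG mL; have := lev_constraint lG kL.
  by rewrite /level_constraint lm lk => -> ->; rewrite (leveled_cut lG cc).
- exact: (exp_valid cc oL lo wL lw).
Qed.

End LevelStep.

(** * Reducible cuts *)

Definition is_axiom (W N : Type) (k : link W N) : bool :=
  if k is Ax _ _ then true else false.

Definition dual_links (W N : Type) (k k' : link W N) : bool :=
  match k, k' with
  | Tensor _ _ _, Par _ _ _ | Forall _ _, Exists _ _
  | Paragraph _ _, Paragraph _ _ | OfCourse _ _, WhyNot _ => true
  | _, _ => false
  end.

Section Redexes.
Variable G : net.
Implicit Types (l m c o w : node G) (x y z : wire G).

Definition cut_onb c x y : bool :=
  if lab c is Cut u v then (c \in links G) &&
    ((u == x) && (v == y) || (u == y) && (v == x)) else false.

Lemma cut_onP c x y : reflect (cut_on c x y) (cut_onb c x y).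
Proof.
rewrite /cut_onb; apply: (iffP idP) => [|[cG] [] ->]; last 2 first.
- by rewrite cG !eqxx.
- by rewrite cG !eqxx orbT.
case E: (lab c) => // /andP[cG /orP[]/andP[/eqP<- /eqP<-]]; split=> //.
  by left.
by right.
Qed.

(** [reducible] quantifies over nets; this decidable form allows cuts to be counted. It reads the
    two premises in one order, and [reducibleb] tries both. *)
Definition redex c x y : bool := cut_onb c x y &&
  [exists l in links G, (x \in conclusion_wires (lab l)) &&
    (is_axiom (lab l) || [exists m in links G,
       (y \in conclusion_wires (lab m)) && dual_links (lab l) (lab m)])].

Definition reducibleb c : bool := [exists x, exists y, redex c x y].

Lemma redexP c x y : reflect (cut_on c x y /\ exists l, [/\ l \in links G,
    x \in conclusion_wires (lab l) & is_axiom (lab l) \/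
    exists m, [/\ m \in links G, y \in conclusion_wires (lab m)
      & dual_links (lab l) (lab m)]]) (redex c x y).
Proof.
apply: (iffP andP) => [[/cut_onP cc /exists_inP[l lG /andP[xl lP]]]|
    [cc [l [lG xl lP]]]].
  split=> //; exists l; split=> //; case/orP: lP => [|/exists_inP[m mG /andP[]]].
    by left.
  by right; exists m.
split; first exact/cut_onP.
apply/exists_inP; exists l; rewrite // xl; case: lP => [->//|[m [mG ym d]]].
by apply/orP; right; apply/exists_inP; exists m; rewrite // ym.
Qed.

Lemma reducibleP c : reflect (reducible c) (reducibleb c).
Proof.
apply: (iffP existsP) => [[x /existsP[y /redexP[cc [l [lG xl lP]]]]]|[G' [r st]]].
  case: lP => [|[m [mG ym]]].
    case El: (lab l) xl => [z z'|||||||||] //; rewrite !inE => /orP[]/eqP ex _.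
      by eexists; eexists; apply: (AxStep (cut_onC cc) lG (z := z')); left;
          rewrite El ex.
    by eexists; eexists; apply: (AxStep (cut_onC cc) lG (z := z)); right; rewrite El ex.
  case El: (lab l) xl => [||a b z||a z||a z|||a z] //;
  case Em: (lab m) ym => [|||a' b' z'||a' z'||z'||a' z'] //;
    rewrite !inE => /eqP ey /eqP ex _; subst z z'.
  - by eexists; eexists; apply: (MultStep cc lG El mG Em).
  - by eexists; eexists; apply: (QuantStep cc lG El mG Em).
  - by eexists; eexists; apply: (ExpStep cc lG El mG Em).
  - by eexists; eexists; apply: (ParagraphStep cc lG El mG Em).
case: st => {G' r} [x y z a cc aG la|x y t p a b a' b' cc tL lt pL lp
  |x y m k a b cc mL lm kL lk|x y m k a b cc mL lm kL lk|x y o w a cc oL lo wL lw].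
- exists y; apply/existsP; exists x; apply/redexP; split; first exact: cut_onC.
  by exists a; split; rewrite // ?inE; case: la => -> /=;
      rewrite ?inE ?eqxx ?orbT //; left.
- exists x; apply/existsP; exists y; apply/redexP; split=> //; exists t.
  by split; rewrite // ?lt ?inE //; right; exists p; rewrite ?lt lp inE.
- exists x; apply/existsP; exists y; apply/redexP; split=> //; exists m.
  by split; rewrite // ?lm ?inE //; right; exists k; rewrite ?lm lk inE.
- exists x; apply/existsP; exists y; apply/redexP; split=> //; exists m.
  by split; rewrite // ?lm ?inE //; right; exists k; rewrite ?lm lk inE.
- exists x; apply/existsP; exists y; apply/redexP; split=> //; exists o.
  by split; rewrite // ?lo ?inE //; right; exists w; rewrite ?lo lw inE.
Qed.

Lemma redex_reducible c x y : redex c x y -> reducibleb c.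
Proof. by move=> rc; apply/existsP; exists x; apply/existsP; exists y. Qed.

Definition contractiveb c o w : bool := [exists x, exists y,
  [&& cut_onb c x y, o \in links G, w \in links G,
    if lab o is OfCourse _ z then z == x else false,
    if lab w is WhyNot z then z == y else false & flats w != set0]].

Lemma contractiveP c o w : reflect (contractive c o w) (contractiveb c o w).
Proof.
apply: (iffP existsP) => [[x /existsP[y /and5P[/cut_onP cc oG wG lo /andP[lw fw]]]]|].
  case Eo: (lab o) lo => [||||||a z|||] // /eqP ex.
  case Ew: (lab w) lw => [|||||||z'||] // /eqP ey.
  by exists x, y, a; split=> //; rewrite ?Eo ?Ew ?ex ?ey.
case=> x [y [a [cc [oG lo] [wG lw] fw]]]; exists x; apply/existsP; exists y.
by rewrite oG wG lo lw !eqxx fw /= !andbT; apply/cut_onP.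
Qed.

Lemma contractive_reducible c o w : contractiveb c o w -> reducibleb c.
Proof.
case/contractiveP=> x [y [a [cc [oG lo] [wG lw] _]]].
apply: (@redex_reducible c x y); apply/redexP; split=> //; exists o.
by split; rewrite ?lo ?inE //; right; exists w; rewrite lw inE.
Qed.

End Redexes.

Lemma is_axiom_map (W W' N N' : Type) (g : W -> W') (h : N -> N')
    (k : link W N) : is_axiom (map_link g h k) = is_axiom k.
Proof. by case: k. Qed.

Lemma dual_links_map (W W' N N' : Type) (g g' : W -> W') (h h' : N -> N')
    (k k' : link W N) :
  dual_links (map_link g h k) (map_link g' h' k') = dual_links k k'.
Proof. by case: k; case: k'. Qed.

Lemma map_link_cut (W W' N N' : Type) (g : W -> W') (h : N -> N')
    (k : link W N) x y : map_link g h k = Cut x y ->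
  exists u v, [/\ k = Cut u v, g u = x & g v = y].
Proof. by case: k => //= u v [<- <-]; exists u, v. Qed.

Section Contractive.
Variables (G : net) (tG : tidy G).
Implicit Types (l m c o w : node G) (x y z : wire G).

Lemma contractive_inj_cut c c' o w w' :
  contractiveb c o w -> contractiveb c' o w' -> c = c'.
Proof.
case/contractiveP=> x [y [a [cc [oG lo] [wG lw] _]]].
case/contractiveP=> x' [y' [a' [cc' [_ lo'] _ _]]].
move: lo'; rewrite lo => -[_ ex].
have [cx _] := cut_on_prem cc; have [cx' _] := cut_on_prem cc'.
by rewrite -ex in cx'; apply: (tidy_prem tG (proj1 cc) (proj1 cc') cx cx').
Qed.

Lemma contractive_inj_why_not c c' o o' w :
  contractiveb c o w -> contractiveb c' o' w -> c = c'.
Proof.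
case/contractiveP=> x [y [a [cc _ [wG lw] _]]].
case/contractiveP=> x' [y' [a' [cc' _ [_ lw'] _]]].
move: lw'; rewrite lw => -[ey].
have [_ cy] := cut_on_prem cc; have [_ cy'] := cut_on_prem cc'.
by rewrite -ey in cy'; apply: (tidy_prem tG (proj1 cc) (proj1 cc') cy cy').
Qed.

Lemma contractive_box c o w : contractiveb c o w -> box o = box c /\ box w = box c.
Proof.
case/contractiveP=> x [y [a [cc [oG lo] [wG lw] _]]]; split.
  by apply: (cut_on_box tG cc oG); rewrite lo inE.
by apply: (cut_on_box tG (cut_onC cc) wG); rewrite lw inE.
Qed.

Lemma cut_on_eq c x y x' y' : cut_on c x y -> cut_on c x' y' ->
  x = x' /\ y = y' \/ x = y' /\ y = x'.
Proof.
by case=> _ lc [_ lc']; case: lc lc' => -> [] [-> ->]; [left|right|right|left].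
Qed.

Lemma contractive_inj c o w o' w' :
  contractiveb c o w -> contractiveb c o' w' -> o = o' /\ w = w'.
Proof.
case/contractiveP=> x [y [a [cc [oG lo] [wG lw] _]]].
case/contractiveP=> x' [y' [a' [cc' [oG' lo'] [wG' lw'] _]]].
have [[ex ey]|[ex ey]] := cut_on_eq cc cc'.
  split; first by apply: (tidy_concl tG oG oG' (x := x)); rewrite ?lo ?lo' ?ex inE.
  by apply: (tidy_concl tG wG wG' (x := y)); rewrite ?lw ?lw' ?ey inE.
have e : o = w' by apply: (tidy_concl tG oG wG' (x := x)); rewrite ?lo ?lw' ?ex inE.
by rewrite e lw' in lo.
Qed.

(** The sources of the two premises of a contractive cut are the links [o] and [w], which fit no
    other kind of step. *)
Lemma step_contractive c o w (P : forall G' : net, (wire G' -> wire G) -> Prop) :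
  contractiveb c o w ->
  (forall x y a, cut_on c x y -> o \in links G -> lab o = OfCourse a x ->
     w \in links G -> lab w = WhyNot y -> flats w != set0 ->
     P (exp_reduct c o w a) (@exp_residual G)) ->
  forall G' (r : wire G' -> wire G), step c r -> P G' r.
Proof.
case/contractiveP=> x [y [a [cc [oG lo] [wG lw] fw]]] PE G' r st.
have con u v : cut_on c u v -> u = x /\ v = y \/ u = y /\ v = x.
  by move=> cuv; have := cut_on_eq cuv cc.
have src u l : l \in links G -> u \in conclusion_wires (lab l) ->
    (u = x -> l = o) /\ (u = y -> l = w).
  move=> lG ul; split=> eu; rewrite eu in ul.
    by apply: (tidy_concl tG lG oG ul); rewrite lo inE.
  by apply: (tidy_concl tG lG wG ul); rewrite lw inE.
have clash u v l m : cut_on c u v -> l \in links G -> m \in links G ->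
    u \in conclusion_wires (lab l) -> v \in conclusion_wires (lab m) ->
    l = o /\ m = w \/ l = w /\ m = o.
  move=> cuv lG mG ul vm; have [lo' lw'] := src _ _ lG ul;
      have [mo mw] := src _ _ mG vm.
  case: (con _ _ cuv) => -[eu ev]; [left | right].
    by rewrite (lo' eu) (mw ev).
  by rewrite (lw' eu) (mo ev).
case: st => {G' r} [u v z l cuv lG ll|u v t p b b' d d' cuv tL lt pL lp
  |u v m k b b' cuv mL lm kL lk|u v m k b b' cuv mL lm kL lk|u v o' w' b cuv oL
      lo' wL lw'].
- have vl : v \in conclusion_wires (lab l) by case: ll => ->; rewrite !inE eqxx ?orbT.
  have [vo vw] := src _ _ lG vl.
  case: (con _ _ cuv) => -[_ ev]; move: ll.
    by rewrite (vw ev) lw => -[].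
  by rewrite (vo ev) lo => -[].
- have := clash _ _ t p cuv tL pL; rewrite lt lp !inE.
  by case=> // -[e _]; move: lt; rewrite e ?lo ?lw.
- have := clash _ _ m k cuv mL kL; rewrite lm lk !inE.
  by case=> // -[e _]; move: lm; rewrite e ?lo ?lw.
- have := clash _ _ m k cuv mL kL; rewrite lm lk !inE.
  by case=> // -[e _]; move: lm; rewrite e ?lo ?lw.
- have := clash _ _ o' w' cuv oL wL; rewrite lo' lw' !inE; case=> // -[e e'].
    subst o' w'; exact: PE cuv oL lo' wL lw' fw.
  by move: lo'; rewrite e lw.
Qed.

End Contractive.

(** * Reducible cuts of a reduct and their levels *)

Section Pullback.
Variables (G : net) (lev : wire G -> int) (n : nat).
Hypothesis vG : valid lev n.
Let tG := valid_tidy vG.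
Let lG := valid_leveled vG.

(** Links with a conclusion keep their kind, so what makes an old or copied cut reducible in the
    reduct made it reducible in the net. A new cut joins the premise of a flat link above [w] to a
    copy of [a], both one level above [c]. *)
Lemma exp_step_reducible c o w a x y : cut_on c x y ->
  o \in links G -> lab o = OfCourse a x -> w \in links G -> lab w = WhyNot y ->
  forall C : node (exp_reduct c o w a), reducibleb C ->
  let L := cut_level (fun u : wire (exp_reduct c o w a) => lev (exp_residual u)) C in
  L = (cut_level lev c + 1)%R
  \/ (exists c', [/\ C = inl c', reducibleb c', L = cut_level lev c'
       & [/\ c' != c & ~~ inside o c']])
  \/ (exists c' f, [/\ C = inr (c', f), reducibleb c', L = cut_level lev c',
       f \in flats w & inside o c']).
Proof.
move=> cc oL lo wL lw C rC L; set G' := exp_reduct c o w a.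
pose vG' := exp_valid vG cc oL lo wL lw.
have [x' [y' /redexP[cC [l' [l'L xl lP]]]]] : exists x' y', redex C x' y'.
  by case/existsP: rC => x' /existsP[y' ?]; exists x', y'.
have LE : L = lev (exp_residual x') by rewrite /L (cut_level_on (valid_leveled vG') cC).
have axE (N : node G') : is_axiom (lab N) = match N with
    inl m => is_axiom (lab m) | inr (m, _) => is_axiom (lab m) end.
  by case: N => [m|[m f]] /=; case: (lab m) => //= u v; case: ifP.
have conclE (N : node G') X : X \in conclusion_wires (lab N) -> 
    exp_residual X \in conclusion_wires (lab (match N with inl m =>
        m | inr (m, _) => m end))
    /\ match N, X with inl _, inl _ => true | inr (_, f), inr (_, f') =>
        f == f' | _, _ => false end.
  case: N => [m|[m f]]; first by case/(exp_concl_outer tG)=> u -> um.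
  by case/exp_concl_copy=> u -> um; split=> //=; rewrite eqxx.
have mapE (N : node G') : (exists g h, @lab G' N =
      map_link g h (lab (match N with inl m => m | inr (m, _) => m end)))
    \/ exists u v, @lab G' N = Cut u v.
  case: N => [m|[m f]]; last by left; eexists; eexists; exact: exp_lab_copy.
  have [/(exp_lab_above tG c o a)[u _ ->]|mnw] := boolP (m \in flats w).
    by right; eexists; eexists.
  by left; eexists; eexists; exact: exp_lab_outer.
have dualE (N M : node G') : dual_links (lab N) (lab M) ->
    dual_links (lab (match N with inl m => m | inr (m, _) => m end))
               (lab (match M with inl m => m | inr (m, _) => m end)).
  case: (mapE N) => [[g [h ->]]|[u [v ->]]] //.
  case: (mapE M) => [[g' [h' ->]]|[u [v ->]]]; first by rewrite dual_links_map.
  by case: (lab (match N with inl m => m | inr (m, _) => m end)).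
have linkE (N : node G') : N \in links G' ->
    (match N with inl m => m | inr (m, _) => m end) \in links G.
  by case: N => [m|[m f]]; [rewrite exp_links_outer =>
      /andP[] | rewrite exp_links_copy => /and3P[]].
pose rn (N : node G') := match N with inl m => m | inr (m, _) => m end.
have back c' : cut_on c' (exp_residual x') (exp_residual y') -> reducibleb c'.
  move=> cc'; apply: (@redex_reducible _ _ (exp_residual x') (exp_residual y')).
  apply/redexP; split=> //; exists (rn l'); split; first exact: linkE.
    by have [] := conclE _ _ xl.
  case: lP => [ax|[m' [m'L ym d]]]; first by left; move: ax; rewrite axE;
      case: (l') => [|[]].
  right; exists (rn m'); split; [exact: linkE | by have [] :=
      conclE _ _ ym | exact: dualE].
have CL : C \in links G' by case: cC.
case: C rC cC CL @L LE => [m|[m f]] rC cC CL L LE.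
  have mL : m \in links G by move: CL; rewrite exp_links_outer => /andP[].
  have [mfw|mnw] := boolP (m \in flats w).
    left; rewrite LE; have [u lm lm'] := exp_lab_above tG c o a mfw.
    have eax : lev a = (cut_level lev c + 1)%R.
      have := lev_constraint lG oL; rewrite /level_constraint lo => ->.
      by rewrite (cut_level_on lG cc).
    have eu : lev u = lev a.
      have := lev_constraint lG mL; rewrite /level_constraint lm => /(_ _ lw) ->.
      have := lev_constraint lG oL; rewrite /level_constraint lo => ->.
      by rewrite (leveled_cut lG cc).
    by rewrite -eax; case: cC => _; rewrite lm' => -[[<- _]|[_ <-]].
  right; left; exists m.
  have cm : cut_on m (exp_residual x') (exp_residual y').
    split=> //; case: cC => _; rewrite exp_lab_outer // => -[] eC;
      have [u [v [-> <- <-]]] := map_link_cut eC; by [left | right].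
  split=> //; first exact: back.
    by rewrite LE (cut_level_on lG cm).
  by move: CL; rewrite exp_links_outer => /and5P[].
right; right; exists m, f.
have mL : m \in links G by move: CL; rewrite exp_links_copy => /and3P[].
have cm : cut_on m (exp_residual x') (exp_residual y').
  split=> //; case: cC => _; rewrite exp_lab_copy => -[] eC;
    have [u [v [-> <- <-]]] := map_link_cut eC; by [left | right].
split=> //; first exact: back.
- by rewrite LE (cut_level_on lG cm).
- by move: CL; rewrite exp_links_copy => /and3P[].
- by move: CL; rewrite exp_links_copy => /and3P[].
Qed.

(** The second hypothesis holds in the steps below because the relabelled links become cuts, which
    have no conclusion. *)
Lemma relabel_reducible (L : {set node G}) lab' (C : node G) :
  L \subset links G ->
  (forall l u, l \in L -> u \in conclusion_wires (lab' l) -> lab' l = lab l) ->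
  lab' C = lab C -> @reducibleb (Net L lab' (@box G)) C -> reducibleb C.
Proof.
move=> /subsetP sL same lC /existsP[x /existsP[y /redexP[[CL cC] [l [/= lL xl lP]]]]].
apply: (@redex_reducible G C x y); apply/redexP.
split; first by split; [exact: sL | rewrite -lC].
exists l; split; [exact: sL | by rewrite -(same _ _ lL xl) |].
rewrite -(same _ _ lL xl); case: lP => [|[m [/= mL ym d]]]; first by left.
by right; exists m; split; [exact: sL | rewrite -(same _ _ mL ym) | rewrite
    -(same _ _ mL ym)].
Qed.

Lemma unary_level_ge (i : int) c m k a b x y : cut_on c x y ->
  reducibleb c -> (forall c', reducibleb c' -> (i <= cut_level lev c')%R) ->
  (lev x <= lev a)%R ->
  forall C, @reducibleb (unary_reduct c m k a b) C ->
    (i <= @cut_level (unary_reduct c m k a b) lev C)%R.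
Proof.
move=> cc /[swap] lo_i /lo_i ci xa C rC.
have [eC|Cc] := eqVneq C c.
  apply: le_trans ci _; rewrite eC [X in (_ <= X)%R]/cut_level /= eqxx.
  by rewrite (cut_level_on lG cc).
have sub : links G :\: [set m; k] \subset links G by apply: subsetDl.
have lC : @lab (unary_reduct c m k a b) C = @lab G C by rewrite /= (negbTE Cc).
rewrite (_ : @cut_level (unary_reduct c m k a b) lev C = @cut_level G lev C).
  by apply/lo_i/(relabel_reducible sub _ lC rC) => l u _ /=; case: ifP.
by rewrite /cut_level lC.
Qed.

Lemma step_level_ge (i : int) c (G' : net) (r : wire G' -> wire G) : step c r ->
  (forall c', reducibleb c' -> (i <= cut_level lev c')%R) ->
  forall C, reducibleb C -> (i <= cut_level (fun u => lev (r u)) C)%R.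
Proof.
move=> st lo_i.
have redc : reducibleb c by apply/reducibleP; exists G', r.
have ci := lo_i c redc.
case: st => {G' r} [x y z a cc aG la|x y t p a b a' b' cc tL lt pL lp
  |x y m k a b cc mL lm kL lk|x y m k a b cc mL lm kL lk|x y o w a cc oL lo wL lw] C.
- have exz : lev x = lev z.
    rewrite (leveled_cut lG cc); have := lev_constraint lG aG.
    by rewrite /level_constraint; case: la => ->.
  have sgE u : lev (if u == z then x else u) = lev u by case: eqP => [->|].
  case/existsP=> x' /existsP[y' /redexP[[CL cC] [l [lL xl lP]]]].
  have CG : C \in links G by move: CL; rewrite !inE => /andP[].
  have [u [v [cuv ex' ey']]] : exists u v : wire G, [/\ @cut_on G C u v,
      x' = (if u == z then x else u) & y' = (if v == z then x else v)].
    case: cC => cC; have [u [v [lC ex0 ey0]]] := map_link_cut cC.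
      by exists u, v; split; [split=> //; left | rewrite -ex0 | rewrite -ey0].
    by exists v, u; split; [split=> //; right | rewrite -ey0 | rewrite -ex0].
  have cut_ev : cut_level lev C = lev u := cut_level_on lG cuv.
  have -> : @cut_level (ax_reduct c a x z) lev C = lev u.
    by rewrite /cut_level /=; case: (cuv) => _ [->|->] /=; rewrite sgE //;
      rewrite (leveled_cut lG cuv).
  rewrite -cut_ev; apply: lo_i.
  (* Such a cut faced the axiom, so it was reducible at the same level, whatever it faces in the
     reduct. *)
  have [az|] := boolP ((u == z) || (v == z)).
    have za : z \in conclusion_wires (lab a) by case: la => ->; rewrite !inE eqxx ?orbT.
    have axa : is_axiom (lab a) by case: la => ->.
    case/orP: az => /eqP e; rewrite e in cuv.
      by apply: (@redex_reducible G C z v); apply/redexP; split=> //; exists a;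
          split=> //; left.
    apply: (@redex_reducible G C z u); apply/redexP; split; first exact: cut_onC.
    by exists a; split=> //; left.
  rewrite negb_or => /andP[/negbTE uz /negbTE vz]; rewrite uz in ex'; rewrite vz in ey'.
  have outG (l0 : node G) : l0 \in links (ax_reduct c a x z) ->
      [/\ l0 != a & l0 \in links G].
    by rewrite !inE negb_or => /andP[/andP[_ ->] ->].
  have conclG (l0 : node G) (u0 : wire G) : l0 \in links (ax_reduct c a x z) ->
      u0 \in conclusion_wires (@lab (ax_reduct c a x z) l0) ->
          u0 \in conclusion_wires (lab l0).
    move=> /outG[l0a l0G]; rewrite map_link_conclusions => /mapP[u1 u1l ->].
    case: eqP => // e1; case/negP: l0a; apply/eqP.
    apply: (tidy_concl tG l0G aG u1l); rewrite e1.
    by case: la => ->; rewrite !inE eqxx ?orbT.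
  subst x' y'; apply: (@redex_reducible G C u v); apply/redexP; split=> //; exists l.
  split; [by case: (outG _ lL) | exact: conclG | case: lP => [|[m [mL vm d]]]].
    by rewrite is_axiom_map; left.
  right; exists m; split; [by case: (outG _ mL) | exact: conclG |].
  by move: d; rewrite dual_links_map.
- move=> rC; have sub : links G :\ p \subset links G by apply: subsetDl.
  have [eC|Cc] := eqVneq C c.
    by apply: le_trans ci _; rewrite eC /cut_level /= eqxx;
       have := lev_constraint lG tL; rewrite /level_constraint lt => -[-> _];
       rewrite -/(cut_level lev c) (cut_level_on lG cc).
  have [eC|Ct] := eqVneq C t.
    apply: le_trans ci _; rewrite eC /cut_level /= eqxx.
    have := lev_constraint lG tL; rewrite /level_constraint lt => -[ea eb].
    rewrite -/(cut_level lev c) (cut_level_on lG cc).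
    by case: ifP => _; rewrite ?ea ?eb.
  have lC : @lab (mult_reduct c t p a b a' b') C = @lab G C by rewrite /= (negbTE
      Cc) (negbTE Ct).
  rewrite (_ : @cut_level (mult_reduct c t p a b a' b') lev C = @cut_level G lev
      C); last by rewrite /cut_level lC.
  apply/lo_i/(relabel_reducible sub _ lC rC) => l u _ /=.
  by case: ifP => // _; case: ifP.
- apply: (unary_level_ge cc) => //; have := lev_constraint lG mL.
  by rewrite /level_constraint lm => ->.
- apply: (unary_level_ge cc) => //; have := lev_constraint lG mL.
  by rewrite /level_constraint lm => ->; rewrite lerDl.
- case/(exp_step_reducible cc oL lo wL lw)=> [->|[[c' [_ rc' ->
    _]]|[c' [f [_ rc' -> _ _]]]]].
  + by apply: le_trans ci _; rewrite lerDl.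
  + exact: lo_i.
  + exact: lo_i.
Qed.

End Pullback.

(** * Sizes and numbers of cuts *)

Section Sizes.
Variables (G : net) (tG : tidy G).
Implicit Types (l m c o w f : node G) (x y z : wire G).

Lemma step_size_contractive c o w (G' : net) (r : wire G' -> wire G) :
  contractiveb c o w -> step c r -> size_net G' <= size_net G ^ 2.
Proof.
move=> con; apply: (step_contractive tG (P :=
    fun G' r => size_net G' <= size_net G ^ 2) con).
move=> x y a cc oL lo wL lw _; rewrite /size_net.
(* Links of the reduct are coded by pairs of links. Sending the outer links to the diagonal causes
   no clash, since the first component of a copy is inside [o]. *)
pose h (N : node (exp_reduct c o w a)) : node G * node G :=
  match N with inl l => (l, l) | inr (l, f) => (l, f) end.
have h_inj : {in links (exp_reduct c o w a) &, injective h}.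
  move=> [l|[l f]] [m|[m g]]; rewrite ?exp_links_outer ?exp_links_copy.
  - by move=> _ _ [->].
  - by move=> /and5P[_ ol _ _ _] /and3P[_ om _] [e _]; rewrite e om in ol.
  - by move=> /and3P[_ om _] /and5P[_ ol _ _ _] [e _]; rewrite -e om in ol.
  - by move=> _ _ [-> ->].
rewrite -(card_in_imset h_inj) -mulnn -cardsX; apply/subset_leq_card/subsetP.
move=> p /imsetP[[l|[l f]] lL ->]; rewrite in_setX /=.
  by move: lL; rewrite exp_links_outer => /andP[-> _].
by move: lL; rewrite exp_links_copy => /and3P[-> _ /flatsP[-> _]].
Qed.

Lemma step_size_noncontractive c (G' : net) (r : wire G' -> wire G) :
  (forall o w, ~~ contractiveb c o w) -> step c r -> size_net G' < size_net G.
Proof.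
move=> ncon; case=> {G' r} [x y z a cc aG la|x y t p a b a' b' cc tL lt pL lp
  |x y m k a b cc mL lm kL lk|x y m k a b cc mL lm kL lk|x y o w a cc oL lo wL lw];
  rewrite /size_net.
- apply/proper_card/properP; split; first exact: subsetDl.
  by exists a; rewrite // !inE eqxx orbT.
- apply/proper_card/properP; split; first exact: subsetDl.
  by exists p; rewrite // !inE eqxx.
- apply/proper_card/properP; split; first exact: subsetDl.
  by exists m; rewrite // !inE eqxx.
- apply/proper_card/properP; split; first exact: subsetDl.
  by exists m; rewrite // !inE eqxx.
(* What remains is a box against a why not link of arity 0, where nothing is copied. *)
have fw : flats w = set0.
  apply/eqP; apply: contraNT (ncon o w) => fw; apply/contractiveP.
  by exists x, y, a.
pose h (N : node (exp_reduct c o w a)) : node G :=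
  match N with inl l => l | inr (l, f) => l end.
have h_inj : {in links (exp_reduct c o w a) &, injective h}.
  move=> [l|[l f]] [m|[m g]]; rewrite ?exp_links_outer ?exp_links_copy ?fw ?inE
      ?andbF //.
  by move=> _ _ /= ->.
rewrite -(card_in_imset h_inj); apply/proper_card/properP; split.
  apply/subsetP => l /imsetP[[m|[m f]] mL ->] /=.
    by move: mL; rewrite exp_links_outer => /andP[].
  by move: mL; rewrite exp_links_copy => /and3P[].
exists o => //; apply/imsetP=> -[[m|[m f]] mL eo].
  by move: mL; rewrite exp_links_outer /= -[m]/(h (inl m)) -eo eqxx !andbF.
by move: mL; rewrite exp_links_copy fw inE !andbF.
Qed.

Variable lev : wire G -> int.

Definition reducible_cuts (i : int) : {set node G} :=
  [set c | reducibleb c && (cut_level lev c == i)].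

Definition all_contractive (i : int) : Prop :=
  forall c, c \in reducible_cuts i -> exists o w, contractiveb c o w.

(* The cuts and their boxes are pairwise distinct links, hence the factor 2. *)
Lemma card_reducible_cuts i : all_contractive i ->
  2 * #|reducible_cuts i| <= size_net G.
Proof.
move=> con.
pose bx c := odflt c [pick o | [exists w, contractiveb c o w]].
have bxP c : c \in reducible_cuts i -> exists w, contractiveb c (bx c) w.
  move=> /con[o [w cow]]; rewrite /bx; case: pickP => [o' /existsP[w' ?]|/(_ o)].
    by exists w'.
  by move/existsP; case; exists w.
have bx_inj : {in reducible_cuts i &, injective bx}.
  move=> c c' /bxP[w cw] /bxP[w' cw'] e; rewrite e in cw.
  exact: contractive_inj_cut cw cw'.
have dis : reducible_cuts i :&: bx @: reducible_cuts i = set0.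
  apply/setP => l; rewrite !inE; apply/negP=> /andP[/andP[rl ll] /imsetP[c cR e]].
  have [w /contractiveP[x [y [a [_ [_ lo] _ _]]]]] := bxP c cR.
  have [|o' [w' /contractiveP[x' [y' [a' [[_ lc] _ _ _]]]]]] := con l.
    by rewrite inE rl ll.
  by move: lc; rewrite e lo => -[].
have sub : reducible_cuts i :|: bx @: reducible_cuts i \subset links G.
  apply/subsetP => l; rewrite in_setU => /orP[/con[o [w]]|/imsetP[c /bxP[w cw] ->]].
    by case/contractiveP=> x [y [a [[]]]].
  by case/contractiveP: cw => x [y [a [_ []]]].
have := subset_leq_card sub; rewrite cardsU dis cards0 subn0.
by rewrite card_in_imset // addnn mul2n.
Qed.

End Sizes.

Section ContractivePhase.
Variables (G : net) (lev : wire G -> int) (n : nat).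
Hypothesis vG : valid lev n.
Let tG := valid_tidy vG.
Implicit Types (l m c o w f : node G) (x y z : wire G).

(* The copied box contains no reducible cut of level [i] by minimality, and
   the new cuts have level [i + 1]. *)
Lemma contractive_step i c o w (G' : net) (r : wire G' -> wire G) :
  all_contractive lev i -> c \in reducible_cuts lev i -> contractiveb c o w ->
  minimal_box lev i o -> step c r ->
  #|reducible_cuts (fun u => lev (r u)) i| < #|reducible_cuts lev i| /\
  all_contractive (fun u => lev (r u)) i.
Proof.
move=> con cR cow min_o.
apply: (step_contractive tG (P := fun G' r =>
  #|reducible_cuts (fun u : wire G' => lev (r u)) i| < #|reducible_cuts lev i| /\
  all_contractive (fun u : wire G' => lev (r u)) i) cow).
move=> x y a cc oL lo wL lw fw; set G'' := exp_reduct c o w a.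
set lev' := fun u : wire G'' => lev (exp_residual u).
have eci : cut_level lev c = i by move: cR; rewrite inE => /andP[_ /eqP].
have noo := tidy_nested tG oL.
have cutE C : C \in reducible_cuts lev' i ->
    exists c', [/\ C = inl c', c' \in reducible_cuts lev i, c' != c & ~~ inside o c'].
  rewrite inE => /andP[rC /eqP Ci].
  have := exp_step_reducible vG cc oL lo wL lw rC; rewrite -/lev' /= Ci.
  case=> [e|[[c' [-> rc' e [nc' nin]]]|[c' [f [_ rc' e _ oc']]]]].
  - by move/eqP: e; rewrite eci -subr_eq0 opprD addrA subrr sub0r oppr_eq0 oner_eq0.
  - by exists c'; split=> //; rewrite inE rc' e eqxx.
  - have c'R : c' \in reducible_cuts lev i by rewrite inE rc' e eqxx.
    have [o' [w' co']] := con c' c'R.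
    (* Minimality gives only that this box is [o] itself; but then the cut, being at the location of
       [o] and inside [o], would put [o] inside itself. *)
    have eo : o' = o.
      apply: min_o; apply: rt_step; exists c', w', c, w; split.
      + by split; [exact/contractiveP | rewrite e].
      + by split; [exact/contractiveP |].
      + by right.
    rewrite eo in co'; have [bo _] := contractive_box tG co'.
    by move: oc' noo; rewrite -(inside_box _ bo) => ->.
split.
  have sub : reducible_cuts lev' i \subset inl @: (reducible_cuts lev i :\ c).
    apply/subsetP => C /cutE[c' [-> c'R nc' _]]; apply: imset_f.
    by rewrite in_setD1 nc' c'R.
  apply: leq_ltn_trans (subset_leq_card sub) _.
  rewrite card_imset; last by move=> ? ? [].
  by rewrite [X in _ < X](cardsD1 c) cR.
move=> C /cutE[c' [-> c'R nc' nin]].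
have [o' [w' co']] := con c' c'R; exists (inl o'), (inl w').
have [bo' bw'] := contractive_box tG co'.
have /contractiveP[x' [y' [a' [cc' [oL' lo'] [wL' lw'] fw']]]] := co'.
have lcn k : lab c = k -> ~ (is_of_course k || is_why_not k).
  by case: cc => _ [->|->] <-.
have noo' : o' != o.
  by apply: contraNneq nc' => e; rewrite e in co';
      apply/eqP/(contractive_inj_cut tG co' cow).
have nww' : w' != w.
  by apply: contraNneq nc' => e; rewrite e in co';
      apply/eqP/(contractive_inj_why_not tG co' cow).
have fo f : f \in flats w -> ~~ inside o f.
  exact: (flats_outside tG cc oL lo wL lw (valid_coreless vG)).
have nfl l : flat_target (lab l) = None -> l \notin flats w.
  by move=> e; apply/flatsP=> -[_]; rewrite e.
have o'L : inl o' \in links G''.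
  rewrite exp_links_outer oL' (inside_box _ bo') nin noo' /=.
  apply/andP; split; apply/eqP=> e; last by rewrite e lw in lo'.
  by apply: (lcn _ erefl); rewrite -e lo'.
have w'L : inl w' \in links G''.
  rewrite exp_links_outer wL' (inside_box _ bw') nin nww' /= andbT.
  apply/andP; split; apply/eqP=> e; last by rewrite e lo in lw'.
  by apply: (lcn _ erefl); rewrite -e lw'.
have c'L : inl c' \in links G''.
  have c'G : c' \in links G by case: cc'.
  rewrite exp_links_outer c'G nin nc' /=; case: cc' => _ lc'.
  by apply/andP; split; apply/eqP=> e; rewrite e ?lo ?lw in lc'; case: lc'.
apply/contractiveP; exists (inl x'), (inl y'), (inl a'); split.
- split=> //; rewrite exp_lab_outer; last by apply: nfl; case: cc' => _ [->|->].
  by case: cc' => _ [->|->]; [left|right].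
- by split=> //; rewrite exp_lab_outer ?lo' //; apply: nfl; rewrite lo'.
- by split=> //; rewrite exp_lab_outer ?lw' //; apply: nfl; rewrite lw'.
(* The arity of [w'] stays positive: a chain which starts inside [o] is copied for [f1], which
   exists because the reduced cut is contractive. *)
have [f0 f0w'] := set0Pn _ fw'; have [f1 f1w] := set0Pn _ fw.
have /flatsP[f0G f0t] := f0w'; have [u lf0] := flat_labP f0t.
apply/set0Pn; have [of0|nof0] := boolP (inside o f0).
  exists (inr (f0, f1)); apply/(@flatsP G''); split.
    by rewrite exp_links_copy f0G of0.
  by rewrite exp_lab_copy lf0 /= (inside_box _ bw') (negbTE nin).
exists (inl f0); apply/(@flatsP G''); split.
  rewrite exp_links_outer f0G nof0 /=; apply/and3P; split; apply/eqP=> e.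
  - by case: cc => _; rewrite -e lf0 => -[].
  - by rewrite e lo in lf0.
  - by rewrite e lw in lf0.
have f0w : f0 \notin flats w.
  by apply/flatsP=> -[_]; rewrite f0t => -[e]; rewrite e eqxx in nww'.
by rewrite exp_lab_outer // lf0.
Qed.

End ContractivePhase.

(** * The contractive order *)

Section MinimalBox.
Variables (G : net) (lev : wire G -> int) (tG : tidy G) (nc : coreless G).
Variable i : int.
Implicit Types (l m c o w f b : node G) (x y z : wire G).

Let T : finType := (node G * node G * node G)%type.
Implicit Types t : T.

Local Notation cut t := t.1.1.
Local Notation bx t := t.1.2.
Local Notation wn t := t.2.

Let A : {set T} :=
  [set t | contractiveb (cut t) (bx t) (wn t) & cut_level lev (cut t) == i].

Let above t' t : bool := [exists f in flats (wn t), pax f (bx t')].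

Let before t' t : bool := above t' t || inside (bx t) (cut t').

Let AP t : t \in A -> contractiveb (cut t) (bx t) (wn t).
Proof. by rewrite inE => /andP[]. Qed.

Let A_box t : t \in A -> box (bx t) = box (cut t) /\ box (wn t) = box (cut t).
Proof. by move/AP; apply: contractive_box. Qed.

Let A_links t : t \in A ->
  [/\ cut t \in links G, bx t \in links G & wn t \in links G].
Proof. by move/AP/contractiveP=> [x [y [a [[? _] [? _] [? _] _]]]]. Qed.

(** Minimality refers to the reflexive transitive closure, which is trivial below a box without
    predecessors. *)
Lemma not_before_minimal t : t \in A -> (forall t', t' \in A -> ~~ before t' t) ->
  minimal_box lev i (bx t).
Proof.
move=> tA nb o' le; move e: (bx t) le => o le.
elim: le e => {o o'}[o' o bef|//|o1 o2 o3 _ IH1 _ IH2] e; last first.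
  by have e2 := IH2 e; rewrite -e2 in IH1 *; apply: IH1; rewrite e2.
case: bef => [c [w [c' [w' [[/contractiveP cow ci] [/contractiveP cow' ci'] bef]]]]].
have tA' : (c, o', w) \in A by rewrite inE cow ci eqxx.
case/negP: (nb _ tA'); rewrite /before /=.
have tcow := AP tA; rewrite e in tcow.
have ec := contractive_inj_cut tG tcow cow'; rewrite ec in tcow.
have [_ ew] := contractive_inj tG tcow cow'.
case: bef => [[f fw' fo']|io]; last by rewrite e io orbT.
by apply/orP; left; apply/exists_inP; exists f; rewrite // ew.
Qed.

Let depth t := #|[set b | inside b (bx t)]|.

(** A predecessor is always at least as deep: strictly if its cut is inside the box, and by
    [leaving_chain] if it has an auxiliary port above the why not link. In the second case equal
    depth forces equal locations. *)
Lemma before_depth t' t : t' \in A -> t \in A -> before t' t ->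
  depth t' <= depth t -> above t' t /\ box (bx t') = box (bx t).
Proof.
move=> t'A tA bef dep.
have [cG oG wG] := A_links tA; have [cG' oG' wG'] := A_links t'A.
have [bo bw] := A_box tA; have [bo' bw'] := A_box t'A.
case/orP: bef => [ab|ins].
  split=> //; case/exists_inP: ab => f fw /paxP[w [fG ft ob nob]].
  case/flatsP: fw => _; rewrite ft => -[ew]; rewrite ew in ft nob.
  have sub : [set b | inside b (bx t)] \subset [set b | inside b (bx t')].
    apply/subsetP => b; rewrite !inE => bt.
    apply: (leaving_chain tG fG ft ob nob).
    by rewrite (inside_box _ (m := bx t)) // bw bo.
  have /eqP e : [set b | inside b (bx t)] == [set b | inside b (bx t')].
    by rewrite eqEcard sub.
  apply: (box_eq_inside tG oG' oG) => b.
  by have /setP/(_ b) := e; rewrite !inE => ->.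
have ins' : inside (bx t) (bx t') by rewrite (inside_box _ bo').
suff : depth t < depth t' by rewrite ltnNge dep.
apply/proper_card/properP; split.
  by apply/subsetP => b; rewrite !inE => bt; apply: inside_trans bt ins'.
by exists (bx t); rewrite inE // (negbTE (tidy_nested tG oG)).
Qed.

(* The cuts on such a family of boxes, and the chains from each box to the why
   not link of the next one, form a core. *)
Lemma no_cycle_of_boxes (R : {set T}) (p : T -> T) (d : option (node G)) :
  R \subset A -> R != set0 -> p @: R = R ->
  (forall t, t \in R -> above (p t) t /\ box (bx t) = d) -> False.
Proof.
move=> /subsetP RA /set0Pn[t0 t0R] pR abR.
pose f t := odflt (bx t) [pick f in flats (wn t) | pax f (bx (p t))].
have fP t : t \in R -> f t \in flats (wn t) /\ pax (f t) (bx (p t)).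
  move=> /abR[/exists_inP[g gw gp] _]; rewrite /f.
  by case: pickP => [g' /andP[]//|/(_ g)]; rewrite gw gp.
have pRt t : t \in R -> p t \in R by move=> tR; rewrite -pR imset_f.
pose S : {set vertex G} := [set v : vertex G | match v with
  | inl l => [exists t in R, [|| l == cut t, l == bx t | l == wn t]]
  | inr (inl u) => [exists t in R, u \in premise_wires (lab (cut t))]
  | inr (inr g) => [exists t in R, g == f t] end].
have SE (v : vertex G) : (v \in S) = match v with
  | inl l => [exists t in R, [|| l == cut t, l == bx t | l == wn t]]
  | inr (inl u) => [exists t in R, u \in premise_wires (lab (cut t))]
  | inr (inr g) => [exists t in R, g == f t] end by rewrite inE.
have tP t : t \in R -> exists x y a, [/\ cut_on (cut t) x y,
    lab (bx t) = OfCourse a x, lab (wn t) = WhyNot y &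
    [/\ inl (cut t) \in S, inl (bx t) \in S, inl (wn t) \in S,
     inr (inr (f t)) \in S & forall u, u \in premise_wires (lab (cut t)) ->
         inr (inl u) \in S]].
  move=> tR; have /AP/contractiveP[x [y [a [cc [oG lo] [wG lw] _]]]] := RA t tR.
  exists x, y, a; split=> //; split; rewrite ?SE.
  - by apply/exists_inP; exists t; rewrite // eqxx.
  - by apply/exists_inP; exists t; rewrite // eqxx orbT.
  - by apply/exists_inP; exists t; rewrite // eqxx !orbT.
  - by apply/exists_inP; exists t.
  - by move=> u uc; rewrite SE; apply/exists_inP; exists t.
have locP t : t \in R -> [/\ box (cut t) = d, box (bx t) = d & box (wn t) = d].
  by move=> tR; have [_ od] := abR t tR; have [<- ->] := A_box (RA t tR).
have uniq_wn t t' : t \in R -> t' \in R -> wn t = wn t' -> t = t'.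
  move=> tR t'R e; have a1 := AP (RA t tR); have a2 := AP (RA t' t'R).
  rewrite -e in a2; have ec := contractive_inj_why_not tG a1 a2.
  rewrite -ec in a2; have [eo _] := contractive_inj tG a1 a2.
  by case: t t' e ec eo {tR t'R a1 a2} => [[? ?] ?] [[? ?] ?] /= -> -> ->.
have incx t x y : t \in R -> cut_on (cut t) x y ->
    incident d (cut t) (inl x) /\ incident d (cut t) (inl y).
  move=> tR cc; have [cd _ _] := locP t tR; have [cx cy] := cut_on_prem cc.
  by have [cG _ _ cno _] := cut_on_link cc; split; apply: incident_prem.
apply: (@nc d S); split.
- by have [x [y [a [_ _ _ [tS _ _ _ _]]]]] := tP t0 t0R; apply/set0Pn;
    exists (inl (cut t0)).
- move=> l e e'; rewrite SE => /exists_inP[t tR lt] eS e'S le le'.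
  have [x [y [a [cc lo lw _]]]] := tP t tR.
  have {lt} el : l = wn t.
    case/or3P: lt => /eqP // el; move: le; rewrite el ?(cut_on_not_switched _ cc) //.
    by rewrite /switched_premise lo.
  have fe g : inr g \in S -> switched_premise l g -> g = inr (f t).
    move=> gS; rewrite el /switched_premise lw; case: g gS => // g.
    rewrite SE => /exists_inP[t' t'R /eqP->] /flatsP[_ ft'].
    have [/flatsP[_ ft]] := fP t' t'R; rewrite ft' in ft; case: ft => ew _.
    by rewrite (uniq_wn t t').
  by rewrite (fe e eS le) (fe e' e'S le').
- move=> v; rewrite SE; case: v => [l|[u|g]] /exists_inP[t tR];
    have [x [y [a [cc lo lw [cS oS wS fS uS]]]]] := tP t tR;
    have [cd od wd] := locP t tR; have [icx icy] := incx t x y tR cc;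
    have [cx cy] := cut_on_prem cc; have [cG oG wG] := A_links (RA t tR);
    have iox : incident d (bx t) (inl x) by [apply: incident_concl => //;
        rewrite lo inE];
    have iwy : incident d (wn t) (inl y) by [apply: incident_concl => //;
        rewrite lw inE];
    have [fw fp] := fP t tR;
    have iwf : incident d (wn t) (inr (f t)) by [rewrite /incident wG wd eqxx lw];
    have pR' := pRt t tR;
    have [_ [_ [_ [_ _ _ [_ oS' _ _ _]]]]] := tP (p t) pR'.
  + case/or3P=> /eqP->.
    * apply: (deg2_cons (uS _ cx) icx (uS _ cy) icy).
      by apply: contra_neq (cut_on_neq tG cc) => -[].
    * have : t \in p @: R by rewrite pR.
      case/imsetP=> t' t'R et; have [_ fp'] := fP t' t'R; rewrite -et in fp'.
      have [_ [_ [_ [_ _ _ [_ _ _ fS' _]]]]] := tP t' t'R.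
      apply: (deg2_cons (uS _ cx) iox fS') => //.
      by rewrite /= /incident oG od eqxx lo.
    * exact: (deg2_cons (uS _ cy) iwy fS iwf).
  + have [cG' eqp _ _ _] := cut_on_link cc; rewrite eqp !inE => /orP[]/eqP->.
      apply: (deg2_cons cS icx oS iox); apply/eqP=> -[e]; case: cc => _.
      by rewrite e lo => -[].
    apply: (deg2_cons cS icy wS iwy); apply/eqP=> -[e]; case: cc => _.
    by rewrite e lw => -[].
  + move/eqP=> ->; have [_ od' _] := locP _ pR'; have [_ oG' _] := A_links (RA _ pR').
    have [x' [y' [a' [_ lo' _ _]]]] := tP (p t) pR'.
    apply: (deg2_cons wS iwf oS').
      by rewrite /= /incident oG' od' eqxx lo'.
    by apply/eqP=> -[e]; rewrite -e lw in lo'.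
Qed.

(** If every triple had a predecessor, then by [before_depth] the predecessors of a triple of
    maximal depth would all stay at one location. A smallest nonempty set closed under a choice of
    predecessors is permuted by this choice, against [no_cycle_of_boxes]. *)
Lemma exists_minimal_box c0 o0 w0 : contractiveb c0 o0 w0 -> cut_level lev c0 = i ->
  exists c o w, [/\ contractiveb c o w, cut_level lev c = i & minimal_box lev i o].
Proof.
move=> co0 ci0; have t0A : (c0, o0, w0) \in A by rewrite inE co0 ci0 eqxx.
have [/exists_inP[t tA /forall_inP nb]|allb] :=
    boolP [exists t in A, [forall t' in A, ~~ before t' t]].
  exists (cut t), (bx t), (wn t); split; first exact: AP.
    by move: tA; rewrite inE => /andP[_ /eqP].
  exact: not_before_minimal.
have {allb} pred t : t \in A -> exists2 t', t' \in A & before t' t.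
  move=> tA; move: allb; rewrite negb_exists_in => /forall_inP/(_ t tA).
  by rewrite negb_forall_in => /exists_inP[t' ? /negPn]; exists t'.
case: (arg_maxnP depth t0A) => t1 t1A0 max1; have t1A : t1 \in A := t1A0.
pose B := [set t in A | box (bx t) == box (bx t1) & depth t == depth t1].
have predB t : t \in B -> exists2 t', t' \in B & above t' t.
  rewrite inE => /and3P[tA /eqP bt /eqP dt]; have [t' t'A bef] := pred t tA.
  have [ab bt'] := before_depth t'A tA bef (leq_trans (max1 t' t'A) (eq_leq (esym dt))).
  exists t' => //; rewrite inE t'A bt' bt eqxx /=.
  rewrite /depth (_ : [set b | inside b (bx t')] = [set b | inside b (bx t)])
      ?[#|_|]dt //.
  by apply/setP => b; rewrite !inE; apply: inside_box.
pose p t := odflt t [pick t' in B | above t' t].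
have pP t : t \in B -> p t \in B /\ above (p t) t.
  move=> /predB[t' t'B ab]; rewrite /p.
  by case: pickP => [t'' /andP[]//|/(_ t')]; rewrite t'B ab.
have B0 : [&& B \subset B, B != set0 & p @: B \subset B].
  rewrite subxx /=; apply/andP; split; first by apply/set0Pn; exists t1;
      rewrite in_set t1A !eqxx.
  by apply/subsetP => t /imsetP[t' /pP[? _] ->].
pose Q (R : {set T}) := [&& R \subset B, R != set0 & p @: R \subset R].
case: (@arg_minnP _ B Q (fun R => #|R|) B0) => R /and3P[RB Rn0 pR] minR.
have QpR : Q (p @: R).
  rewrite /Q (subset_trans pR RB) imsetS //= andbT.
  by have [t tR] := set0Pn _ Rn0; apply/set0Pn; exists (p t); apply: imset_f.
have epR : p @: R = R by apply/eqP; rewrite eqEcard pR minR.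
case: (@no_cycle_of_boxes R p (box (bx t1))) => //.
  by apply: subset_trans RB _; apply/subsetP => t; rewrite inE => /andP[].
move=> t /(subsetP RB) tB; have [_ ab] := pP t tB; split=> //.
by move: tB; rewrite inE => /and3P[_ /eqP].
Qed.

End MinimalBox.

(** * Rounds *)

Lemma normalizes_within_mono (m k : nat) (G : net) (lev : wire G -> int) :
  m <= k -> normalizes_within m lev -> normalizes_within k lev.
Proof.
elim: m k G lev => [|m IH] [|k] G lev //= mk [nG|]; try by left.
case=> ex st; right; split=> // c G' r ch rs.
exact: (IH _ G' (fun u => lev (r u)) mk (st c G' r ch rs)).
Qed.

Definition levels_from (G : net) (lev : wire G -> int) (i : int) : Prop :=
  forall c : node G, reducibleb c -> (i <= cut_level lev c)%R.

Section Rounds.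
Variable n : nat.

Lemma levels_from_next (G : net) (lev : wire G -> int) i : levels_from lev i ->
  reducible_cuts lev i = set0 -> levels_from lev (i + 1)%R.
Proof.
move=> li r0 c rc; have := li c rc; rewrite le_eqVlt => /orP[/eqP e|];
    last by rewrite lezD1.
by have := in_set0 c; rewrite -r0 inE rc -e eqxx.
Qed.

Lemma chosen_reducible_cut (G : net) (lev : wire G -> int) i c c1 :
  levels_from lev i -> c1 \in reducible_cuts lev i -> chosen lev c ->
  c \in reducible_cuts lev i.
Proof.
move=> li; rewrite !inE => /andP[r1 /eqP e1] [/reducibleP rc min _].
rewrite rc eq_le li // andbT -e1; apply: min; exact/reducibleP.
Qed.

(** The hypothesis on later rounds is made for every net in which the phase may end, as the
    procedure is not deterministic. Each of the at most [k] steps squares the bound on the size,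
    whence [M ^ (2 ^ k)]. *)
Lemma contractive_phase k (m M : nat) i (G : net) (lev : wire G -> int) :
  valid lev n -> levels_from lev i -> all_contractive lev i ->
  #|reducible_cuts lev i| <= k -> size_net G <= M ->
  (forall (G' : net) (lev' : wire G' -> int), valid lev' n ->
     levels_from lev' (i + 1)%R -> size_net G' <= M ^ (2 ^ k) ->
     normalizes_within m lev') ->
  normalizes_within (k + m) lev.
Proof.
elim: k M G lev => [|k IH] M G lev vG li con card sz next;
    have [r0|/set0Pn[c1 c1R]] := eqVneq (reducible_cuts lev i) set0.
- by apply: next => //; apply: levels_from_next.
- by move: card; rewrite (cardsD1 c1) c1R.
- apply: (normalizes_within_mono (leq_addl _ _)); apply: next => //.
    exact: levels_from_next.
  apply: leq_trans sz _; case: M => // M.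
  by rewrite -{1}[M.+1]expn1 leq_pexp2l // expn_gt0.
have [o1 [w1 con1]] := con c1 c1R.
have tG := valid_tidy vG.
right; split.
  have [|c [o [w [cow ci min_o]]]] :=
      exists_minimal_box tG (valid_coreless vG) (lev := lev) (i := i) con1.
    by move: c1R; rewrite inE => /andP[_ /eqP].
  exists c; split.
  - exact/reducibleP/(contractive_reducible cow).
  - by move=> c' /reducibleP rc'; rewrite ci; apply: li.
  - move=> o' w' /contractiveP cow'; have [<- _] := contractive_inj tG cow cow'.
    rewrite ci; split=> // c' /reducibleP rc' ci'.
    have [|o'' [w'' co'']] := con c'; first by rewrite inE rc' ci' eqxx.
    by exists o'', w''; apply/contractiveP.
move=> c G' r ch st.
have cR := chosen_reducible_cut li c1R ch.
have ci : cut_level lev c = i by move: cR; rewrite inE => /andP[_ /eqP].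
have [o [w cow]] := con c cR.
have [_ _ /(_ o w)[|min_o _]] := ch; first exact/contractiveP.
rewrite ci in min_o.
have [card' con'] := contractive_step vG con cR cow min_o st.
apply: (IH (M ^ 2)) => //.
- exact: (step_valid vG st).
- exact: (step_level_ge vG st li).
- by rewrite -ltnS; apply: leq_trans card' card.
- by apply: leq_trans (step_size_contractive tG cow st) _; rewrite leq_exp2r.
- by move=> G'' lev'' v'' l''; rewrite -expnM -expnS; apply: next.
Qed.

(** It suffices that [s * 2 ^ k <= 2 ^ s], that is [s <= 2 ^ (s - k)]. For positive [k] and
    [s = 2 * k + j] this follows from [2 * k <= 2 ^ k] and [j < 2 ^ j]. *)
Lemma square_tower_bound k s : 2 * k <= s -> s ^ (2 ^ k) <= 2 ^ (2 ^ s).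
Proof.
move=> ks; have sle : s <= 2 ^ (s - k).
  have [e|k0] := posnP k; first by rewrite e subn0 ltnW // ltn_expl.
  have -> : s = 2 * k + (s - 2 * k) by lia.
  rewrite (_ : 2 * k + (s - 2 * k) - k = k + (s - 2 * k)); last by lia.
  move: (s - 2 * k) => j; rewrite expnD.
  have h1 : 2 * k <= 2 ^ k.
    case: k k0 {ks} => // k _; elim: k => // k IH; rewrite expnS; lia.
  have h2 : j < 2 ^ j by apply: ltn_expl.
  nia.
have s1 : s <= 2 ^ s by rewrite ltnW // ltn_expl.
apply: leq_trans (_ : (2 ^ s) ^ (2 ^ k) <= _); first by rewrite leq_exp2r ?expn_gt0.
rewrite -expnM leq_exp2l //; apply: leq_trans (_ : 2 ^ (s - k) * 2 ^ k <= _).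
  by rewrite leq_mul2r sle orbT.
by rewrite -expnD leq_exp2l //; lia.
Qed.

Lemma contractive_round s m i (G : net) (lev : wire G -> int) :
  valid lev n -> levels_from lev i -> all_contractive lev i -> size_net G <= s ->
  (forall (G' : net) (lev' : wire G' -> int), valid lev' n ->
     levels_from lev' (i + 1)%R -> size_net G' <= 2 ^ (2 ^ s) ->
     normalizes_within m lev') ->
  normalizes_within (s + m) lev.
Proof.
move=> vG li con sz next; have card := card_reducible_cuts (valid_tidy vG) con.
apply: (normalizes_within_mono (m := #|reducible_cuts lev i| + m)).
  by rewrite leq_add2r; lia.
apply: (contractive_phase vG li con (leqnn _) (leqnn _)) => G' lev' v' l' sz'.
apply: next => //; apply: leq_trans sz' (leq_trans (square_tower_bound card) _).
by rewrite !leq_exp2l.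
Qed.

(** A non-contractive step is paid for by the decrease of the size: the contractive phase then
    starts with a smaller bound both on its steps and on the final size, so the whole round stays
    within the initial [s]. *)
Lemma round_normalizes s m i (G : net) (lev : wire G -> int) :
  valid lev n -> levels_from lev i -> size_net G <= s ->
  (forall (G' : net) (lev' : wire G' -> int), valid lev' n ->
     levels_from lev' (i + 1)%R -> size_net G' <= 2 ^ (2 ^ s) ->
     normalizes_within m lev') ->
  normalizes_within (s + m) lev.
Proof.
elim: s G lev => [|s IH] G lev vG li sz next;
  have [/forall_inP con|ncon] := boolP
    [forall c in reducible_cuts lev i, [exists o, exists w, contractiveb c o w]].
- apply: contractive_round next => // c /con /existsP[o /existsP[w]].
  by exists o, w.
- move: ncon; rewrite negb_forall_in => /exists_inP[c cR _].
  move: cR; rewrite inE => /andP[/existsP[x /existsP[y /redexP[[cG _] _]]] _].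
  by move: sz; rewrite leqn0 cards_eq0 => /eqP s0; rewrite s0 inE in cG.
- apply: contractive_round next => // c /con /existsP[o /existsP[w]].
  by exists o, w.
move: ncon; rewrite negb_forall_in => /exists_inP[c1 c1R nc1].
have c1n o w : ~~ contractiveb c1 o w.
  by apply: contra nc1 => co; apply/existsP; exists o; apply/existsP; exists w.
have [r1 /eqP e1] : reducibleb c1 /\ cut_level lev c1 == i.
  by apply/andP; move: c1R; rewrite inE.
right; split.
  exists c1; split; first exact/reducibleP.
    by move=> c' /reducibleP rc'; rewrite e1; apply: li.
  by move=> o w /contractiveP co; case/negP: (c1n o w).
move=> c G' r ch st.
have cR := chosen_reducible_cut li c1R ch.
have ci : cut_level lev c = i by move: cR; rewrite inE => /andP[_ /eqP].
(* A contractive cut is chosen only if all reducible cuts of its level are contractive, and [c1] is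
   not. *)
have cn o w : ~~ contractiveb c o w.
  apply/negP=> /contractiveP co; have [_ _ /(_ o w co)[_ /(_ c1)]] := ch.
  case=> [||o' [w' /contractiveP co']]; [exact/reducibleP | by rewrite e1 ci |].
  by case/negP: (c1n o' w').
have sz' := step_size_noncontractive cn st.
apply: IH; [exact: (step_valid vG st) | exact: (step_level_ge vG st li) | |].
  by rewrite -ltnS; apply: leq_trans sz' sz.
move=> G'' lev'' v'' l'' sz''; apply: next => //; apply: leq_trans sz'' _.
by rewrite leq_exp2l // leq_exp2l.
Qed.

Lemma towerS k s : tower k.+1 s = 2 ^ tower k s.
Proof. by []. Qed.

Lemma tower_mono j k s : j <= k -> tower j s <= tower k s.
Proof.
move=> /subnK <-; elim: (k - j) => // d IH; rewrite addSn towerS.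
by apply: leq_trans IH _; rewrite ltnW // ltn_expl.
Qed.

(** When level [i] is reached, [k] rounds remain. Each is charged the bound for the last one, that
    of level [n], which gives the product. *)
Lemma rounds_normalize k i s (G : net) (lev : wire G -> int) :
  i + k = n.+1 -> valid lev n -> levels_from lev i%:Z ->
  size_net G <= tower (2 * i) s -> normalizes_within (k * tower (2 * n) s) lev.
Proof.
elim: k i G lev => [|k IH] i G lev ik vG li sz.
  (* Here [i = n + 1] exceeds every level, so no reducible cut is left. *)
  left=> c /reducibleP rc; have := li c rc.
  have /existsP[x /existsP[y /redexP[cc _]]] := rc.
  have [cx _] := cut_on_prem cc; have [cG _ _ _ _] := cut_on_link cc.
  rewrite (cut_level_on (valid_leveled vG) cc).
  by have /andP[_ h1] := bound_prem vG cG cx; move=> h2; lia.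
have sT : tower (2 * i) s <= tower (2 * n) s by apply: tower_mono; lia.
rewrite mulSn; apply: (normalizes_within_mono (m :=
    tower (2 * i) s + k * tower (2 * n) s)).
  by rewrite leq_add2r.
apply: (round_normalizes vG li sz) => G' lev' v' l' sz'.
apply: (IH i.+1) => //; first by rewrite addSn -addnS.
  by rewrite -addn1 PoszD.
by rewrite mulnS add2n !towerS.
Qed.

End Rounds.

(** * From the canonical indexing to levels of wires *)

Section Canonical.
Variables (G : net) (I : edge G -> int).
Implicit Types (l m f w b : node G).

(** Follow the chain outwards from [f]: each box which contains [f] but not [w] carries one of its
    pax links, which preserve the index. *)
Lemma chain_index f w : tidy G -> indexing I -> f \in flats w ->
  I (inr (f, box f)) = I (inr (f, box w)).
Proof.
move=> tG idx fw; have /flatsP[fG ft] := fw.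
have [wG ww win] := tidy_flat tG fG ft.
have [k] := ubnP #|[set b | inside b f]|.
have : (forall b, inside b w -> inside b f) /\ (f = f \/ inside f f) by split; [|left].
(* The induction passes from a link to its innermost box, so it ranges over [f] and the boxes around
   it. *)
have : forall l, l \in links G -> (l = f \/ inside l f) ->
  (forall b, inside b w -> inside b l) -> #|[set b | inside b l]| < k ->
  I (inr (f, box l)) = I (inr (f, box w)); last first.
  by move=> H _ sz; apply: (H f) => //; left.
elim: k => // k IH l lG lf wl sz.
case E: (box l) => [b|]; last first.
  case Ew: (box w) => [b|//].
  by have := wl b (inside_here Ew); rewrite (inside_out _ E).
have bf : inside b f.
  by case: lf => [<-|lf]; [exact: inside_here | exact: inside_trans (inside_here E) lf].
have [bG bo] := tidy_box tG lG E.
have [bw|nbw] := boolP (inside b w).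
  case Ew: (box w) => [b'|]; last by rewrite (inside_out _ Ew) in bw.
  have := wl b' (inside_here Ew); rewrite (inside_step _ E).
  case/orP=> [/eqP->//|b'b]; move: bw; rewrite (inside_step _ Ew) => /orP[/eqP->//|bb'].
  by have := tidy_nested tG bG; rewrite (inside_trans bb' b'b).
have pb : pax f b by apply/paxP; exists w.
rewrite (idx_pax idx pb); apply: IH => //; first by right.
  move=> b' b'w; have := wl b' b'w; rewrite (inside_step _ E) => /orP[/eqP e|//].
  by rewrite e b'w in nbw.
rewrite -ltnS; apply: leq_trans sz; rewrite ltnS; apply/proper_card/properP; split.
  by apply/subsetP => b'; rewrite !inE (inside_step _ E) => ->; rewrite orbT.
exists b; rewrite inE; first exact: inside_here.
exact: (tidy_nested tG bG).
Qed.

Lemma mL3_valid : mL3 G -> canonical I -> valid (fun u => I (inl u)) (level I).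
Proof.
move=> [[wf cor] _] [idx ge0 _]; have tG := well_formed_tidy wf.
split=> //; first exact: correct_coreless.
have bound l u : l \in links G -> u \in conclusion_wires (lab l) ->
    (0 <= I (inl u) <= (level I)%:Z)%R.
  move=> lG ul.
  have eu : inl u \in edges G.
    rewrite in_setU; apply/orP; left; apply/bigcupP; exists l => //.
    by rewrite /conclusions; case: (lab l) ul => //= *; apply: imset_f.
  have I0 := ge0 _ eu; rewrite I0 -(gez0_abs I0) lez_nat.
  by rewrite /level; exact: (@bigop.bigmax_sup _ (inl u : edge G) (fun e =>
      e \in edges G) _ (fun e => absz (I e)) eu (leqnn _)).
split=> [l lG|l u lG].
  have := idx_link idx lG; rewrite /link_constraint /level_constraint.
  case E: (lab l) => [a b|a b|a b c|a b c|a c|a c|a c|c|a w|a c] // -> z lw.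
  have lw' : l \in flats w by apply/flatsP; rewrite lG E.
  have [wG _ _] := tidy_flat tG lG (proj2 (flatsP _ _ lw')).
  (* The flat link constrains the first edge of its chain, the why not link the last one;
     [chain_index] joins them. *)
  have := idx_link idx wG; rewrite /link_constraint lw => /(_ l lw') <-.
  by rewrite (chain_index tG idx lw').
rewrite mem_cat => /orP[ul|]; last exact: bound.
have : u \in all_conclusion_wires G.
  apply: (wf_source wf); apply/flattenP; exists (premise_wires (lab l)) => //.
  by apply: map_f; rewrite mem_enum.
case/flattenP=> _ /mapP[m mG ->] um; apply: (bound m) => //.
by rewrite -mem_enum.
Qed.

End Canonical.

Theorem mainTheorem1 (G : net) (I : edge G -> int) (s l : nat) :
  mL3 G -> canonical I -> s = size_net G -> l = level I ->
  normalizes_within ((l + 1) * tower (2 * l) s) (fun x : wire G => I (inl x)).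
Proof.
move=> mG canI -> ->; have vG := mL3_valid mG canI.
(* Canonical indices are non-negative, so the first round is that of level 0. *)
rewrite addn1; apply: (rounds_normalize (i := 0)) => // c.
case/existsP=> x /existsP[y /redexP[cc _]].
have [cx _] := cut_on_prem cc; have [cG _ _ _ _] := cut_on_link cc.
rewrite (cut_level_on (valid_leveled vG) cc).
by case/andP: (bound_prem vG cG cx).
Qed.
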